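(* Let $X_1,\dots,X_n$ be iid random vectors with a distribution $F$ in $\mathbb{R}^p$. Suppose that there exists a constant $C_1>0$ such that $\Gamma_{(j,k),(j,k)}\ge C_1$ for all $j,k=1,\dots,p$. Let $\alpha,\beta,K\in(0,1)$ and $\tau_*=\beta^{-1}a_{\bar T_n^\sharp}(1-\alpha)$, where the bootstrap samples are generated with Kendall's tau rank correlation coefficient matrix kernel $h$. If $\log^7(np)\le C_2n^{1-K}$ for a constant $C_2>0$, then the test of $$H_0:U_\diamond=U_0\quad\text{versus}\quad H_1:U_\diamond\ne U_0,$$ where $U_\diamond=\mathbb{E}[h(X_1,X_2)]$ and $U_0$ is a known $p\times p$ matrix, that rejects $H_0$ if $\bar T_0'\ge a_{\bar T_n^\sharp}(1-\alpha)$ with $\bar T_0'=|U_n-U_0|_{\infty,\mathrm{off}}$, has the size $\alpha+O(n^{-K/6})$.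
   Context: Throughout $n\ge4$ and $d=p^2\ge3$; $p$ and $F$ may depend on $n$, while the constants $C_1,C_2$ do not depend on $n$ and $d$. For a $p\times p$ matrix $A$, $|A|_{\infty,\mathrm{off}}=\max_{1\le m\ne k\le p}|A_{mk}|$ is the maximum magnitude of the off-diagonal entries. Kendall's tau kernel: $h:\mathbb{R}^p\times\mathbb{R}^p\to\mathbb{R}^{p\times p}$, $h_{mk}(x,y)=\mathbf 1\{(x_m-y_m)(x_k-y_k)>0\}$ for $m,k=1,\dots,p$. The U-statistic $U_n=\frac1{n(n-1)}\sum_{1\le i\ne j\le n}h(X_i,X_j)$ is Kendall's tau rank correlation coefficient matrix. $g(x)=\mathbb{E}[h(x,X_1)]-\mathbb{E}[h(X_1,X_2)]$ and $\Gamma=\mathrm{Cov}(g(X_1))$ is indexed by pairs, so $\Gamma_{(j,k),(j,k)}=\mathrm{Var}(g_{jk}(X_1))$. Bootstrap: $e_1,\dots,e_n$ are iid $N(0,1)$ independent of $X_1,\dots,X_n$, $$T_n^\sharp=\frac1{\sqrt n}\sum_{i=1}^n\Big[\frac1{n-1}\sum_{j\ne i}h(X_i,X_j)-U_n\Big]e_i,\qquad \bar T_n^\sharp=2n^{-1/2}\max_{1\le m,k\le p}|T^\sharp_{n,mk}|,$$ and $a_{\bar T_n^\sharp}(\alpha)=\inf\{t\in\mathbb{R}:\mathbb{P}_e(\bar T_n^\sharp\le t)\ge\alpha\}$ is the conditional $\alpha$-quantile of $\bar T_n^\sharp$ given the data, where $\mathbb{P}_e$ is the probability with respect to $e_1,\dots,e_n$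 only.
   Formalization: As printed, the maximum over all pairs in \bar T_n^\sharp makes the size claim false for data with ties (e.g. p=2, independent Bernoulli(1/4) coordinates); proved here with \bar T_n^\sharp and the bound \Gamma\ge C_1 taken over off-diagonal pairs only, as in \bar T_0'. *)

(* Defs.v *)
From HB Require Import structures.
From mathcomp Require Import all_boot all_order all_algebra.
From mathcomp Require Import all_classical all_reals all_analysis.

Set Implicit Arguments.
Unset Strict Implicit.
Unset Printing Implicit Defensive.

Import Order.TTheory GRing.Theory Num.Theory.
Import numFieldNormedType.Exports.

Local Open Scope classical_set_scope.
Local Open Scope ring_scope.

Definition mutual_independence d (T : measurableType d) (R : realType)
    (P : probability T R) (I : finType) (S : I -> set (set T)) : Prop :=
  forall (J : {set I}) (A : I -> set T),
    (forall i, i \in J -> S i (A i)) ->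
    P (\bigcap_(i in [set` J]) A i) = (\prod_(i in J) P (A i))%E.

Definition sigma_of d d' (T : measurableType d) (T' : measurableType d')
    (X : T -> T') : set (set T) :=
  preimage_set_system setT X measurable.

(* Equality of laws is asked on measurable sets only: the value of a MathComp
   measure on a non-measurable set carries no information. *)
Definition has_law d d' (T : measurableType d) (T' : measurableType d')
    (R : realType) (P : probability T R) (X : {RV P >-> T'})
    (mu : set T' -> \bar R) : Prop :=
  forall A : set T', measurable A -> distribution P X A = mu A.

(* Vectors of R^p are p-tuples, whose library sigma-algebra (generated by the
   coordinates) is the Borel sigma-algebra. *)
Section kendall.
Variables (R : realType) (p : nat).

Definition kendall_kernel (x y : p.-tuple R) : 'M[R]_p :=
  \matrix_(m, k)
    (0 < (tnth x m - tnth y m) * (tnth x k - tnth y k))%R%:R.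

Definition max_off (A : 'M[R]_p) : R :=
  \big[Num.max/0]_(m < p) \big[Num.max/0]_(k < p | m != k) `|A m k|.

Definition U_diamond (F : probability (p.-tuple R) R) : 'M[R]_p :=
  \matrix_(m, k) fine 'E_((F \x F)%E)[fun z => kendall_kernel z.1 z.2 m k].

Definition hajek (F : probability (p.-tuple R) R) (x : p.-tuple R) : 'M[R]_p :=
  \matrix_(m, k)
    (fine 'E_F[fun y => kendall_kernel x y m k] - U_diamond F m k).

Definition Gamma (F : probability (p.-tuple R) R) (a b : 'I_p * 'I_p) : R :=
  fine (covariance F (fun x => hajek F x a.1 a.2)
                     (fun x => hajek F x b.1 b.2)).

Variable n : nat.

Definition U_stat (x : 'I_n -> p.-tuple R) : 'M[R]_p :=
  (n%:R * (n%:R - 1))^-1 *: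
    \sum_(i < n) \sum_(j < n | j != i) kendall_kernel (x i) (x j).

Definition T_sharp (x : 'I_n -> p.-tuple R) (e : 'I_n -> R) : 'M[R]_p :=
  (Num.sqrt n%:R)^-1 *:
    \sum_(i < n) e i *:
      ((n%:R - 1)^-1 *: (\sum_(j < n | j != i) kendall_kernel (x i) (x j))
       - U_stat x).

(* As in the test statistic [max_off (U_stat x - U0)] that this bootstraps, the
   diagonal is left out of the maximum: with ties in the data the diagonal of
   [T_sharp] need not vanish, while without ties it is 0 and the maximum over
   all pairs (m, k) is the same. *)
Definition Tbar_sharp (x : 'I_n -> p.-tuple R) (e : 'I_n -> R) : R :=
  2 * (Num.sqrt n%:R)^-1 * max_off (T_sharp x e).

(* The data [x] are frozen, so [P] only acts on the multipliers [e]; the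
   conditional quantile given X_1, ..., X_n is the value at [x i := X i w]. *)
Definition boot_quantile d (Omega : measurableType d)
    (P : probability Omega R) (e : 'I_n -> Omega -> R)
    (x : 'I_n -> p.-tuple R) (a : R) : R :=
  inf [set t : R |
    (a%:E <= P [set w | Tbar_sharp x (fun i => e i w) <= t]%R)%E].

End kendall.

(* Main.v *)
Require Import Defs.
From HB Require Import structures.
From mathcomp Require Import all_boot all_order all_algebra.
From mathcomp Require Import all_classical all_reals all_analysis.
From mathcomp Require Import measurable_realfun.
From mathcomp Require Import ring lra.

Set Implicit Arguments.
Unset Strict Implicit.
Unset Printing Implicit Defensive.

Import Order.TTheory GRing.Theory Num.Theory.
Import numFieldNormedType.Exports.

Local Open Scope classical_set_scope.
Local Open Scope ring_scope.

(** Hajek's projection turns sqrt(n)/2 (U_n - U) into a normalised sum S of independent, bounded,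
    centred vectors, up to a degenerate double sum of order ln(np)/sqrt(n), controlled by an
    exponential martingale bound after truncation.  With the data frozen, the bootstrap statistic is
    the maximum of a Gaussian vector Y whose covariance is within O(sqrt(ln(np)/n)) of that of S,
    except on an event of probability O(1/(np)).

    For every such data set the laws of max S and max Y are compared directly: both maxima are
    smoothed by a log-sum-exp at scale 1/kappa, and one differentiates along s S + c Y with
    s^2 + c^2 = 1.  Resampling a single observation gives an approximate Stein identity for S, Gaussian
    integration by parts an exact one for Y, and the two second order terms differ only through the
    covariances.  The same identities yield the anti-concentration of the maximum that undoes the
    smoothing.  With eps = (ln^7(np)/n)^(1/6) and kappa = sqrt(ln(np))/eps all errors are O(eps), hence
    O(n^(-K/6)), and the bootstrap quantile inherits the error of the distribution functions. *)

(** The exponent 1/6 relies on never replacing the gauge by its supremum in the comparison. Each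
    remainder is a constant times the gauge at the current point, so every error along the path
    carries the mean of [bump], which anti-concentration makes O(eps); the prefactor need only stay
    bounded. The log-sum-exp overshoots the maximum by at most [ln #|J| / beta]; to keep this
    O(1/[kappa]) one takes [beta = kappa * ln (n p)], and the third order term kappa beta^2 n^(-1/2)
    then equals 1 for the stated [eps]. This is the source of both ln^7 and 1/6. The mean of [bump]
    is needed at every point of the path, at mixtures of S and Y, so an inequality for Gaussian
    maxima alone would not do; the Stein identities cover the mixtures too. Observations and
    multipliers form one sample of pairs. Freezing the data means reading residuals off one point
    [x] and multipliers off another point [y], so no conditional expectation is formed. The
    bootstrap quantile depends on the data in the statistic, but a tail function uniformly close to
    a deterministic one traps it between deterministic levels. *)

Section real_derivatives.
Variable R : realType.
Implicit Types f : R -> R.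

Lemma is_derive_ext f (g : R -> R) (x df dg : R) :
  is_derive x 1 f df -> f =1 g -> df = dg -> is_derive x 1 g dg.
Proof. by move=> h /funext <- <-. Qed.

Lemma is_derive_add f (g : R -> R) (x df dg : R) :
  is_derive x 1 f df -> is_derive x 1 g dg ->
  is_derive x 1 (fun t => f t + g t) (df + dg).
Proof. by move=> hf hg; exact: is_deriveD. Qed.

Lemma is_derive_sub f (g : R -> R) (x df dg : R) :
  is_derive x 1 f df -> is_derive x 1 g dg ->
  is_derive x 1 (fun t => f t - g t) (df - dg).
Proof. by move=> hf hg; exact: is_deriveB. Qed.

Lemma is_derive_const (c x : R) : is_derive x 1 (fun _ : R => c) 0.
Proof. exact: is_derive_cst. Qed.

Lemma is_derive_bigsum (I : Type) (r : seq I) (f df : I -> R -> R) (x : R) :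
  (forall i, is_derive x 1 (f i) (df i x)) ->
  is_derive x 1 (fun t => \sum_(i <- r) f i t) (\sum_(i <- r) df i x).
Proof.
move=> h; elim: r => [|i r ih].
  apply: (is_derive_ext (is_derive_const 0 x)); last by rewrite big_nil.
  by move=> t; rewrite big_nil.
apply: (is_derive_ext (is_derive_add (h i) ih)); last by rewrite big_cons.
by move=> t; rewrite big_cons.
Qed.

Lemma is_derive_mul f (g : R -> R) (x df dg : R) :
  is_derive x 1 f df -> is_derive x 1 g dg ->
  is_derive x 1 (fun t => f t * g t) (f x * dg + g x * df).
Proof. by move=> hf hg; exact: is_deriveM. Qed.

Lemma is_derive_comp f (g : R -> R) (x df dg : R) :
  is_derive (g x) 1 f df -> is_derive x 1 g dg ->
  is_derive x 1 (fun t => f (g t)) (df * dg).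
Proof. by move=> hf hg; exact: (is_derive1_comp hf hg). Qed.

Lemma is_derive_cmul (k : R) f (x df : R) :
  is_derive x 1 f df -> is_derive x 1 (fun t => k * f t) (k * df).
Proof. by move=> hf; exact: is_deriveZ. Qed.

Lemma is_derive_inv f (x df : R) : is_derive x 1 f df -> f x != 0 ->
  is_derive x 1 (fun t => (f t)^-1) (- (f x) ^- 2 * df).
Proof. by move=> hf f0; exact: is_deriveV. Qed.

Lemma MVT_is_derive f (df : R -> R) (a b : R) : a <= b ->
  (forall x : R, is_derive x 1 f (df x)) ->
  exists2 c, a <= c <= b & f b - f a = df c * (b - a).
Proof.
move=> ab h.
have hc : {within `[a, b], continuous f}.
  by apply: derivable_within_continuous => x _; apply: ex_derive.
have [c] := @MVT_segment R f df a b ab (fun x _ => h x) hc.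
by rewrite in_itv /= => cab e; exists c.
Qed.

(* Two applications of the mean value theorem: the factor 1/2 of Taylor's
   formula is given up. *)
Lemma taylor2_le f (df ddf : R -> R) (M : R) :
  (forall x : R, is_derive x 1 f (df x)) ->
  (forall x : R, is_derive x 1 df (ddf x)) ->
  (forall x, 0 <= x <= 1 -> `|ddf x| <= M) ->
  `|f 1 - f 0 - df 0| <= M.
Proof.
move=> h1 h2 hM.
have [c /andP[c0 c1]] := MVT_is_derive ler01 h1.
rewrite subr0 mulr1 => ->.
have [e /andP[e0 ec]] := MVT_is_derive c0 h2.
rewrite subr0 => ->.
have e1 : 0 <= e <= 1 by rewrite e0 (le_trans ec c1).
rewrite normrM (ger0_norm c0) -[leRHS]mulr1 ler_pM//; exact: hM.
Qed.

End real_derivatives.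

(** * Smooth approximation of the maximum *)

Section tame_gauge.
Variable R : realType.

(** [A1] and [A2] are the first two derivatives, and every bound is relative to [A] at the same
    point, so that a Taylor remainder integrates to a multiple of the mean of [A]. Two gauges occur:
    [sigmoid] for the anti-concentration and its derivative [bump] for the comparison. *)
Record tame (A A1 A2 : R -> R) : Prop := Tame {
  tame_ge0 : forall x, 0 <= A x;
  tame_le1 : forall x, A x <= 1;
  tame_der1 : forall x : R, is_derive x 1 A (A1 x);
  tame_der2 : forall x : R, is_derive x 1 A1 (A2 x);
  tame_le_der1 : forall x, `|A1 x| <= A x;
  tame_le_der2 : forall x, `|A2 x| <= A x;
  tame_stable : forall x h, A (x + h) <= expR (2 * `|h|) * A x }.

Definition sigmoid (x : R) : R := (1 + expR (- x))^-1.
Definition bump (x : R) : R := sigmoid x * (1 - sigmoid x).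

Lemma sigmoid_gt0 x : 0 < sigmoid x.
Proof. by rewrite invr_gt0 addr_gt0// expR_gt0. Qed.

Lemma sigmoid_lt1 x : sigmoid x < 1.
Proof. by rewrite invf_lt1 ?addr_gt0 ?expR_gt0// ltrDl expR_gt0. Qed.

Lemma sigmoidN x : sigmoid (- x) = 1 - sigmoid x.
Proof.
rewrite /sigmoid opprK.
have e : expR x * expR (- x) = 1 by rewrite -expRD subrr expR0.
have h1 : 1 + expR x != 0 by rewrite gt_eqF// addr_gt0// expR_gt0.
have h2 : 1 + expR (- x) != 0 by rewrite gt_eqF// addr_gt0// expR_gt0.
have : (1 + expR x)^-1 + (1 + expR (- x))^-1 = 1; last by lra.
rewrite -[X in X + _]mul1r -[X in _ + X]mul1r addf_div//.
by rewrite -[RHS](divff (mulf_neq0 h1 h2)); congr (_ / _); ring: e.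
Qed.

Lemma bump_gt0 x : 0 < bump x.
Proof. by rewrite mulr_gt0 ?sigmoid_gt0// subr_gt0 sigmoid_lt1. Qed.

Lemma sigmoid_homo x y : x <= y -> sigmoid x <= sigmoid y.
Proof.
move=> xy; rewrite lef_pV2 ?posrE ?addr_gt0 ?expR_gt0//.
by rewrite lerD2l ler_expR lerN2.
Qed.

Lemma sigmoid_stable x h : sigmoid (x + h) <= expR `|h| * sigmoid x.
Proof.
rewrite /sigmoid ler_pdivlMr ?addr_gt0 ?expR_gt0// mulrC.
rewrite ler_pdivrMr ?addr_gt0 ?expR_gt0// mulrDr mulr1 -expRD lerD//.
  by rewrite -expR0 ler_expR.
by rewrite ler_expR opprD; have := ler_norm h; lra.
Qed.

(** As [bump x = sigmoid x * sigmoid (- x)], a shift by [h] changes each of two factors by at most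
    [expR |h|]; this is the 2 in [tame_stable]. *)
Lemma bump_stable x h : bump (x + h) <= expR (2 * `|h|) * bump x.
Proof.
rewrite /bump -!sigmoidN opprD mulr_natl mulr2n expRD mulrACA.
rewrite ler_pM ?(ltW (sigmoid_gt0 _)) ?sigmoid_stable//.
by rewrite -{2}[h]opprK normrN sigmoid_stable.
Qed.

Lemma is_derive_sigmoid (x : R) : is_derive x 1 sigmoid (bump x).
Proof.
have h0 : 1 + expR (- x) != 0 by rewrite gt_eqF// addr_gt0// expR_gt0.
have h : is_derive x 1 (fun t : R => 1 + expR (- t)) (- expR (- x)).
  have h1 := is_derive_comp (is_derive_expR (- x)) (is_deriveNid x 1).
  by apply: (is_derive_ext (is_derive_add (is_derive_const 1 x) h1)) => //=; lra.
apply: (is_derive_ext (is_derive_inv h h0)) => //=.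
by rewrite /bump /sigmoid; field.
Qed.

Lemma is_derive_bump (x : R) :
  is_derive x 1 bump (bump x * (1 - 2 * sigmoid x)).
Proof.
have h1 := is_derive_sigmoid x.
have h2 := is_derive_sub (is_derive_const 1 x) h1.
apply: (is_derive_ext (is_derive_mul h1 h2)) => //=.
by rewrite /bump; ring.
Qed.

Lemma is_derive_bump1 (x : R) :
  is_derive x 1 (fun t => bump t * (1 - 2 * sigmoid t))
    (bump x * (1 - 6 * bump x)).
Proof.
have h1 := is_derive_cmul 2 (is_derive_sigmoid x).
have h2 := is_derive_sub (is_derive_const 1 x) h1.
apply: (is_derive_ext (is_derive_mul (is_derive_bump x) h2)) => //=.
by rewrite /bump; ring.
Qed.

Lemma tame_sigmoid :
  tame sigmoid bump (fun x => bump x * (1 - 2 * sigmoid x)).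
Proof.
split.
- by move=> x; exact/ltW/sigmoid_gt0.
- by move=> x; exact/ltW/sigmoid_lt1.
- exact: is_derive_sigmoid.
- exact: is_derive_bump.
- move=> x; rewrite gtr0_norm ?bump_gt0//.
  by rewrite /bump; have := sigmoid_gt0 x; have := sigmoid_lt1 x; nra.
- move=> x; have b0 := bump_gt0 x; have s0 := sigmoid_gt0 x.
  have s1 := sigmoid_lt1 x.
  rewrite normrM gtr0_norm//; apply: (@le_trans _ _ (bump x * 1)).
    by rewrite ler_pM2l// ler_norml; lra.
  by rewrite mulr1 /bump; nra.
- move=> x h; apply: le_trans (sigmoid_stable x h) _.
  rewrite ler_wpM2r ?(ltW (sigmoid_gt0 x))// ler_expR.
  by have := normr_ge0 h; lra.
Qed.

Lemma tame_bump :
  tame bump (fun x => bump x * (1 - 2 * sigmoid x))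
    (fun x => bump x * (1 - 6 * bump x)).
Proof.
split.
- by move=> x; exact/ltW/bump_gt0.
- by move=> x; rewrite /bump; have := sigmoid_gt0 x; have := sigmoid_lt1 x; nra.
- exact: is_derive_bump.
- exact: is_derive_bump1.
- move=> x; have b0 := bump_gt0 x; have s0 := sigmoid_gt0 x.
  have s1 := sigmoid_lt1 x.
  rewrite normrM gtr0_norm// -[leRHS]mulr1.
  by rewrite ler_pM2l// ler_norml; lra.
- move=> x; have b0 := bump_gt0 x; have s0 := sigmoid_gt0 x.
  have s1 := sigmoid_lt1 x.
  rewrite normrM gtr0_norm// -[leRHS]mulr1 ler_pM2l// ler_norml.
  (* A product [s * (1 - s)] is at most 1/4, hence [1 - 6 * bump x] lies between -1/2 and 1. *)
  have : bump x <= 1 / 4 by have := sqr_ge0 (1 - 2 * sigmoid x); rewrite /bump; nra.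
  by lra.
- exact: bump_stable.
Qed.

End tame_gauge.

Section softmax.
Variables (R : realType) (J : finType) (j0 : J) (beta : R).
Hypothesis beta_gt0 : 0 < beta.
Implicit Types (y w u : J -> R).

(** [softmax] is the gradient of [lse]. Along a curve, first derivatives are means under these
    weights and derivatives of means are [beta] times covariances; the weights sum to 1, so the
    bounds on them do not depend on the cardinality of [J]. *)
Definition partition_sum y : R := \sum_j expR (beta * y j).
Definition softmax y (j : J) : R := expR (beta * y j) / partition_sum y.
Definition mean y w : R := \sum_j softmax y j * w j.
Definition cov y w u : R := mean y (fun j => w j * u j) - mean y w * mean y u.
Definition lse y : R := ln (partition_sum y) / beta.

Lemma partition_sum_gt0 y : 0 < partition_sum y.
Proof.
rewrite /partition_sum (bigD1 j0)//= ltr_pwDl ?expR_gt0// sumr_ge0//.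
Qed.

Lemma softmax_ge0 y j : 0 <= softmax y j.
Proof. by rewrite divr_ge0 ?expR_ge0// ltW// partition_sum_gt0. Qed.

Lemma sum_softmax y : \sum_j softmax y j = 1.
Proof. by rewrite -mulr_suml divff ?gt_eqF ?partition_sum_gt0. Qed.

Lemma mean_cst y c : mean y (fun=> c) = c.
Proof. by rewrite /mean -mulr_suml sum_softmax mul1r. Qed.

Lemma meanD y w u : mean y (fun j => w j + u j) = mean y w + mean y u.
Proof. by rewrite /mean -big_split; apply: eq_bigr => j _; rewrite mulrDr. Qed.

Lemma meanZ y c w : mean y (fun j => c * w j) = c * mean y w.
Proof. by rewrite /mean mulr_sumr; apply: eq_bigr => j _; rewrite mulrCA. Qed.

Lemma mean_sum y (I : Type) (r : seq I) (w : I -> J -> R) :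
  mean y (fun j => \sum_(i <- r) w i j) = \sum_(i <- r) mean y (w i).
Proof.
rewrite /mean exchange_big; apply: eq_bigr => j _; by rewrite mulr_sumr.
Qed.

Lemma le_mean y w u : (forall j, w j <= u j) -> mean y w <= mean y u.
Proof.
by move=> h; apply: ler_sum => j _; rewrite ler_wpM2l ?softmax_ge0.
Qed.

Lemma normr_mean_le y w (a : R) : (forall j, `|w j| <= a) -> `|mean y w| <= a.
Proof.
move=> h; rewrite ler_norml -(mean_cst y (- a)) -{2}(mean_cst y a).
by rewrite !le_mean// => j; have := h j; rewrite ler_norml => /andP[].
Qed.

Lemma cov_self_ge0 y w : 0 <= cov y w w.
Proof.
have : 0 <= mean y (fun j => (w j + (- mean y w)) * (w j + (- mean y w))).
  by apply: sumr_ge0 => j _; rewrite mulr_ge0 ?softmax_ge0// -expr2 sqr_ge0.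
have -> : (fun j => (w j + (- mean y w)) * (w j + (- mean y w))) =
  (fun j => w j * w j + ((- 2 * mean y w) * w j + mean y w * mean y w)).
  by apply/funext => j; ring.
by rewrite !meanD mean_cst meanZ /cov; lra.
Qed.

Lemma normr_cov_le y w u (a b : R) : (forall j, `|w j| <= a) ->
  (forall j, `|u j| <= b) -> `|cov y w u| <= 2 * (a * b).
Proof.
move=> ha hb; rewrite /cov (le_trans (ler_normB _ _))// mulr_natl mulr2n lerD//.
  by apply: normr_mean_le => j; rewrite normrM ler_pM.
by rewrite normrM ler_pM// normr_mean_le.
Qed.

Lemma lse_ge y j : y j <= lse y.
Proof.
rewrite /lse ler_pdivlMr// -ler_expR lnK ?posrE ?partition_sum_gt0// mulrC.
rewrite /partition_sum (bigD1 j)//= lerDl sumr_ge0//.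
Qed.

Lemma lse_le y (M : R) : (forall j, y j <= M) ->
  lse y <= M + ln #|J|%:R / beta.
Proof.
move=> h; have J0 : (0 : R) < #|J|%:R.
  by rewrite ltr0n; apply/card_gt0P; exists j0.
have -> : M + ln #|J|%:R / beta = (beta * M + ln #|J|%:R) / beta.
  by rewrite mulrDl mulrAC divff ?gt_eqF// mul1r.
rewrite /lse ler_pM2r ?invr_gt0//.
rewrite -ler_expR lnK ?posrE ?partition_sum_gt0// expRD lnK ?posrE//.
rewrite /partition_sum -sum1_card natr_sum mulr_sumr; apply: ler_sum => j _.
by rewrite mulr1 ler_expR ler_pM2l.
Qed.

Lemma lse_shift y c : lse (fun j => y j + c) = lse y + c.
Proof.
rewrite /lse; have -> : partition_sum (fun j => y j + c) =
   expR (beta * c) * partition_sum y.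
  rewrite /partition_sum mulr_sumr; apply: eq_bigr => j _.
  by rewrite -expRD; congr expR; ring.
rewrite lnM ?posrE ?partition_sum_gt0 ?expR_gt0// expRK.
by field; rewrite gt_eqF.
Qed.

Lemma le_lse y w : (forall j, y j <= w j) -> lse y <= lse w.
Proof.
move=> h; rewrite /lse ler_pM2r ?invr_gt0// ler_ln ?posrE ?partition_sum_gt0//.
by apply: ler_sum => j _; rewrite ler_expR ler_pM2l.
Qed.

(** [lse] is monotone and commutes with adding a constant, which makes it 1-Lipschitz for the sup
    norm without any differentiation. *)
Lemma lse_lipschitz y w (a : R) : (forall j, `|y j - w j| <= a) ->
  `|lse y - lse w| <= a.
Proof.
move=> h; rewrite ler_norml; apply/andP; split.
  rewrite lerBrDr addrC -lerBrDr opprK -lse_shift; apply: le_lse => j.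
  by have := h j; rewrite ler_norml; lra.
rewrite lerBlDr addrC -lse_shift; apply: le_lse => j.
by have := h j; rewrite ler_norml; lra.
Qed.

Section curve.
Variables (Y Y' : R -> J -> R) (x : R).
Hypothesis dY : forall j, is_derive x 1 (fun t => Y t j) (Y' x j).

Lemma is_derive_expY j :
  is_derive x 1 (fun t => expR (beta * Y t j))
    (expR (beta * Y x j) * (beta * Y' x j)).
Proof.
exact: is_derive_comp (is_derive_expR _) (is_derive_cmul beta (dY j)).
Qed.

Lemma is_derive_sum_expY (w : J -> R) :
  is_derive x 1 (fun t => \sum_j expR (beta * Y t j) * w j)
    (beta * \sum_j expR (beta * Y x j) * (w j * Y' x j)).
Proof.
have h j : is_derive x 1 (fun t => expR (beta * Y t j) * w j)
   (expR (beta * Y x j) * (beta * Y' x j) * w j).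
  apply: (is_derive_ext (is_derive_mul (is_derive_expY j) (is_derive_const (w j) x))) => //.
  by rewrite mulr0 add0r mulrC.
apply: (is_derive_ext (is_derive_bigsum (index_enum J)
   (df := fun j (t : R) => expR (beta * Y x j) * (beta * Y' x j) * w j) h)) => //.
by rewrite mulr_sumr; apply: eq_bigr => j _; ring.
Qed.

Lemma is_derive_partition_sum :
  is_derive x 1 (fun t => partition_sum (Y t))
    (partition_sum (Y x) * (beta * mean (Y x) (Y' x))).
Proof.
apply: (is_derive_ext (is_derive_sum_expY (fun=> 1))).
  by move=> t; apply: eq_bigr => j _; rewrite mulr1.
rewrite mulrCA; congr (_ * _); rewrite /mean /softmax mulr_sumr.
apply: eq_bigr => j _; rewrite mul1r.
by field; rewrite gt_eqF// partition_sum_gt0.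
Qed.

Lemma is_derive_lse :
  is_derive x 1 (fun t => lse (Y t)) (mean (Y x) (Y' x)).
Proof.
have h := is_derive1_ln (partition_sum_gt0 (Y x)).
have h2 := is_derive_cmul beta^-1 (is_derive_comp h is_derive_partition_sum).
apply: (is_derive_ext h2); first by move=> t; rewrite /lse mulrC.
by field; rewrite !gt_eqF// partition_sum_gt0.
Qed.

Lemma is_derive_mean w :
  is_derive x 1 (fun t => mean (Y t) w) (beta * cov (Y x) w (Y' x)).
Proof.
have P0 := partition_sum_gt0 (Y x); have Pn0 : partition_sum (Y x) != 0 by rewrite gt_eqF.
have h := is_derive_mul (is_derive_sum_expY w)
   (is_derive_inv is_derive_partition_sum Pn0).
apply: (is_derive_ext h).
  by move=> t; rewrite /mean mulr_suml; apply: eq_bigr => j _; rewrite mulrAC.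
have e u : \sum_j expR (beta * Y x j) * u j = partition_sum (Y x) * mean (Y x) u.
  rewrite /mean mulr_sumr; apply: eq_bigr => j _.
  by rewrite /softmax; field.
by rewrite /= !e /cov; field.
Qed.

End curve.

Lemma is_derive_cov (Y Y' : R -> J -> R) (x : R) w u :
  (forall j, is_derive x 1 (fun t => Y t j) (Y' x j)) ->
  is_derive x 1 (fun t => cov (Y t) w u)
    (beta * (cov (Y x) (fun j => w j * u j) (Y' x) -
       (mean (Y x) w * cov (Y x) u (Y' x) + mean (Y x) u * cov (Y x) w (Y' x)))).
Proof.
move=> dY.
have h := is_derive_sub (is_derive_mean dY (fun j => w j * u j))
  (is_derive_mul (is_derive_mean dY w) (is_derive_mean dY u)).
apply: (is_derive_ext h) => //; ring.
Qed.

Section field.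
Variables (A A1 A2 : R -> R) (kappa t : R).
Hypothesis tA : tame A A1 A2.
Hypothesis kappa_gt0 : 0 < kappa.
Hypothesis kappa_beta : kappa <= beta.

(** For [A := bump], [kappa * sfield y w] is the derivative of the smoothed indicator
    [sigmoid (arg y)] in direction [w]; for [A := sigmoid], the field is the gradient of a smoothed
    positive part of [lse y - t]. [dfield] differentiates once more, in direction [u]. *)
Definition arg y := kappa * (lse y - t).
Definition sfield y w := A (arg y) * mean y w.
Definition dfield y w u :=
  kappa * A1 (arg y) * (mean y u * mean y w) + beta * A (arg y) * cov y w u.

Lemma is_derive_arg (Y Y' : R -> J -> R) (x : R) :
  (forall j, is_derive x 1 (fun s => Y s j) (Y' x j)) ->
  is_derive x 1 (fun s => arg (Y s)) (kappa * mean (Y x) (Y' x)).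
Proof.
move=> dY; have h := is_derive_sub (is_derive_lse dY) (is_derive_const t x).
by apply: (is_derive_ext (is_derive_cmul kappa h)) => //; rewrite subr0.
Qed.

Lemma is_derive_line y u (x : R) j :
  is_derive x 1 (fun s => y j + s * u j) (u j).
Proof.
have h := is_derive_add (is_derive_const (y j) x)
  (is_derive_mul (is_derive_id x 1) (is_derive_const (u j) x)).
by apply: (is_derive_ext h) => //; rewrite mulr0 !add0r mulr1.
Qed.

Lemma is_derive_sfield y w u (x : R) :
  is_derive x 1 (fun s => sfield (fun j => y j + s * u j) w)
    (dfield (fun j => y j + x * u j) w u).
Proof.
set Y := fun (s : R) j => y j + s * u j.
have dY j : is_derive x 1 (fun s => Y s j) (u j) by exact: is_derive_line.
have h1 := @is_derive_comp R A (fun s => arg (Y s)) x _ _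
   (tame_der1 tA (arg (Y x))) (is_derive_arg (Y' := fun=> u) dY).
apply: (is_derive_ext (is_derive_mul h1 (is_derive_mean (Y' := fun=> u) dY w))) => //.
by rewrite /dfield -/(Y x); ring.
Qed.

Definition ddfield y w u :=
  kappa * (A2 (arg y) * (kappa * mean y u)) * (mean y u * mean y w) +
  kappa * A1 (arg y) *
    (mean y u * (beta * cov y w u) + mean y w * (beta * cov y u u)) +
  (beta * (A1 (arg y) * (kappa * mean y u)) * cov y w u +
   beta * A (arg y) * (beta * (cov y (fun j => w j * u j) u -
       (mean y w * cov y u u + mean y u * cov y w u)))).

Lemma is_derive_dfield y w u (x : R) :
  is_derive x 1 (fun s => dfield (fun j => y j + s * u j) w u)
    (ddfield (fun j => y j + x * u j) w u).
Proof.
set Y := fun (s : R) j => y j + s * u j.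
have dY j : is_derive x 1 (fun s => Y s j) (u j) by exact: is_derive_line.
have da := is_derive_arg (Y' := fun=> u) dY.
have dA := @is_derive_comp R A (fun s => arg (Y s)) x _ _ (tame_der1 tA (arg (Y x))) da.
have dA1 := @is_derive_comp R A1 (fun s => arg (Y s)) x _ _ (tame_der2 tA (arg (Y x))) da.
have dm v := is_derive_mean (Y' := fun=> u) dY v.
have dc := is_derive_cov (Y' := fun=> u) w u dY.
have h := is_derive_add
  (is_derive_mul (is_derive_cmul kappa dA1) (is_derive_mul (dm u) (dm w)))
  (is_derive_mul (is_derive_cmul beta dA) dc).
apply: (is_derive_ext h) => //.
by rewrite /ddfield -/(Y x); ring.
Qed.

Lemma ddfield_le y w u (a : R) : (forall j, `|w j| <= 1) ->
  (forall j, `|u j| <= a) ->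
  `|ddfield y w u| <= 13 * (beta ^+ 2 * a ^+ 2) * A (arg y).
Proof.
move=> hw hu.
have a0 : 0 <= a by apply: le_trans (hu j0); exact: normr_ge0.
have A0 := tame_ge0 tA (arg y).
have hA1 := tame_le_der1 tA (arg y).
have hA2 := tame_le_der2 tA (arg y).
have mu := normr_mean_le y hu.
have mw := normr_mean_le y hw.
have cwu := normr_cov_le y hw hu; rewrite mul1r in cwu.
have cuu := normr_cov_le y hu hu.
have hwu j : `|w j * u j| <= a.
  by rewrite normrM -[leRHS]mul1r ler_pM.
have cwuu := normr_cov_le y hwu hu.
have k0 := ltW kappa_gt0; have b0 := ltW beta_gt0.
have kb : kappa * beta <= beta ^+ 2 by rewrite expr2 ler_pM.
have kk : kappa ^+ 2 <= beta ^+ 2 by rewrite ler_sqr ?nnegrE.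
have M (x1 x2 y1 y2 : R) : `|x1| <= y1 -> `|x2| <= y2 -> `|x1 * x2| <= y1 * y2 :> R.
  by move=> h1 h2; rewrite normrM ler_pM.
have D (x1 x2 y1 y2 : R) : `|x1| <= y1 -> `|x2| <= y2 -> `|x1 + x2| <= y1 + y2 :> R.
  by move=> h1 h2; rewrite (le_trans (ler_normD _ _))// lerD.
have B (x1 x2 y1 y2 : R) : `|x1| <= y1 -> `|x2| <= y2 -> `|x1 - x2| <= y1 + y2 :> R.
  by move=> h1 h2; rewrite (le_trans (ler_normB _ _))// lerD.
have kn : `|kappa| <= kappa by rewrite ger0_norm.
have bn : `|beta| <= beta by rewrite ger0_norm.
have An : `|A (arg y)| <= A (arg y) by rewrite ger0_norm.
rewrite /ddfield.
set c1 := cov y (fun j => _) u in cwuu *.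
(* The term follows the syntax tree of [ddfield]. Collecting gives the weights 1, 6 and 6 for
   [kappa ^+ 2], [kappa * beta] and [beta ^+ 2]; with [kappa <= beta] they add up to 13. *)
have H := D _ _ _ _ (D _ _ _ _
   (M _ _ _ _ (M _ _ _ _ kn (M _ _ _ _ hA2 (M _ _ _ _ kn mu))) (M _ _ _ _ mu mw))
   (M _ _ _ _ (M _ _ _ _ kn hA1) (D _ _ _ _
      (M _ _ _ _ mu (M _ _ _ _ bn cwu)) (M _ _ _ _ mw (M _ _ _ _ bn cuu)))))
  (D _ _ _ _ (M _ _ _ _ (M _ _ _ _ bn (M _ _ _ _ hA1 (M _ _ _ _ kn mu))) cwu)
     (M _ _ _ _ (M _ _ _ _ bn An) (M _ _ _ _ bn (B _ _ _ _ cwuu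
        (D _ _ _ _ (M _ _ _ _ mw cuu) (M _ _ _ _ mu cwu)))))).
apply: le_trans H _.
set Ay := A (arg y) in A0 *.
rewrite [leLHS](_ : _ = (kappa ^+ 2 + 6 * (kappa * beta) + 6 * beta ^+ 2) *
   (a ^+ 2 * Ay)); last by ring.
rewrite [leRHS](_ : _ = (13 * beta ^+ 2) * (a ^+ 2 * Ay)); last by ring.
rewrite ler_wpM2r ?mulr_ge0 ?sqr_ge0//; lra.
Qed.

(** The second derivative is controlled by the gauge at an intermediate point. As [lse] is
    1-Lipschitz, [arg] moves by at most [kappa * a], and [tame_stable] brings the gauge back to the
    base point [y]. *)
Lemma sfield_taylor y w u (a : R) : (forall j, `|w j| <= 1) ->
  (forall j, `|u j| <= a) ->
  `|sfield (fun j => y j + u j) w - sfield y w - dfield y w u| <=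
    13 * (beta ^+ 2 * a ^+ 2) * (expR (2 * (kappa * a)) * A (arg y)).
Proof.
move=> hw hu.
have a0 : 0 <= a by apply: le_trans (hu j0); exact: normr_ge0.
have := @taylor2_le R (fun s => sfield (fun j => y j + s * u j) w)
  (fun s => dfield (fun j => y j + s * u j) w u)
  (fun s => ddfield (fun j => y j + s * u j) w u)
  (13 * (beta ^+ 2 * a ^+ 2) * (expR (2 * (kappa * a)) * A (arg y)))
  (is_derive_sfield y w u) (is_derive_dfield y w u).
have -> : (fun j => y j + 1 * u j) = (fun j => y j + u j).
  by apply/funext => j; rewrite mul1r.
have -> : (fun j => y j + 0 * u j) = y.
  by apply/funext => j; rewrite mul0r addr0.
apply=> x /andP[x0 x1].
set z := fun j => y j + x * u j.
apply: le_trans (ddfield_le z hw hu) _.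
rewrite ler_wpM2l ?mulr_ge0 ?(ltW beta_gt0)//.
have lz : `|lse z - lse y| <= a.
  apply: lse_lipschitz => j; rewrite /z addrC addKr normrM (ger0_norm x0).
  by rewrite -[leRHS]mul1r ler_pM.
have -> : arg z = arg y + kappa * (lse z - lse y) by rewrite /arg; ring.
apply: le_trans (tame_stable tA _ _) _.
rewrite ler_wpM2r ?(tame_ge0 tA)// ler_expR ler_pM2l// normrM (gtr0_norm kappa_gt0).
by rewrite ler_pM2l.
Qed.

(* [hform y M] contracts the Jacobian of [y |-> (sfield y e_j)_j] with the
   matrix [M]; for a rank one [M] it is [dfield]. *)
Definition hform y (M : J -> J -> R) : R :=
  kappa * A1 (arg y) * (\sum_j \sum_k softmax y j * softmax y k * M j k) +
  beta * A (arg y) *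
   (\sum_j softmax y j * M j j - \sum_j \sum_k softmax y j * softmax y k * M j k).

Lemma dfieldE y w u : dfield y w u = hform y (fun j k => w j * u k).
Proof.
have e : \sum_j \sum_k softmax y j * softmax y k * (w j * u k) = mean y w * mean y u.
  rewrite /mean mulr_suml; apply: eq_bigr => j _; rewrite mulr_sumr.
  by apply: eq_bigr => k _; ring.
rewrite /dfield /hform !e /cov -/(mean y (fun j => w j * u j)); ring.
Qed.

Lemma hform_sum y (I : Type) (r : seq I) (M : I -> J -> J -> R) :
  hform y (fun j k => \sum_(i <- r) M i j k) = \sum_(i <- r) hform y (M i).
Proof.
rewrite /hform big_split -!mulr_sumr sumrB /=.
have e : \sum_j \sum_k softmax y j * softmax y k * (\sum_(i <- r) M i j k) =
   \sum_(i <- r) \sum_j \sum_k softmax y j * softmax y k * M i j k.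
  rewrite [RHS]exchange_big; apply: eq_bigr => j _; rewrite [RHS]exchange_big.
  by apply: eq_bigr => k _; rewrite mulr_sumr.
rewrite !e; congr (_ + _ * (_ - _)).
by rewrite [RHS]exchange_big; apply: eq_bigr => j _; rewrite mulr_sumr.
Qed.

Lemma hformD y (M N : J -> J -> R) :
  hform y (fun j k => M j k + N j k) = hform y M + hform y N.
Proof.
have := hform_sum y [:: true; false] (fun b => if b then M else N).
rewrite !big_cons big_nil addr0 => <-; congr hform; apply/funext => j.
by apply/funext => k; rewrite !big_cons big_nil addr0.
Qed.

Lemma hformZ y c (M : J -> J -> R) :
  hform y (fun j k => c * M j k) = c * hform y M.
Proof.
have e : \sum_j \sum_k softmax y j * softmax y k * (c * M j k) =
   c * \sum_j \sum_k softmax y j * softmax y k * M j k.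
  rewrite mulr_sumr; apply: eq_bigr => j _; rewrite mulr_sumr.
  by apply: eq_bigr => k _; ring.
have e2 : \sum_j softmax y j * (c * M j j) = c * \sum_j softmax y j * M j j.
  by rewrite mulr_sumr; apply: eq_bigr => j _; ring.
by rewrite /hform e e2; ring.
Qed.

Lemma softmax2_sum_le y (M : J -> J -> R) a : (forall j k, `|M j k| <= a) ->
  `|\sum_j \sum_k softmax y j * softmax y k * M j k| <= a.
Proof.
move=> h; have -> : \sum_j \sum_k softmax y j * softmax y k * M j k =
   mean y (fun j => mean y (M j)).
  rewrite /mean; apply: eq_bigr => j _; rewrite mulr_sumr.
  by apply: eq_bigr => k _; rewrite mulrA.
by apply: normr_mean_le => j; apply: normr_mean_le => k.
Qed.

(** The 3 counts one average with weight [kappa <= beta] and two averages with weight [beta]. *)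
Lemma hform_le y (M : J -> J -> R) a : (forall j k, `|M j k| <= a) ->
  `|hform y M| <= 3 * beta * a * A (arg y).
Proof.
move=> h; have h1 := softmax2_sum_le y h.
have h2 : `|\sum_j softmax y j * M j j| <= a by apply: (normr_mean_le y (w := fun j => M j j)).
have A0 := tame_ge0 tA (arg y).
have hA1 := tame_le_der1 tA (arg y).
have a0 : 0 <= a by apply: le_trans h2; exact: normr_ge0.
rewrite /hform (le_trans (ler_normD _ _))//.
rewrite [leRHS](_ : _ = beta * A (arg y) * a + beta * A (arg y) * (a + a)); last by ring.
apply: lerD; rewrite !normrM ?(gtr0_norm beta_gt0) ?(gtr0_norm kappa_gt0).
  rewrite ler_pM ?mulr_ge0 ?normr_ge0 ?(ltW kappa_gt0)//.
  by rewrite ler_pM ?(ltW kappa_gt0).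
rewrite (ger0_norm A0) ler_wpM2l ?mulr_ge0 ?(ltW beta_gt0)//.
by rewrite (le_trans (ler_normB _ _))// lerD.
Qed.

End field.

Section lower_bound.
Variables (kappa t : R).
Hypothesis kappa_gt0 : 0 < kappa.
Hypothesis kappa_beta : kappa <= beta.

(* The two nonnegative parts of the form, the [mean]-variance of [M] and the
   remaining average of the diagonal, enter with weights that are both at
   least [kappa * bump]; their sum is an average of the diagonal. *)
Lemma hform_sigmoid_ge y (M : J -> J -> R) (c : R) :
  (forall j, c <= M j j) -> 0 <= c ->
  \sum_j \sum_k softmax y j * softmax y k * M j k <= \sum_j softmax y j * M j j ->
  0 <= \sum_j \sum_k softmax y j * softmax y k * M j k ->
  kappa * c * bump (arg kappa t y) <=
  hform (@sigmoid R) (@bump R) kappa t y M.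
Proof.
move=> hM c0; set V := \sum_j \sum_k _; set D := \sum_j _ => VD V0.
have cD : c <= D by rewrite -(mean_cst y c); apply: le_mean.
rewrite /hform -/V -/D; set b := bump _; set s := sigmoid _.
have b0 : 0 < b := bump_gt0 _.
have s0 : 0 < s := sigmoid_gt0 _.
have s1 : s < 1 := sigmoid_lt1 _.
have bs : b <= s by rewrite /b /bump -/s; nra.
have kb : kappa * b <= beta * s by rewrite ler_pM// ltW.
have : kappa * b * (D - V) <= beta * s * (D - V) by rewrite ler_wpM2r// subr_ge0.
have : kappa * b * c <= kappa * b * D by rewrite ler_wpM2l// mulr_ge0// ltW.
nra.
Qed.

End lower_bound.

End softmax.

(** * Gaussian integrals *)

Section normal_density.
Variable R : realType.
Notation leb := (@lebesgue_measure R).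
Notation N01 := (@normal_prob R 0 1).
Local Open Scope ereal_scope.

(** Change of measure comes with the abstract Radon-Nikodym derivative, which agrees almost
    everywhere with the density because both integrate to [N01] over every measurable set. *)
Lemma ge0_integral_normal (f : measurableTypeR R -> \bar R) :
  measurable_fun setT f -> (forall x, 0 <= f x) ->
  \int[N01]_x f x = \int[leb]_x (f x * (normal_pdf 0 1 x)%:E).
Proof.
move=> mf f0.
have dom : N01 `<< leb := normal_prob_dominates 0 1.
rewrite -(Radon_Nikodym_SigmaFinite.change_of_variables dom f0 measurableT mf).
have mpdf : measurable_fun [set: measurableTypeR R] (fun x => (normal_pdf 0 1 x)%:E : \bar R).
  by apply/measurable_EFinP; exact: measurable_normal_pdf.
have irn := Radon_Nikodym_SigmaFinite.f_integrable dom.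
have mrn := measurable_int _ irn.
have ae : ae_eq leb setT (Radon_Nikodym_SigmaFinite.f N01 leb)
    (fun x => (normal_pdf 0 1 x)%:E).
  apply: integral_ae_eq => // E _ mE.
  by rewrite -Radon_Nikodym_SigmaFinite.f_integral.
apply: ae_eq_integral => //.
- by apply: emeasurable_funM.
- by apply: emeasurable_funM.
- by apply: filterS ae => x /= h _; rewrite h.
Qed.

Lemma integral_normal (f : measurableTypeR R -> R) : measurable_fun setT f ->
  \int[N01]_x (f x)%:E = \int[leb]_x (f x * normal_pdf 0 1 x)%:E.
Proof.
move=> mf; have mfE : measurable_fun setT (EFin \o f) by exact/measurable_EFinP.
have pdf0 x : 0 <= (normal_pdf 0 1 x)%:E :> \bar R by rewrite lee_fin normal_pdf_ge0.
rewrite integralE [RHS]integralE; congr (_ - _).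
  rewrite ge0_integral_normal//; last exact: measurable_funepos.
  apply: eq_integral => x _; rewrite !funeposE maxe_pMl// mul0e /=.
  by rewrite EFinM.
rewrite ge0_integral_normal//; last exact: measurable_funeneg.
apply: eq_integral => x _; rewrite !funenegE maxe_pMl// mul0e /=.
by rewrite -mulNr EFinM.
Qed.

(** Completing the square: up to the constant on the right, tilting by [expR (a * x)] turns the
    density of N(0,1) into that of N(a,1). *)
Lemma normal_mgf (a : R) :
  \int[N01]_x (expR (a * x))%:E = (expR (a ^+ 2 / 2))%:E.
Proof.
have mexp : measurable_fun [set: measurableTypeR R] (fun x : R => expR (a * x)).
  by apply: measurableT_comp => //; exact: measurable_funM.
rewrite integral_normal//.
transitivity (\int[leb]_x ((expR (a ^+ 2 / 2))%:E * (normal_pdf a 1 x)%:E)).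
  apply: eq_integral => x _; rewrite -EFinM; congr EFin.
  rewrite /normal_pdf (negbTE (oner_neq0 _)) mulrCA [RHS]mulrCA.
  congr (_ * _)%R; rewrite /normal_fun -!expRD; congr expR; by field.
rewrite (@ge0_integralZl _ _ _ leb setT measurableT (fun x => (normal_pdf a 1 x)%:E))//.
- by rewrite integral_normal_pdf mule1.
- by apply/measurable_EFinP; exact: measurable_normal_pdf.
- by move=> x _; rewrite lee_fin normal_pdf_ge0.
Qed.

Lemma integrable_normal_exp (a : R) :
  N01.-integrable setT (EFin \o (fun x : measurableTypeR R => expR (a * x))).
Proof.
have mexp : measurable_fun [set: measurableTypeR R] (fun x : R => expR (a * x)).
  by apply: measurableT_comp => //; exact: measurable_funM.
apply/integrableP; split; first exact/measurable_EFinP.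
rewrite (_ : (fun x => _) = (fun x : R => (expR (a * x))%:E)).
  by rewrite normal_mgf ltry.
by apply/funext => x /=; rewrite ger0_norm ?expR_ge0.
Qed.

Lemma integrable_normal_id :
  N01.-integrable setT (EFin \o (@id (measurableTypeR R))).
Proof.
have h := integrableD measurableT (integrable_normal_exp 1) (integrable_normal_exp (-1)).
apply: (le_integrable measurableT _ _ h).
  by apply/measurable_EFinP; exact: measurable_id.
move=> x _ /=; rewrite lee_fin [leRHS]ger0_norm ?addr_ge0 ?expR_ge0//.
rewrite mul1r mulN1r ler_norml; have := expR_ge1Dx x; have := expR_ge1Dx (- x).
have := expR_gt0 x; have := expR_gt0 (- x); lra.
Qed.

End normal_density.

Section real_integrals.
Context d (T : measurableType d) (R : realType) (mu : probability T R).
Implicit Types f g : T -> R.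

Lemma integrable_dominated f g : measurable_fun setT f ->
  mu.-integrable setT (EFin \o g) -> (forall x, `|f x| <= g x) ->
  mu.-integrable setT (EFin \o f).
Proof.
move=> mf ig fg; apply: (le_integrable measurableT _ _ ig).
  exact/measurable_EFinP.
by move=> x _ /=; rewrite lee_fin (le_trans (fg x))// ler_norm.
Qed.

Lemma integrable_bounded f (C : R) : measurable_fun setT f ->
  (forall x, `|f x| <= C) -> mu.-integrable setT (EFin \o f).
Proof.
move=> mf fC; apply: (@integrable_dominated f (fun=> C)) => //.
exact: finite_measure_integrable_cst.
Qed.

Lemma integrable_mul_bounded f g (C : R) : measurable_fun setT f ->
  (forall x, `|f x| <= C) -> mu.-integrable setT (EFin \o g) ->
  mu.-integrable setT (EFin \o (fun x => f x * g x)).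
Proof.
move=> mf fC ig; have mg : measurable_fun setT g.
  by apply/measurable_EFinP; exact: measurable_int ig.
have h := integrable_norm ig.
have h2 := integrableZl measurableT C h.
apply: (le_integrable measurableT _ _ h2).
  by apply/measurable_EFinP; exact: measurable_funM.
move=> x _ /=; rewrite lee_fin normrM [leRHS]ger0_norm.
  by rewrite ler_wpM2r.
by rewrite mulr_ge0// (le_trans _ (fC x)).
Qed.

Lemma integrable_add f g : mu.-integrable setT (EFin \o f) ->
  mu.-integrable setT (EFin \o g) ->
  mu.-integrable setT (EFin \o (fun x => f x + g x)).
Proof. by move=> h1 h2; exact: (integrableD measurableT h1 h2). Qed.

Lemma integrable_sub f g : mu.-integrable setT (EFin \o f) ->
  mu.-integrable setT (EFin \o g) ->
  mu.-integrable setT (EFin \o (fun x => f x - g x)).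
Proof. by move=> h1 h2; exact: (integrableB measurableT h1 h2). Qed.

Lemma integrable_scale (c : R) f : mu.-integrable setT (EFin \o f) ->
  mu.-integrable setT (EFin \o (fun x => c * f x)).
Proof. by move=> h1; exact: (integrableZl measurableT c h1). Qed.

Lemma integrable_bigsum (I : Type) (r : seq I) (F : I -> T -> R) :
  (forall i, mu.-integrable setT (EFin \o F i)) ->
  mu.-integrable setT (EFin \o (fun x => \sum_(i <- r) F i x)).
Proof.
move=> h; elim: r => [|i r ih].
  rewrite (_ : _ \o _ = EFin \o (fun=> 0)).
    exact: finite_measure_integrable_cst.
  by apply/funext => x /=; rewrite big_nil.
rewrite (_ : _ \o _ = EFin \o (fun x => F i x + \sum_(i <- r) F i x)).
  exact: integrable_add.
by apply/funext => x /=; rewrite big_cons.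
Qed.

Lemma Rintegral_bigsum (I : Type) (r : seq I) (F : I -> T -> R) :
  (forall i, mu.-integrable setT (EFin \o F i)) ->
  \int[mu]_x (\sum_(i <- r) F i x) = \sum_(i <- r) \int[mu]_x F i x.
Proof.
move=> h; elim: r => [|i r ih].
  rewrite big_nil; under eq_Rintegral do rewrite big_nil.
  by rewrite Rintegral_cst// mul0r.
rewrite big_cons -ih -RintegralD//; last exact: integrable_bigsum.
by apply: eq_Rintegral => x _; rewrite big_cons.
Qed.

Lemma Rintegral_const (c : R) : \int[mu]_x c = c.
Proof.
rewrite Rintegral_cst// -[RHS]mulr1; congr (_ * _).
by have /= -> := @probability_setT _ _ _ mu.
Qed.

Lemma EFin_Rintegral f : mu.-integrable setT (EFin \o f) ->
  (\int[mu]_x f x)%:E = (\int[mu]_x (f x)%:E)%E.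
Proof. by move=> h; rewrite /Rintegral fineK//; exact: integrable_fin_num. Qed.

Lemma normr_Rintegral_le f g : mu.-integrable setT (EFin \o f) ->
  mu.-integrable setT (EFin \o g) -> (forall x, `|f x| <= g x) ->
  `|\int[mu]_x f x| <= \int[mu]_x g x.
Proof.
move=> hf hg fg; apply: le_trans (le_normr_Rintegral measurableT hf) _.
by apply: le_Rintegral => //; exact: (integrable_norm hf).
Qed.

End real_integrals.

Section gaussian_integration_by_parts.
Variable R : realType.
Notation leb := (@lebesgue_measure R).
Notation N01 := (@normal_prob R 0 1).
Notation phi := (@normal_pdf R 0 1).

Lemma is_derive_normal_pdf (x : R) : is_derive x 1 phi (- x * phi x).
Proof.
have h : is_derive x 1 (fun t : R => - (t ^+ 2) / 2) (- x).
  have := is_derive_cmul (- 2^-1) (is_derive_mul (is_derive_id x 1) (is_derive_id x 1)).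
  by move=> /is_derive_ext; apply=> [t|] /=; field.
have := is_derive_cmul (normal_peak (1 : R))
  (@is_derive_comp R expR (fun t => - t ^+ 2 / 2) x _ _
    (is_derive_expR (- x ^+ 2 / 2)) h).
move=> /is_derive_ext; apply=> [t|]; rewrite /normal_pdf (negbTE (oner_neq0 _)) /normal_fun;
  rewrite ?subr0 ?expr1n.
  by [].
by ring.
Qed.

(** Only the vanishing of boundary terms is asked of this bound, so a crude decay suffices:
    exp(x^2/2) is at least 1 + x^2/2, and this is at least (n+1)/2. *)
Lemma normal_pdf_le (n : nat) (x : R) : n%:R <= `|x| ->
  phi x <= 2 * normal_peak (1 : R) * harmonic n.
Proof.
move=> nx; rewrite /normal_pdf (negbTE (oner_neq0 _)) /normal_fun subr0 expr1n.
rewrite -mulrA mulrCA ler_wpM2l ?normal_peak_ge0// mulNr expRN.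
have n1 : 0 < n.+1%:R / 2 :> R by rewrite divr_gt0 ?ltr0n.
rewrite -[leRHS]invrK lef_pV2 ?posrE ?expR_gt0//; last first.
  by rewrite invr_gt0 mulr_gt0// invr_gt0 ltr0n.
rewrite invfM invrK; apply: le_trans (expR_ge1Dx _).
have : (n%:R : R) ^+ 2 <= x ^+ 2.
  by rewrite -[leRHS]real_normK ?num_real// ler_sqr ?nnegrE.
have e : n.+1%:R = n%:R + 1 :> R by rewrite natr1.
rewrite {}e; have n0 : (0 : R) <= n%:R by [].
have : 0 <= (n%:R - 1 : R) ^+ 2 by exact: sqr_ge0.
by rewrite sqrrB expr1n mulr1; lra.
Qed.

(** [- f * phi] is a primitive of [(x * f - f') * phi], so the difference of the two sides is a
    limit of boundary terms over growing intervals. *)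
Lemma gaussian_ibp (f f' : R -> R) (C : R) :
  (forall x : R, is_derive x 1 f (f' x)) -> continuous f' ->
  (forall x, `|f x| <= C) -> (forall x, `|f' x| <= C) ->
  \int[N01]_x (x * f x) = \int[N01]_x f' x.
Proof.
move=> df cf' fC f'C.
have cf : continuous f.
  move=> x; apply/differentiable_continuous/derivable1_diffP.
  by have := df x => h; apply: ex_derive.
have mf : measurable_fun [set: measurableTypeR R] f by exact: continuous_measurable_fun.
have mf' : measurable_fun [set: measurableTypeR R] f' by exact: continuous_measurable_fun.
have i1 : N01.-integrable setT (EFin \o (fun x : measurableTypeR R => x * f x)).
  rewrite (_ : _ \o _ = EFin \o (fun x : measurableTypeR R => f x * x)).
    exact: (integrable_mul_bounded mf fC (integrable_normal_id R)).
  by apply/funext => x /=; rewrite mulrC.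
have i2 : N01.-integrable setT (EFin \o (f' : measurableTypeR R -> R)).
  exact: (@integrable_bounded _ _ R N01 f' C mf' f'C).
apply/eqP; rewrite -subr_eq0 -RintegralB//; apply/eqP.
pose g (x : measurableTypeR R) : R := x * f x - f' x.
have mg : measurable_fun setT g.
  by apply: measurable_funB => //; exact: measurable_funM.
pose K (x : measurableTypeR R) : R := g x * phi x.
rewrite /Rintegral (integral_normal mg) -/K.
pose h (x : R) : R := - (f x * phi x).
have dh (x : R) : is_derive x 1 h (K x).
  have := is_derive_cmul (-1) (is_derive_mul (df x) (is_derive_normal_pdf x)).
  by move=> /is_derive_ext; apply=> [t|]; rewrite /h /K /g; ring.
have cphi : continuous phi by apply: continuous_normal_pdf; exact: oner_neq0.
have cK : continuous K.
  move=> x; apply: cvgM; last exact: cphi.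
  by apply: cvgB; [apply: cvgM; [exact: cvg_id|exact: cf]|exact: cf'].
have ch : continuous h.
  move=> x; apply/differentiable_continuous/derivable1_diffP.
  by have := dh x => ?; apply: ex_derive.
have iK : leb.-integrable setT (EFin \o K).
  have ig : N01.-integrable setT (EFin \o g) by exact: integrable_sub.
  apply/integrableP; split.
    by apply/measurable_EFinP; exact: continuous_measurable_fun.
  have := integrableP _ _ _ ig => -[_].
  rewrite ge0_integral_normal//.
    rewrite (_ : (fun x => _) = (fun x => `|(EFin \o K) x|)%E)//.
    apply/funext => x /=; rewrite -EFinM /K normrM.
    by rewrite (ger0_norm (normal_pdf_ge0 0 1 x)).
  by apply: measurableT_comp => //; exact/measurable_EFinP.
(* End points at [n.+1] rather than [n] keep the interval nondegenerate for [n = 0], as the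
   fundamental theorem requires. *)
pose I (n : nat) : set R := `[- n.+1%:R, n.+1%:R]%classic.
pose D (n : nat) : R := h n.+1%:R - h (- n.+1%:R).
have FTC (n : nat) : (\int[leb]_(x in I n) (K x)%:E = (D n)%:E)%E.
  rewrite EFinB; apply: continuous_FTC2.
  - by rewrite (@lt_trans _ _ 0) ?oppr_lt0 ?ltr0n.
  - exact: continuous_subspaceT.
  - split.
    + by move=> x _; have := dh x => ?; apply: ex_derive.
    + by apply: cvg_at_right_filter; exact: ch.
    + by apply: cvg_at_left_filter; exact: ch.
  - by move=> x _; rewrite derive1E; have := dh x => ?; apply: derive_val.
have lim1 : ((\int[leb]_(x in I n) (K x)%:E)%E
     @[n --> \oo] --> (\int[leb]_x (K x)%:E)%E).
  have -> : (fun n : nat => \int[leb]_(x in I n) (K x)%:E)%E =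
      (fun n : nat => \int[leb]_x (((EFin \o K) \_ (I n)) x))%E.
    by apply/funext => n; rewrite integral_mkcond.
  apply: (@dominated_cvg _ _ _ leb setT measurableT _ _ (fun x => `|K x|%:E)).
  - move=> n; apply/(measurable_restrictT _ _).1 => //.
      exact: measurable_itv.
    by apply: measurable_funTS; exact: measurable_int iK.
  - move=> x _; apply: cvg_near_cst.
    exists (Num.bound `|x|) => //= n nx.
    have : x \in I n.
      rewrite /I inE/= in_itv/= -ler_norml ltW//.
      apply: (lt_le_trans (archi_boundP (normr_ge0 x))).
      by rewrite ler_nat ltnW.
    by move=> xn; rewrite patchE xn.
  - by [].
  - exact: (integrable_norm iK).
  - move=> n x _; rewrite patchE; case: ifP => //= _.
    by rewrite normr0 lee_fin.
have lim2 : ((D n)%:E @[n --> \oo] --> (0 : R)%:E).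
  apply: cvg_EFin; first exact: nearW.
  have hb (n : nat) (x : R) : n%:R <= `|x| ->
      `|h x| <= C * (2 * normal_peak (1 : R)) * harmonic n.
    move=> nx; rewrite /h normrN normrM -mulrA ler_pM//.
    by rewrite ger0_norm ?normal_pdf_ge0 ?normal_pdf_le.
  apply/norm_cvg0P.
  rewrite /D; apply: (@squeeze_cvgr _ _ _ _ (cst 0)
     (fun n => (C * (2 * normal_peak (1 : R)) * 2) * harmonic n)).
  - apply: nearW => n /=; rewrite normr_ge0 /=.
    apply: le_trans (ler_normB _ _) _.
    pose X : R := harmonic n; rewrite [leRHS](_ : _ =
      C * (2 * normal_peak (1 : R)) * X + C * (2 * normal_peak (1 : R)) * X).
      by apply: lerD; apply: hb; rewrite ?normrN ger0_norm// ler_nat.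
    by rewrite /X /=; ring.
  - exact: cvg_cst.
  - rewrite -[X in _ --> X](mulr0 (C * (2 * normal_peak (1 : R)) * 2)).
    by apply: cvgM; [exact: cvg_cst|exact: cvg_harmonic].
have -> : (\int[leb]_x (K x)%:E = 0)%E.
  apply: (cvg_unique _ lim1) => //.
  have -> : (fun n : nat => \int[leb]_(x in I n) (K x)%:E)%E =
    (fun n : nat => (D n)%:E) by apply/funext.
  exact: lim2.
by [].
Qed.

End gaussian_integration_by_parts.

(** * Resampling one observation *)

Section transport.
Context d d' (X : measurableType d) (Y : measurableType d') (R : realType).
Variables (mu : probability X R) (Q : probability Y R) (u : X * Y -> X).
Hypothesis mu_u : measurable_fun setT u.

(* The law [mu] is unchanged when part of the sample is replaced by a fresh
   draw from [Q]: this is all that is used of independence. *)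
Definition preserved := forall A : set X, measurable A ->
  mu A = (mu \x Q)%E (u @^-1` A).

Hypothesis hu : preserved.

Lemma integral_transport (f : X -> \bar R) : measurable_fun setT f ->
  (forall x, 0 <= f x)%E -> (\int[mu]_x f x = \int[(mu \x Q)%E]_p f (u p))%E.
Proof.
move=> mf f0.
rewrite (eq_measure_integral (pushforward (mu \x Q)%E u));
  last by move=> A mA _; exact: hu.
by rewrite ge0_integral_pushforward//; exact: mu_u.
Qed.

Lemma transport_ge0 (f : X -> \bar R) : measurable_fun setT f ->
  (forall x, 0 <= f x)%E ->
  (\int[mu]_x f x = \int[mu]_x \int[Q]_z f (u (x, z)))%E.
Proof.
move=> mf f0; rewrite (integral_transport mf f0) fubini_tonelli1//.
exact: measurableT_comp.
Qed.

Variable f : X -> R.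
Hypothesis intf : mu.-integrable setT (EFin \o f).

Let g (p : X * Y) := (f (u p))%:E.

Let mf : measurable_fun setT f.
Proof. by apply/measurable_EFinP; exact: measurable_int intf. Qed.

Let intg : (mu \x Q)%E.-integrable setT g.
Proof.
apply/integrableP; split; first by apply/measurable_EFinP/measurableT_comp.
have := integrableP _ _ _ intf => -[_].
rewrite integral_transport//.
by apply: measurableT_comp => //; exact/measurable_EFinP.
Qed.

(** Sections of an integrable function may fail to be integrable on a null set; there the extended
    integral can be infinite while [fine] returns 0, hence an equality almost everywhere only. *)
Let aefin : {ae mu, forall x, fubini_F Q g x = (\int[Q]_z f (u (x, z)))%:E}.
Proof.
apply: filterS (ae_integrable1 intg) => x ix.
by rewrite EFin_Rintegral.
Qed.

Let mfine : measurable_fun setT (fun x => \int[Q]_z f (u (x, z))).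
Proof. exact: measurableT_comp (measurable_fubini_F intg). Qed.

Lemma integrable_transport :
  mu.-integrable setT (EFin \o (fun x => \int[Q]_z f (u (x, z)))).
Proof.
have h := integrable_fubini_F intg.
apply/integrableP; split; first exact/measurable_EFinP.
have [mF] := integrableP _ _ _ h.
rewrite (@ae_eq_integral _ _ _ mu setT (fun x => `|(\int[Q]_z f (u (x, z)))%:E|)%E)//.
- by apply: measurableT_comp.
- by apply: measurableT_comp => //; exact/measurable_EFinP.
- by apply: filterS aefin => x /= e _; rewrite e.
Qed.

Lemma transport : \int[mu]_x f x = \int[mu]_x \int[Q]_z f (u (x, z)).
Proof.
apply: EFin_inj; rewrite !EFin_Rintegral//; last exact: integrable_transport.
transitivity (\int[(mu \x Q)%E]_p g p)%E.
  rewrite [LHS](eq_measure_integral (pushforward (mu \x Q)%E u));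
    last by move=> A mA _; exact: hu.
  by rewrite (integral_pushforward mu_u (measurable_int _ intf) intg).
rewrite -integral12_prod_meas1//; apply: ae_eq_integral => //.
- exact: (measurable_fubini_F intg).
- exact/measurable_EFinP.
- by apply: filterS aefin => x /= e _; rewrite e.
Qed.

End transport.

Section product_of_conditional_bounds.
Context d d' (X : measurableType d) (Y : measurableType d') (R : realType).
Variables (mu : probability X R) (Q : probability Y R) (I : eqType).
Variable u : I -> X * Y -> X.
Hypothesis mu_u : forall l, measurable_fun setT (u l).
Hypothesis hu : forall l, preserved mu Q (u l).

(** The head factor is peeled off: refreshing its coordinate leaves the later factors fixed, and
    integrating the fresh draw costs [c]. The condition along the list is one-sided, so the same
    lemma serves products of independent factors and martingale-type products. *)
Lemma prod_resample (D : I -> X -> R) (c : R) (s : seq I) :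
  0 <= c -> (forall l, measurable_fun setT (D l)) -> (forall l x, 0 <= D l x) ->
  (forall l, l \in s -> forall x, \int[Q]_z (D l (u l (x, z)))%:E <= c%:E)%E ->
  pairwise (fun l l' => `[< forall x z, D l' (u l (x, z)) = D l' x >]) s ->
  (\int[mu]_x (\prod_(l <- s) D l x)%:E <= (c ^+ size s)%:E)%E.
Proof.
move=> c0 mD D0; elim: s => [|l s ih] hc.
  move=> _; under eq_integral do rewrite big_nil.
  by rewrite integral_cst//= mul1e expr0 probability_le1.
rewrite pairwise_cons => /andP[/allP hl hs].
have mP : measurable_fun setT (fun x => \prod_(l <- s) D l x).
  elim: (s) => [|k r ihr].
    by rewrite (_ : (fun x => _) = cst 1)//; apply/funext => x; rewrite big_nil.
  rewrite (_ : (fun x => _) = (fun x => D k x * \prod_(l <- r) D l x)).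
    exact: measurable_funM.
  by apply/funext => x; rewrite big_cons.
have P0 x : 0 <= \prod_(l <- s) D l x by apply: prodr_ge0.
under eq_integral do rewrite big_cons.
rewrite (transport_ge0 (mu_u l) (hu l)); last 2 first.
- by apply/measurable_EFinP/measurable_funM.
- by move=> x; rewrite lee_fin mulr_ge0.
have hP x z : \prod_(l' <- s) D l' (u l (x, z)) = \prod_(l' <- s) D l' x.
  by apply: eq_big_seq => l' /hl /asboolP ->.
have mDl x : measurable_fun setT (fun z => D l (u l (x, z))).
  by apply: measurableT_comp => //; exact: (measurableT_comp (mu_u l) (pair1_measurable x)).
apply: (@le_trans _ _ (\int[mu]_x (c%:E * (\prod_(l' <- s) D l' x)%:E))%E).
  apply: ge0_le_integral => //.
  - by move=> x _; apply: integral_ge0 => z _; rewrite lee_fin mulr_ge0.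
  - have : measurable_fun setT (fun p : X * Y =>
      (D l (u l p) * \prod_(l' <- s) D l' (u l p))%:E).
      apply/measurable_EFinP; apply: measurable_funM.
        by apply: measurableT_comp => //; exact: mu_u.
      by apply: (measurableT_comp mP); exact: mu_u.
    move=> mm; apply: (@measurable_fun_fubini_tonelli_F _ _ _ _ _ Q _ mm) => p.
    by rewrite lee_fin mulr_ge0.
  - by apply/measurable_EFinP/measurable_funM.
  move=> x _; under eq_integral do rewrite hP mulrC EFinM.
  rewrite ge0_integralZl//.
  - by rewrite muleC lee_wpmul2r ?lee_fin//; apply: hc; rewrite mem_head.
  - exact/measurable_EFinP.
  - by move=> z _; rewrite lee_fin.
  - by rewrite lee_fin.
rewrite ge0_integralZl//.
- rewrite exprS EFinM lee_wpmul2l ?lee_fin//; apply: ih => // l' hl' x.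
  by apply: hc; rewrite inE hl' orbT.
- exact/measurable_EFinP.
- by move=> z _; rewrite lee_fin.
Qed.

End product_of_conditional_bounds.

Section resampling.
Context d (E : measurableType d) (R : realType) (n : nat).
Variables (mu : probability (n.-tuple E) R) (Q : probability E R).

Definition upd (x : n.-tuple E) (i : 'I_n) (z : E) : n.-tuple E :=
  [tuple if j == i then z else tnth x j | j < n].

Lemma tnth_upd x i z j : tnth (upd x i z) j = if j == i then z else tnth x j.
Proof. by rewrite tnth_mktuple. Qed.

Lemma measurable_upd i :
  measurable_fun setT (fun p : n.-tuple E * E => upd p.1 i p.2).
Proof.
apply/measurable_fun_tnthP => j.
rewrite (_ : _ \o _ = fun p : n.-tuple E * E => if j == i then p.2 else tnth p.1 j).
  case: (j == i) => /=; first exact: measurable_snd.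
  apply: (@measurableT_comp _ _ _ _ _ _ (fun t : n.-tuple E => tnth t j)) => //=.
  exact: measurable_tnth.
by apply/funext => p /=; rewrite tnth_upd.
Qed.

Lemma measurable_updr x i : measurable_fun setT (fun z : E => upd x i z).
Proof.
apply/measurable_fun_tnthP => j.
rewrite (_ : _ \o _ = fun z => if j == i then z else tnth x j).
  by case: (j == i).
by apply/funext => p /=; rewrite tnth_upd.
Qed.

Definition iid_law := forall i : 'I_n,
  preserved mu Q (fun p : n.-tuple E * E => upd p.1 i p.2).

Hypothesis hiid : iid_law.

Lemma resample_ge0 i (f : n.-tuple E -> \bar R) : measurable_fun setT f ->
  (forall x, 0 <= f x)%E ->
  (\int[mu]_x f x = \int[mu]_x \int[Q]_z f (upd x i z))%E.
Proof. by move=> mf f0; rewrite (transport_ge0 (measurable_upd i) (hiid i)). Qed.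

End resampling.

Section resample_component.
Context d1 d2 (T1 : measurableType d1) (T2 : measurableType d2) (R : realType).
Variables (n : nat) (mu : probability (n.-tuple (T1 * T2)) R).
Variables (F1 : probability T1 R) (F2 : probability T2 R).
Hypothesis hiid : iid_law mu (F1 \x F2)%E.

Definition upd_fst (i : 'I_n) (p : n.-tuple (T1 * T2) * T1) :=
  upd p.1 i (p.2, (tnth p.1 i).2).
Definition upd_snd (i : 'I_n) (p : n.-tuple (T1 * T2) * T2) :=
  upd p.1 i ((tnth p.1 i).1, p.2).

Let measurable_tnth1 i (d : measure_display) (Y : measurableType d) :
  measurable_fun setT (fun p : n.-tuple (T1 * T2) * Y => tnth p.1 i).
Proof.
apply: (@measurableT_comp _ _ _ _ _ _ (fun t : n.-tuple (T1 * T2) => tnth t i)) => //=.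
exact: measurable_tnth.
Qed.

Lemma measurable_upd_fst i : measurable_fun setT (upd_fst i).
Proof.
have h : measurable_fun setT (fun p : n.-tuple (T1 * T2) * T1 =>
    (p.1, (p.2, (tnth p.1 i).2))).
  apply: measurable_fun_pair => //; apply: measurable_fun_pair => //.
  by apply: measurableT_comp => //; exact: measurable_tnth1.
exact: (measurableT_comp (measurable_upd i) h).
Qed.

Lemma measurable_upd_snd i : measurable_fun setT (upd_snd i).
Proof.
have h : measurable_fun setT (fun p : n.-tuple (T1 * T2) * T2 =>
    (p.1, ((tnth p.1 i).1, p.2))).
  apply: measurable_fun_pair => //; apply: measurable_fun_pair => //.
  by apply: measurableT_comp => //; exact: measurable_tnth1.
exact: (measurableT_comp (measurable_upd i) h).
Qed.

Lemma upd_upd (x : n.-tuple (T1 * T2)) i z z' : upd (upd x i z) i z' = upd x i z'.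
Proof. by apply: eq_from_tnth => j; rewrite !tnth_upd; case: eqP. Qed.

Let indicator_ge0 (A : set (n.-tuple (T1 * T2))) x : (0 <= (\1_A x)%:E :> \bar R)%E.
Proof. by rewrite lee_fin. Qed.

(** Averaging over a refresh of the whole pair makes the two components independent. A second draw
    of the first component then overwrites the first one ([upd_upd]), and integrating out the
    overwritten value costs the factor [F1 setT = 1]. *)
Lemma preserved_upd_fst i : preserved mu F1 (upd_fst i).
Proof.
move=> A mA; pose f x : \bar R := (\1_A x)%:E.
have mf : measurable_fun setT f by apply/measurable_EFinP.
have mfu : measurable_fun setT (fun p => f (upd_fst i p)).
  by apply: (measurableT_comp mf); exact: measurable_upd_fst.
have mB : measurable (upd_fst i @^-1` A).
  by rewrite -[_ @^-1` _]setTI; exact: measurable_upd_fst.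
transitivity (\int[mu]_x f x)%E; first by rewrite integral_indic// setIT.
transitivity (\int[(mu \x F1)%E]_p f (upd_fst i p))%E; last first.
  rewrite (_ : (fun p => _) = (fun p => (\1_(upd_fst i @^-1` A) p)%:E)).
    by rewrite integral_indic// setIT.
  by apply/funext.
rewrite (fubini_tonelli1 _ mfu (fun p => indicator_ge0 A (upd_fst i p))).
pose g x : \bar R := (\int[F1]_a f (upd_fst i (x, a)))%E.
have mg : measurable_fun setT g.
  apply: (@measurable_fun_fubini_tonelli_F _ _ _ _ _ F1 _ mfu) => p.
  exact: indicator_ge0.
have g0 x : (0 <= g x)%E by apply: integral_ge0 => ? _; exact: indicator_ge0.
rewrite [RHS](resample_ge0 hiid i mg g0).
rewrite [LHS](resample_ge0 hiid i mf (indicator_ge0 A)).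
apply: eq_integral => x _.
have mz : measurable_fun setT (fun z => f (upd x i z)).
  by apply: (measurableT_comp mf); exact: measurable_updr.
have mgz : measurable_fun setT (fun z => g (upd x i z)).
  by apply: (measurableT_comp mg); exact: measurable_updr.
rewrite [LHS](fubini_tonelli2 _ mz (fun z => indicator_ge0 A (upd x i z))).
rewrite [RHS](fubini_tonelli2 _ mgz (fun z => g0 (upd x i z))).
apply: eq_integral => b _; rewrite /fubini_G.
have e a : g (upd x i (a, b)) = (\int[F1]_a f (upd x i (a, b)))%E.
  by apply: eq_integral => a' _; rewrite /upd_fst upd_upd tnth_upd eqxx.
under [RHS]eq_integral do rewrite e.
rewrite integral_cst//.
by have /= -> := @probability_setT _ _ _ F1; rewrite mule1.
Qed.

Lemma preserved_upd_snd i : preserved mu F2 (upd_snd i).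
Proof.
move=> A mA; pose f x : \bar R := (\1_A x)%:E.
have mf : measurable_fun setT f by apply/measurable_EFinP.
have mfu : measurable_fun setT (fun p => f (upd_snd i p)).
  by apply: (measurableT_comp mf); exact: measurable_upd_snd.
have mB : measurable (upd_snd i @^-1` A).
  by rewrite -[_ @^-1` _]setTI; exact: measurable_upd_snd.
transitivity (\int[mu]_x f x)%E; first by rewrite integral_indic// setIT.
transitivity (\int[(mu \x F2)%E]_p f (upd_snd i p))%E; last first.
  rewrite (_ : (fun p => _) = (fun p => (\1_(upd_snd i @^-1` A) p)%:E)).
    by rewrite integral_indic// setIT.
  by apply/funext.
rewrite (fubini_tonelli1 _ mfu (fun p => indicator_ge0 A (upd_snd i p))).
pose g x : \bar R := (\int[F2]_b f (upd_snd i (x, b)))%E.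
have mg : measurable_fun setT g.
  apply: (@measurable_fun_fubini_tonelli_F _ _ _ _ _ F2 _ mfu) => p.
  exact: indicator_ge0.
have g0 x : (0 <= g x)%E by apply: integral_ge0 => ? _; exact: indicator_ge0.
rewrite [RHS](resample_ge0 hiid i mg g0).
rewrite [LHS](resample_ge0 hiid i mf (indicator_ge0 A)).
apply: eq_integral => x _.
have mz : measurable_fun setT (fun z => f (upd x i z)).
  by apply: (measurableT_comp mf); exact: measurable_updr.
have mgz : measurable_fun setT (fun z => g (upd x i z)).
  by apply: (measurableT_comp mg); exact: measurable_updr.
rewrite [LHS](fubini_tonelli1 _ mz (fun z => indicator_ge0 A (upd x i z))).
rewrite [RHS](fubini_tonelli1 _ mgz (fun z => g0 (upd x i z))).
apply: eq_integral => a _; rewrite /fubini_F.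
have e b : g (upd x i (a, b)) = (\int[F2]_b f (upd x i (a, b)))%E.
  by apply: eq_integral => b' _; rewrite /upd_snd upd_upd tnth_upd eqxx.
under [RHS]eq_integral do rewrite e.
rewrite integral_cst//.
by have /= -> := @probability_setT _ _ _ F2; rewrite mule1.
Qed.

End resample_component.

(** * Invariance of the law of the sample under resampling *)

Section sample_law.
Context d1 d2 (T1 : measurableType d1) (T2 : measurableType d2) (R : realType).
Context d (Omega : measurableType d) (P : probability Omega R) (n : nat).
Variables (X : 'I_n -> {RV P >-> T1}) (e : 'I_n -> {RV P >-> T2}).
Variables (F1 : probability T1 R) (F2 : probability T2 R).
Hypothesis lawX : forall i, has_law (X i) F1.
Hypothesis lawe : forall i, has_law (e i) F2.
Hypothesis indep : mutual_independence P (fun s : 'I_n + 'I_n =>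
    match s with inl i => sigma_of (X i) | inr i => sigma_of (e i) end).

Notation E := (T1 * T2)%type.

Definition sample (w : Omega) : n.-tuple E := [tuple (X i w, e i w) | i < n].

Lemma tnth_sample w i : tnth (sample w) i = (X i w, e i w).
Proof. by rewrite tnth_mktuple. Qed.

Lemma measurable_sample : measurable_fun setT sample.
Proof.
apply/measurable_fun_tnthP => i.
rewrite (_ : _ \o _ = fun w => (X i w, e i w)).
  exact: measurable_fun_pair.
by apply/funext => w /=; rewrite tnth_sample.
Qed.

HB.instance Definition _ := isMeasurableFun.Build _ _ _ _ sample measurable_sample.

Definition sample_law : probability (n.-tuple E) R :=
  distribution P [the {mfun Omega >-> n.-tuple E} of sample].

Definition rect (B : 'I_n -> set T1) (C : 'I_n -> set T2) : set (n.-tuple E) :=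
  [set x | forall i, B i (tnth x i).1 /\ C i (tnth x i).2].

Definition rects : set (set (n.-tuple E)) :=
  [set A | exists B C, [/\ forall i, measurable (B i),
     forall i, measurable (C i) & A = rect B C]].

Lemma measurable_rect B C : (forall i, measurable (B i)) ->
  (forall i, measurable (C i)) -> measurable (rect B C).
Proof.
move=> mB mC.
have -> : rect B C = \bigcap_(i in [set: 'I_n])
   ((fun x : n.-tuple E => tnth x i) @^-1` (B i `*` C i)).
  by apply/seteqP; split=> [x h i _|x h i]; [exact: h|exact: (h i I)].
apply: fin_bigcap_measurable => // i _.
rewrite -[_ @^-1` _]setTI; apply: measurable_tnth => //; exact: measurableX.
Qed.

Lemma sample_law_rect B C : (forall i, measurable (B i)) ->
  (forall i, measurable (C i)) ->
  sample_law (rect B C) = (\prod_(i < n) (F1 (B i) * F2 (C i)))%E.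
Proof.
move=> mB mC.
pose A (s : 'I_n + 'I_n) : set Omega :=
  match s with inl i => X i @^-1` B i | inr i => e i @^-1` C i end.
have hA s : s \in [set: 'I_n + 'I_n]%SET ->
    (match s with inl i => sigma_of (X i) | inr i => sigma_of (e i) end) (A s).
  by move=> _; case: s => i; [exists (B i)|exists (C i)]; rewrite ?setTI.
have := @indep [set: 'I_n + 'I_n]%SET A hA.
have -> : \bigcap_(i in [set` [set: 'I_n + 'I_n]%SET]) A i = sample @^-1` rect B C.
  apply/seteqP; split=> w /= h.
    move=> i; rewrite tnth_sample; split.
      by apply: (h (inl i)); rewrite /= inE.
    by apply: (h (inr i)); rewrite /= inE.
  by move=> [i|i] _; have := h i; rewrite tnth_sample => -[].
move=> hP; rewrite [LHS](_ : _ = P (sample @^-1` rect B C))// hP.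
rewrite (eq_bigl xpredT); last by move=> s; rewrite inE.
rewrite big_sumType /= -big_split; apply: eq_bigr => i _ /=.
by congr (_ * _)%E; [exact: (lawX i (mB i))|exact: (lawe i (mC i))].
Qed.

(** It suffices that the identity is measurable out of the sigma-algebra generated by the
    rectangles; this is checked coordinatewise, on rectangles constrained at one index only. *)
Lemma rects_generate (A : set (n.-tuple E)) : measurable A -> <<s rects >> A.
Proof.
move=> mA.
have mid : measurable_fun [set: g_sigma_algebraType rects]
    (idfun : g_sigma_algebraType rects -> n.-tuple E).
  apply/measurable_fun_tnthP => i.
  rewrite (_ : _ \o _ = fun x : g_sigma_algebraType rects =>
     ((tnth (x : n.-tuple E) i).1, (tnth (x : n.-tuple E) i).2)); last first.
    by apply/funext => x /=; case: (tnth x i).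
  apply: measurable_fun_pair => _ Y mY; rewrite setTI; apply: sub_sigma_algebra.
    exists (fun j => if j == i then Y else setT), (fun=> setT).
    split=> // [j|]; first by case: ifP.
    apply/seteqP; split=> x /= h.
      by move=> j; case: (eqVneq j i) => [->|] //=.
    by have [] := h i; rewrite eqxx.
  exists (fun=> setT), (fun j => if j == i then Y else setT).
  split=> // [j|]; first by case: ifP.
  apply/seteqP; split=> x /= h.
    by move=> j; case: (eqVneq j i) => [->|] //=.
  by have [] := h i; rewrite eqxx.
by have := mid measurableT A mA; rewrite setTI.
Qed.

(** Rectangles form a generating pi-system, and on a rectangle overwriting index [i] merely
    exchanges the factor at [i] for an equal one. *)
Lemma sample_law_iid : iid_law sample_law (F1 \x F2)%E.
Proof.
move=> i A mA.
pose Q : probability E R := (F1 \x F2)%E.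
pose up := fun p : n.-tuple E * E => upd p.1 i p.2.
have mup : measurable_fun setT up by exact: measurable_upd.
pose up_mf := isMeasurableFun.Build _ _ _ _ up mup.
pose upm : {mfun (n.-tuple E * E)%type >-> n.-tuple E} :=
  MeasurableFun.Pack (MeasurableFun.Class up_mf).
pose nu := distribution (sample_law \x Q)%E upm.
change (sample_law A = nu A).
apply: (@g_sigma_algebra_measure_unique _ _ _ rects _ (fun=> setT)) => //.
- by move=> _ [B [C [mB mC ->]]]; exact: measurable_rect.
- by move=> _; exists (fun=> setT), (fun=> setT); split=> //; apply/seteqP; split.
- by rewrite bigcup_const//; exists 0.
- move=> _ _ [B [C [mB mC ->]]] [B' [C' [mB' mC' ->]]].
  exists (fun j => B j `&` B' j), (fun j => C j `&` C' j); split.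
  + by move=> j; exact: measurableI.
  + by move=> j; exact: measurableI.
  apply/seteqP; split=> x /=; first by move=> [h h'] j; have [? ?] := h j; have [? ?] := h' j.
  by move=> h; split=> j; have [[? ?] [? ?]] := h j.
- move=> _ [B [C [mB mC ->]]].
  (* The overwritten coordinate is left free, and its constraint moves to the fresh draw. *)
  pose B' j := if j == i then setT else B j.
  pose C' j := if j == i then setT else C j.
  have mB' j : measurable (B' j) by rewrite /B'; case: ifP.
  have mC' j : measurable (C' j) by rewrite /C'; case: ifP.
  rewrite /nu /distribution /pushforward /=.
  have -> : up @^-1` rect B C = rect B' C' `*` (B i `*` C i).
    apply/seteqP; split=> [[x z]|[x z]] /=.
      move=> h; split.
        move=> j; rewrite /B' /C'; have := h j; rewrite tnth_upd.
        by case: (eqVneq j i).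
      by have := h i; rewrite tnth_upd eqxx.
    move=> [h1 h2] j; rewrite tnth_upd; case: (eqVneq j i) => [->//|ji].
    by have := h1 j; rewrite /B' /C' (negbTE ji).
  have -> : (sample_law \x Q)%E (rect B' C' `*` (B i `*` C i)) =
      (sample_law (rect B' C') * Q (B i `*` C i))%E.
    by apply: (product_measure1E sample_law Q); [exact: measurable_rect|exact: measurableX].
  have -> : Q (B i `*` C i) = (F1 (B i) * F2 (C i))%E by exact: (product_measure1E F1 F2).
  rewrite !sample_law_rect// (bigD1 i)//= [in RHS](bigD1 i)//=.
  have e1 : F1 setT = 1%E by exact: probability_setT.
  have e2 : F2 setT = 1%E by exact: probability_setT.
  rewrite /B' /C' eqxx e1 e2 mul1e mul1e muleC; congr (_ * _)%E.
  by apply: eq_bigr => j /negbTE ->.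
- by move=> _; apply: le_lt_trans (ltry (1 : R)); exact: probability_le1.
- exact: rects_generate.
Qed.

End sample_law.

(** * Elementary moment and exponential bounds *)

Section markov.
Context d (T : measurableType d) (R : realType) (mu : probability T R).

Lemma markov_ge0 (f : T -> R) (a b : R) : measurable_fun setT f ->
  (forall x, 0 <= f x) -> 0 < a ->
  (\int[mu]_x (f x)%:E <= b%:E)%E ->
  fine (mu [set x | a <= f x]) <= b / a.
Proof.
move=> mf f0 a0 fb.
pose A := [set x | a <= f x]; rewrite -/A.
have mA : measurable A.
  by rewrite -[X in measurable X]setTI; exact: measurable_fun_le.
rewrite ler_pdivlMr// mulrC -lee_fin EFinM fineK; last exact: fin_num_measure.
apply: le_trans _ fb.
rewrite -integral_cst//.
apply: (@le_trans _ _ (\int[mu]_(x in A) (f x)%:E)%E).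
  apply: ge0_le_integral => //.
  - by move=> x _; rewrite lee_fin ltW.
  - by apply/measurable_EFinP/measurable_funTS.
apply: ge0_subset_integral => //.
- exact/measurable_EFinP.
- by move=> x _; rewrite lee_fin.
Qed.

End markov.

Section exponential_bounds.
Variable R : realType.

Lemma expR_le_inv (x : R) : x < 1 -> expR x <= (1 - x)^-1.
Proof.
move=> x1; rewrite -[expR x]invrK -expRN lef_pV2 ?posrE ?expR_gt0 ?subr_gt0//.
exact: expR_ge1Dx.
Qed.

Lemma expR_le_quadratic (x : R) : x <= 1 / 2 -> expR x <= 1 + x + 2 * x ^+ 2.
Proof.
move=> x1; have x2 : x < 1 by lra.
apply: le_trans (expR_le_inv x2) _.
rewrite -[leLHS]mul1r ler_pdivrMr; last by lra.
have : 0 <= x ^+ 2 * (1 - 2 * x) by rewrite mulr_ge0 ?sqr_ge0//; lra.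
by rewrite (_ : (1 + x + 2 * x ^+ 2) * (1 - x) = 1 + x ^+ 2 * (1 - 2 * x)); [lra|ring].
Qed.

Lemma expR1_le4 : expR 1 <= 4 :> R.
Proof.
have h : expR (1 / 2) <= 2 :> R.
  apply: le_trans (@expR_le_inv (1 / 2) _) _; first by lra.
  by rewrite (_ : 1 - 1 / 2 = 2^-1) ?invrK//; field.
have -> : 1 = 1 / 2 + 1 / 2 :> R by field.
rewrite expRD; have := expR_gt0 (1 / 2 : R); nra.
Qed.

End exponential_bounds.

Section measurable_softmax.
Context d (X : measurableType d) (R : realType) (J : finType) (j0 : J).
Variables (beta : R) (Z w : X -> J -> R).
Hypothesis beta_gt0 : 0 < beta.
Hypothesis mZ : forall j, measurable_fun setT (fun x => Z x j).
Hypothesis mw : forall j, measurable_fun setT (fun x => w x j).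

Lemma measurable_partition_sum : measurable_fun setT (fun x => partition_sum beta (Z x)).
Proof.
apply: measurable_sum => j; apply: measurableT_comp => //.
exact: measurable_funM.
Qed.

Lemma measurable_softmax j : measurable_fun setT (fun x => softmax beta (Z x) j).
Proof.
have -> : (fun x => softmax beta (Z x) j) =
   (fun x => expR (beta * Z x j - ln (partition_sum beta (Z x)))).
  apply/funext => x; rewrite expRD expRN lnK// posrE.
  exact: partition_sum_gt0.
apply: measurableT_comp => //; apply: measurable_funB; first exact: measurable_funM.
by apply: measurableT_comp => //; exact: measurable_partition_sum.
Qed.

Lemma measurable_lse : measurable_fun setT (fun x => lse beta (Z x)).
Proof.
apply: measurable_funM => //.
by apply: measurableT_comp => //; exact: measurable_partition_sum.
Qed.

Lemma measurable_mean : measurable_fun setT (fun x => mean beta (Z x) (w x)).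
Proof.
apply: measurable_sum => j; apply: measurable_funM => //; exact: measurable_softmax.
Qed.

Lemma measurable_gauge (A A' : R -> R) kappa t :
  (forall x : R, is_derive x 1 A (A' x)) ->
  measurable_fun setT (fun x => A (arg beta kappa t (Z x))).
Proof.
move=> dA; have cA : continuous A.
  move=> x; apply/differentiable_continuous/derivable1_diffP.
  by have := dA x => ?; apply: ex_derive.
apply: (measurableT_comp (continuous_measurable_fun cA)).
apply: measurable_funM => //; apply: measurable_funB => //; exact: measurable_lse.
Qed.

Lemma measurable_sfield (A A' : R -> R) kappa t :
  (forall x : R, is_derive x 1 A (A' x)) ->
  measurable_fun setT (fun x => sfield beta A kappa t (Z x) (w x)).
Proof.
move=> dA; apply: measurable_funM; last exact: measurable_mean.
exact: measurable_gauge dA.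
Qed.

Lemma measurable_hform (A A1 A2 : R -> R) kappa t (M : X -> J -> J -> R) :
  (forall x : R, is_derive x 1 A (A1 x)) ->
  (forall x : R, is_derive x 1 A1 (A2 x)) ->
  (forall j k, measurable_fun setT (fun x => M x j k)) ->
  measurable_fun setT (fun x => hform beta A A1 kappa t (Z x) (M x)).
Proof.
move=> dA dA1 mM.
have mA := measurable_gauge kappa t dA; have mA1 := measurable_gauge kappa t dA1.
have ms := measurable_softmax.
have m2 : measurable_fun setT (fun x => \sum_j \sum_k softmax beta (Z x) j *
    softmax beta (Z x) k * M x j k).
  apply: measurable_sum => j; apply: measurable_sum => k.
  by apply: measurable_funM => //; apply: measurable_funM.
apply: measurable_funD; apply: measurable_funM.
- exact: measurable_funM.
- exact: m2.
- exact: measurable_funM.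
- apply: measurable_funB => //; apply: measurable_sum => j; exact: measurable_funM.
Qed.

End measurable_softmax.

(** * Stein identities along the interpolation path *)

Section stein.
Context dT (T : measurableType dT) (R : realType) (n : nat) (J : finType) (j0 : J).
Notation N01 := (@normal_prob R 0 1).
Notation E := (T * measurableTypeR R)%type.
Variables (F : probability T R) (mu : probability (n.-tuple E) R).
Hypothesis hiid : iid_law mu (F \x N01)%E.
Hypothesis n_gt0 : (0 < n)%N.
Variables (G : T -> J -> R) (v : 'I_n -> J -> R).
Hypothesis mG : forall j, measurable_fun setT (fun a => G a j).
Hypothesis G_le1 : forall a j, `|G a j| <= 1.
Hypothesis G_mean0 : forall j, \int[F]_a G a j = 0.
Hypothesis v_le1 : forall i j, `|v i j| <= 1.

Definition rn : R := (Num.sqrt n%:R)^-1.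

Lemma rn_gt0 : 0 < rn.
Proof. by rewrite invr_gt0 sqrtr_gt0 ltr0n. Qed.

Lemma rn2n : n%:R * (rn * rn) = 1.
Proof.
by rewrite -invfM -expr2 sqr_sqrtr ?ler0n// divff// pnatr_eq0 -lt0n.
Qed.

Definition Gam (j k : J) : R := \int[F]_a (G a j * G a k).
Definition Sig (j k : J) : R := \sum_i (rn * rn) * (v i j * v i k).
Definition Ssum (x : n.-tuple E) (j : J) : R := rn * \sum_i G (tnth x i).1 j.
Definition Ysum (x : n.-tuple E) (j : J) : R := rn * \sum_i (tnth x i).2 * v i j.
Definition W (s c : R) x j : R := s * Ssum x j + c * Ysum x j.

Lemma sum_upd (f : E -> 'I_n -> R) x i z :
  \sum_k f (tnth (upd x i z) k) k = \sum_k f (tnth x k) k + (f z i - f (tnth x i) i).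
Proof.
rewrite (bigD1 i)//= [in RHS](bigD1 i)//= tnth_upd eqxx.
rewrite (eq_bigr (fun k => f (tnth x k) k)); last by move=> k /negbTE ki; rewrite tnth_upd ki.
ring.
Qed.

Lemma W_upd_fst s c i x a : W s c (upd_fst i (x, a)) =
  fun j => W s c x j + s * rn * (G a j - G (tnth x i).1 j).
Proof.
apply/funext => j; rewrite /W /Ssum /Ysum /upd_fst /=.
rewrite (sum_upd (fun z _ => G z.1 j)) (sum_upd (fun z k => z.2 * v k j)) /=.
ring.
Qed.

(** The point is split into a base free of the i-th multiplier plus [xi] times a fixed direction,
    the form to which Gaussian integration by parts applies. *)
Lemma W_upd_snd s c i x (xi : R) : W s c (upd_snd i (x, xi)) =
  fun j => (W s c x j - (tnth x i).2 * (c * rn * v i j)) + xi * (c * rn * v i j).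
Proof.
apply/funext => j; rewrite /W /Ssum /Ysum /upd_snd /=.
rewrite (sum_upd (fun z _ => G z.1 j)) (sum_upd (fun z k => z.2 * v k j)) /=.
ring.
Qed.

Lemma measurable_coord i : measurable_fun setT (fun x : n.-tuple E => tnth x i).
Proof. exact: measurable_tnth. Qed.

Lemma measurable_coord1 i : measurable_fun setT (fun x : n.-tuple E => (tnth x i).1).
Proof. by apply: measurableT_comp => //; exact: measurable_coord. Qed.

Lemma measurable_coord2 i : measurable_fun setT (fun x : n.-tuple E => (tnth x i).2).
Proof. by apply: measurableT_comp => //; exact: measurable_coord. Qed.

Lemma measurable_Gcoord i j : measurable_fun setT (fun x : n.-tuple E => G (tnth x i).1 j).
Proof. by apply: (measurableT_comp (mG j)); exact: measurable_coord1. Qed.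

Lemma measurable_Ssum j : measurable_fun setT (fun x => Ssum x j).
Proof.
apply: measurable_funM => //; apply: measurable_sum => i; exact: measurable_Gcoord.
Qed.

Lemma measurable_Ysum j : measurable_fun setT (fun x => Ysum x j).
Proof.
apply: measurable_funM => //; apply: measurable_sum => i.
by apply: measurable_funM => //; exact: measurable_coord2.
Qed.

Lemma measurable_W s c j : measurable_fun setT (fun x => W s c x j).
Proof.
apply: measurable_funD; apply: measurable_funM => //.
  exact: measurable_Ssum.
exact: measurable_Ysum.
Qed.

Lemma integrable_coord2 i :
  mu.-integrable setT (EFin \o (fun x : n.-tuple E => (tnth x i).2)).
Proof.
apply/integrableP; split; first by apply/measurable_EFinP; exact: measurable_coord2.
rewrite (transport_ge0 (measurable_upd_snd i) (preserved_upd_snd hiid i))//; last first.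
  apply: measurableT_comp => //; apply/measurable_EFinP; exact: measurable_coord2.
under eq_integral => x _ do under eq_integral => z _ do rewrite /upd_snd /= tnth_upd eqxx /=.
have [_ h] := integrableP _ _ _ (integrable_normal_id R).
by rewrite integral_cst//= [X in (_ * X)%E](@probability_setT _ _ _ mu) mule1.
Qed.

Lemma normr_Gam_le j k : `|Gam j k| <= 1.
Proof.
have mGG : measurable_fun setT (fun a => G a j * G a k) by exact: measurable_funM.
have GG1 a : `|G a j * G a k| <= 1 by rewrite normrM mulr_ile1.
rewrite -[leRHS](Rintegral_const F) normr_Rintegral_le//.
  exact: integrable_bounded GG1.
exact: finite_measure_integrable_cst.
Qed.

Section gauge.
Variables (A A1 A2 : R -> R) (beta kappa t s c : R).
Hypothesis tA : tame A A1 A2.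
Hypothesis beta_gt0 : 0 < beta.
Hypothesis kappa_gt0 : 0 < kappa.
Hypothesis kappa_beta : kappa <= beta.
Hypothesis kappa_rn : 4 * (kappa * rn) <= 1.
Hypothesis s_le1 : `|s| <= 1.
Hypothesis c_le1 : `|c| <= 1.

Notation sf := (@sfield R J beta A kappa t).
Notation df := (@dfield R J beta A A1 kappa t).
Notation hf := (@hform R J beta A A1 kappa t).
Notation Aw x := (A (arg beta kappa t (W s c x))).

Lemma normr_sf_le y w : (forall j, `|w j| <= 1) -> `|sf y w| <= 1.
Proof.
move=> w1; rewrite /sfield normrM mulr_ile1//.
  by rewrite ger0_norm ?(tame_ge0 tA)// (tame_le1 tA).
exact: normr_mean_le.
Qed.

Lemma normr_hf_le y (M : J -> J -> R) a : (forall j k, `|M j k| <= a) ->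
  `|hf y M| <= 3 * beta * a.
Proof.
move=> Ma; have a0 : 0 <= a by apply: le_trans (Ma j0 j0); exact: normr_ge0.
apply: le_trans (hform_le j0 beta_gt0 t tA kappa_gt0 kappa_beta y Ma) _.
by rewrite -[leRHS]mulr1 ler_wpM2l ?(tame_le1 tA)// !mulr_ge0// ltW.
Qed.

(** [hform y] is a finite linear combination of the entries of its matrix, with its values on the
    elementary matrices [D p] as coefficients; it therefore commutes with the integral. *)
Lemma hf_Rintegral y (M : T -> J -> J -> R) :
  (forall j k, F.-integrable setT (EFin \o (fun a => M a j k))) ->
  F.-integrable setT (EFin \o (fun a => hf y (M a))) /\
  \int[F]_a hf y (M a) = hf y (fun j k => \int[F]_a M a j k).
Proof.
move=> iM.
pose D (p : J * J) (j k : J) : R := ((j == p.1) && (k == p.2))%:R.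
have e (N : J -> J -> R) : hf y N = \sum_(p : J * J) N p.1 p.2 * hf y (D p).
  under [RHS]eq_bigr do rewrite -hformZ.
  rewrite -hform_sum; congr hform; apply/funext => j; apply/funext => k.
  rewrite (bigD1 (j, k))//= big1 ?addr0 /D /= ?eqxx ?mulr1//.
  move=> [j' k'] /=; rewrite xpair_eqE !(eq_sym j') !(eq_sym k') => /negbTE ->.
  by rewrite mulr0.
have iMp (p : J * J) : F.-integrable setT (EFin \o (fun a => M a p.1 p.2 * hf y (D p))).
  rewrite (_ : (fun a => _) = (fun a => hf y (D p) * M a p.1 p.2)).
    exact: integrable_scale.
  by apply/funext => a; rewrite mulrC.
rewrite (_ : (fun a => _) = (fun a => \sum_(p : J * J) M a p.1 p.2 * hf y (D p))); last first.
  by apply/funext => a; exact: e.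
split; first exact: integrable_bigsum.
rewrite e Rintegral_bigsum//; apply: eq_bigr => p _.
by rewrite RintegralZr.
Qed.

Lemma mean_Rintegral y (w : T -> J -> R) :
  (forall j, F.-integrable setT (EFin \o (fun a => w a j))) ->
  \int[F]_a mean beta y (w a) = mean beta y (fun j => \int[F]_a w a j).
Proof.
move=> iw; rewrite Rintegral_bigsum; last by move=> j; exact: integrable_scale.
by apply: eq_bigr => j _; rewrite RintegralZl.
Qed.

Let iG j : F.-integrable setT (EFin \o (fun a => G a j)).
Proof. exact: integrable_bounded (fun a => G_le1 a j). Qed.

Let iGG j k : F.-integrable setT (EFin \o (fun a => G a j * G a k)).
Proof.
apply: (@integrable_bounded _ _ _ _ _ 1); first exact: measurable_funM.
by move=> a; rewrite normrM mulr_ile1.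
Qed.

(* Replacing [G (x_i)] by a fresh [G a] makes the direction independent of the
   point, so the zeroth order term integrates to 0 and the first order one to
   the covariance. *)
Lemma resampled_field_le i x :
  `|\int[F]_a sf (W s c (upd_fst i (x, a))) (G a) - s * rn * hf (W s c x) Gam|
   <= 208 * beta ^+ 2 * (rn * rn) * Aw x.
Proof.
set y := W s c x.
pose g := G (tnth x i).1.
pose L a := sf y (G a) + s * rn * (hf y (fun j k => G a j * G a k) -
                                   hf y (fun j k => G a j * g k)).
have mL0 : F.-integrable setT (EFin \o (fun a => sf y (G a))).
  apply: (@integrable_bounded _ _ _ _ _ 1).
    by apply: measurable_sfield (tame_der1 tA).
  by move=> a; exact: normr_sf_le.
have [i1 e1] := hf_Rintegral y iGG.
have iGg j k : F.-integrable setT (EFin \o (fun a => G a j * g k)).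
  rewrite (_ : (fun a => _) = (fun a => g k * G a j)); first exact: integrable_scale.
  by apply/funext => a; rewrite mulrC.
have [i2 e2] := hf_Rintegral y iGg.
have iL : F.-integrable setT (EFin \o L).
  by apply: integrable_add => //; apply: integrable_scale; exact: integrable_sub.
have intL : \int[F]_a L a = s * rn * hf y Gam.
  rewrite RintegralD//; last by apply: integrable_scale; exact: integrable_sub.
  rewrite RintegralZl//; last exact: integrable_sub.
  rewrite RintegralB// e1 e2.
  have -> : (fun j k => \int[F]_a (G a j * g k)) = (fun j k => 0 * g k).
    by apply/funext => j; apply/funext => k; rewrite RintegralZr// G_mean0.
  have -> : hf y (fun j k => 0 * g k) = 0 by rewrite hformZ mul0r.
  have -> : \int[F]_a sf y (G a) = 0.
    rewrite /sfield RintegralZl//; last first.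
      apply: (@integrable_bounded _ _ _ _ _ 1); first exact: measurable_mean.
      by move=> a; exact: normr_mean_le.
    rewrite mean_Rintegral//.
    have -> : (fun j => \int[F]_a G a j) = (fun=> 0) by apply/funext => j.
    by rewrite mean_cst// mulr0.
  by rewrite subr0 add0r.
have mf : measurable_fun setT (fun a => sf (W s c (upd_fst i (x, a))) (G a)).
  apply: measurable_sfield (tame_der1 tA) => // j.
  rewrite (_ : (fun a => _) = (fun a => y j + s * rn * (G a j - g j))).
    apply: measurable_funD => //; apply: measurable_funM => //.
    exact: measurable_funB.
  by apply/funext => a; rewrite W_upd_fst.
have if_ : F.-integrable setT (EFin \o (fun a => sf (W s c (upd_fst i (x, a))) (G a))).
  apply: (@integrable_bounded _ _ _ _ _ 1) => // a; exact: normr_sf_le.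
rewrite -intL -RintegralB// -[leRHS](Rintegral_const F).
apply: normr_Rintegral_le; first exact: integrable_sub.
  exact: finite_measure_integrable_cst.
move=> a; rewrite W_upd_fst -/y -/g.
have hu j : `|s * rn * (G a j - g j)| <= 2 * rn.
  rewrite !normrM (gtr0_norm rn_gt0) mulrAC ler_wpM2r ?(ltW rn_gt0)//.
  rewrite -[leRHS]mul1r ler_pM// (le_trans (ler_normB _ _))// mulr2n lerD//; exact: G_le1.
have -> : L a = sf y (G a) + df y (G a) (fun j => s * rn * (G a j - g j)).
  rewrite /L dfieldE; congr (_ + _).
  rewrite mulrBr -hformZ -hformZ -mulN1r -hformZ -hformD.
  by congr hform; apply/funext => j; apply/funext => k; ring.
rewrite opprD addrA.
apply: le_trans (sfield_taylor j0 beta_gt0 t tA kappa_gt0 kappa_beta y (G_le1 a) hu) _.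
(* [kappa_rn] bounds the exponent by 1, and e <= 4; together with the increment [2 * rn] the Taylor
   constant 13 becomes 13 * 4 * 4 = 208. *)
have e4 : expR (2 * (kappa * (2 * rn))) <= 4.
  have -> : 2 * (kappa * (2 * rn)) = 4 * (kappa * rn) by ring.
  by apply: le_trans (expR1_le4 R); rewrite ler_expR.
have A0 := tame_ge0 tA (arg beta kappa t y).
rewrite [leRHS](_ : _ = 13 * (beta ^+ 2 * (2 * rn) ^+ 2) * (4 * A (arg beta kappa t y))); last by ring.
rewrite ler_wpM2l//; first by rewrite !mulr_ge0// ?exprn_ge0// ?mulr_ge0// ltW// rn_gt0.
by rewrite ler_wpM2r.
Qed.

Lemma integrable_Aw : mu.-integrable setT (EFin \o (fun x => Aw x)).
Proof.
apply: (@integrable_bounded _ _ _ _ _ 1).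
  by apply: measurable_gauge (tame_der1 tA) => // j; exact: measurable_W.
by move=> x; rewrite ger0_norm ?(tame_ge0 tA) ?(tame_le1 tA).
Qed.

Lemma integrable_hfW (M : J -> J -> R) a : (forall j k, `|M j k| <= a) ->
  mu.-integrable setT (EFin \o (fun x => hf (W s c x) M)).
Proof.
move=> Ma; apply: (@integrable_bounded _ _ _ _ _ (3 * beta * a)).
  by apply: measurable_hform (tame_der1 tA) (tame_der2 tA) _ => // j; exact: measurable_W.
by move=> x; exact: normr_hf_le.
Qed.

Lemma integrable_sfW (w : n.-tuple E -> J -> R) :
  (forall j, measurable_fun setT (fun x => w x j)) -> (forall x j, `|w x j| <= 1) ->
  mu.-integrable setT (EFin \o (fun x => sf (W s c x) (w x))).
Proof.
move=> mw w1; apply: (@integrable_bounded _ _ _ _ _ 1).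
  by apply: measurable_sfield (tame_der1 tA) => // j; exact: measurable_W.
by move=> x; exact: normr_sf_le.
Qed.

Lemma sfield_comb y (b : R) (I : finType) (w : I -> J -> R) :
  sf y (fun j => b * \sum_i w i j) = b * \sum_i sf y (w i).
Proof.
rewrite /sfield meanZ mean_sum mulrCA; congr (_ * _).
by rewrite mulr_sumr.
Qed.

(** Each of the [n] coordinates contributes an error of order [rn * rn]; with the factor [rn] in
    front of the sum and [n * rn ^ 2 = 1], a single [rn] remains, still weighted by the mean of the
    gauge. *)
Lemma stein_sample :
  `|\int[mu]_x sf (W s c x) (Ssum x) - s * \int[mu]_x hf (W s c x) Gam|
   <= 208 * beta ^+ 2 * rn * \int[mu]_x Aw x.
Proof.
have i1 i : mu.-integrable setT
    (EFin \o (fun x => sf (W s c x) (G (tnth x i).1))).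
  by apply: integrable_sfW => [j|x j]; [exact: measurable_Gcoord|exact: G_le1].
have iH := integrable_hfW normr_Gam_le.
have iA := integrable_Aw.
have h i : `|\int[mu]_x sf (W s c x) (G (tnth x i).1) -
     s * rn * \int[mu]_x hf (W s c x) Gam| <=
     208 * beta ^+ 2 * (rn * rn) * \int[mu]_x Aw x.
  rewrite (transport (measurable_upd_fst i) (preserved_upd_fst hiid i) (i1 i)).
  have iT := integrable_transport (measurable_upd_fst i) (preserved_upd_fst hiid i) (i1 i).
  rewrite -RintegralZl// -RintegralB//; last exact: integrable_scale.
  rewrite -RintegralZl//; apply: normr_Rintegral_le.
  - by apply: integrable_sub => //; exact: integrable_scale.
  - exact: integrable_scale.
  move=> x; have := resampled_field_le i x; congr (`|_ - _| <= _).
  by apply: eq_Rintegral => a _; rewrite {2}/upd_fst tnth_upd eqxx.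
have e : \int[mu]_x sf (W s c x) (Ssum x) =
    rn * \sum_i \int[mu]_x sf (W s c x) (G (tnth x i).1).
  rewrite -Rintegral_bigsum// -RintegralZl//; last exact: integrable_bigsum.
  by apply: eq_Rintegral => x _; rewrite -sfield_comb.
have e2 : s * \int[mu]_x hf (W s c x) Gam =
    rn * \sum_(i < n) (s * rn * \int[mu]_x hf (W s c x) Gam).
  rewrite sumr_const card_ord -[X in _ = rn * X]mulr_natl.
  rewrite [RHS](_ : _ = (n%:R * (rn * rn)) * (s * \int[mu]_x hf (W s c x) Gam)).
    by rewrite rn2n mul1r.
  ring.
rewrite e e2 -mulrBr -sumrB normrM (gtr0_norm rn_gt0).
apply: (@le_trans _ _ (rn * \sum_(i < n) (208 * beta ^+ 2 * (rn * rn) * \int[mu]_x Aw x))).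
  rewrite ler_wpM2l ?(ltW rn_gt0)// (le_trans (ler_norm_sum _ _ _))//.
  by apply: ler_sum => i _.
rewrite sumr_const card_ord -[X in rn * X <= _]mulr_natl.
rewrite [leLHS](_ : _ = (n%:R * (rn * rn)) * (208 * beta ^+ 2 * rn * \int[mu]_x Aw x)).
  by rewrite rn2n mul1r.
ring.
Qed.

Lemma integrable_coord2_sf i (w : n.-tuple E -> J -> R) :
  (forall j, measurable_fun setT (fun x => w x j)) -> (forall x j, `|w x j| <= 1) ->
  mu.-integrable setT (EFin \o (fun x => (tnth x i).2 * sf (W s c x) (w x))).
Proof.
move=> mw w1.
rewrite (_ : (fun x => _) = (fun x => sf (W s c x) (w x) * (tnth x i).2)); last first.
  by apply/funext => x; rewrite mulrC.
apply: (@integrable_mul_bounded _ _ _ _ _ _ 1) (integrable_coord2 i).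
  by apply: measurable_sfield (tame_der1 tA) => // j; exact: measurable_W.
by move=> x; exact: normr_sf_le.
Qed.

(** Given all other coordinates, the point moves along a line as the Gaussian variable varies, and
    the field along this line is smooth and bounded: integration by parts leaves no error term. *)
Lemma stein_gauss :
  \int[mu]_x sf (W s c x) (Ysum x) = c * \int[mu]_x hf (W s c x) Sig.
Proof.
have i1 i : mu.-integrable setT
    (EFin \o (fun x => (tnth x i).2 * sf (W s c x) (v i))).
  exact: integrable_coord2_sf.
have vv i j k : `|v i j * v i k| <= 1 by rewrite normrM mulr_ile1.
have h i : \int[mu]_x ((tnth x i).2 * sf (W s c x) (v i)) =
     c * rn * \int[mu]_x hf (W s c x) (fun j k => v i j * v i k).
  pose u j := c * rn * v i j.
  have hu j : `|u j| <= rn.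
    rewrite /u !normrM (gtr0_norm rn_gt0) -[leRHS]mulr1 ler_pM ?mulr_ge0 ?(ltW rn_gt0)//.
    by rewrite -[leRHS]mul1r ler_wpM2r// ltW// rn_gt0.
  have iH : mu.-integrable setT (EFin \o (fun x => hf (W s c x) (fun j k => v i j * u k))).
    apply: (@integrable_hfW _ rn) => j k; rewrite normrM -[leRHS]mul1r.
    by rewrite ler_pM.
  have -> : c * rn * \int[mu]_x hf (W s c x) (fun j k => v i j * v i k) =
      \int[mu]_x hf (W s c x) (fun j k => v i j * u k).
    rewrite -RintegralZl//; last exact: (@integrable_hfW _ 1).
    apply: eq_Rintegral => x _; rewrite -hformZ; congr hform.
    by apply/funext => j; apply/funext => k; rewrite /u; ring.
  (* Both sides are resampled in the same multiplier, so that the identity can be proved for fixed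
     remaining coordinates. *)
  rewrite (transport (measurable_upd_snd i) (preserved_upd_snd hiid i) (i1 i)).
  rewrite [RHS](transport (measurable_upd_snd i) (preserved_upd_snd hiid i) iH).
  apply: eq_Rintegral => x _.
  pose base j := W s c x j - (tnth x i).2 * (c * rn * v i j).
  have eW xi : W s c (upd_snd i (x, xi)) = fun j => base j + xi * u j by exact: W_upd_snd.
  transitivity (\int[N01]_xi (xi * sf (fun j => base j + xi * u j) (v i))).
    by apply: eq_Rintegral => xi _; rewrite eW /upd_snd tnth_upd eqxx.
  have dd := @is_derive_dfield R J j0 beta beta_gt0 A A1 A2 kappa t tA base (v i) u.
  have d1 := @is_derive_sfield R J j0 beta beta_gt0 A A1 A2 kappa t tA base (v i) u.
  have c1 : continuous (fun xi : R => df (fun j => base j + xi * u j) (v i) u).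
    move=> xi; apply/differentiable_continuous/derivable1_diffP.
    by have := dd xi => ?; apply: ex_derive.
  have b1 (xi : R) : `|sf (fun j => base j + xi * u j) (v i)| <= 1 + 3 * beta * rn.
    apply: (@le_trans _ _ 1); first exact: normr_sf_le.
    by rewrite lerDl !mulr_ge0// ltW// rn_gt0.
  have b2 (xi : R) : `|df (fun j => base j + xi * u j) (v i) u| <= 1 + 3 * beta * rn.
    apply: (@le_trans _ _ (3 * beta * rn)); last by rewrite lerDr.
    rewrite dfieldE; apply: normr_hf_le => j k; rewrite normrM -[leRHS]mul1r.
    by rewrite ler_pM.
  rewrite (gaussian_ibp d1 c1 b1 b2).
  by apply: eq_Rintegral => xi _; rewrite eW dfieldE.
have e : \int[mu]_x sf (W s c x) (Ysum x) =
    rn * \sum_i \int[mu]_x ((tnth x i).2 * sf (W s c x) (v i)).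
  rewrite -Rintegral_bigsum// -RintegralZl//; last exact: integrable_bigsum.
  apply: eq_Rintegral => x _; rewrite /Ysum sfield_comb; congr (_ * _).
  by apply: eq_bigr => i _; rewrite /sfield meanZ mulrCA.
rewrite e; under eq_bigr do rewrite h.
have i2 i : mu.-integrable setT (EFin \o (fun x => rn * rn * hf (W s c x) (fun j k => v i j * v i k))).
  by apply: integrable_scale; exact: (@integrable_hfW _ 1).
have -> : \int[mu]_x hf (W s c x) Sig =
   \sum_i \int[mu]_x (rn * rn * hf (W s c x) (fun j k => v i j * v i k)).
  rewrite -Rintegral_bigsum//; apply: eq_Rintegral => x _.
  by rewrite /Sig hform_sum; apply: eq_bigr => i _; rewrite hformZ.
rewrite !mulr_sumr; apply: eq_bigr => i _.
rewrite RintegralZl//; last exact: (@integrable_hfW _ 1).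
ring.
Qed.


Lemma integrable_sf_Ssum :
  mu.-integrable setT (EFin \o (fun x => sf (W s c x) (Ssum x))).
Proof.
rewrite (_ : (fun x => _) = (fun x => rn * \sum_i sf (W s c x) (G (tnth x i).1))).
  apply: integrable_scale; apply: integrable_bigsum => i.
  by apply: integrable_sfW => [j|x j]; [exact: measurable_Gcoord|exact: G_le1].
by apply/funext => x; rewrite -sfield_comb.
Qed.

Lemma integrable_sf_Ysum :
  mu.-integrable setT (EFin \o (fun x => sf (W s c x) (Ysum x))).
Proof.
rewrite (_ : (fun x => _) = (fun x => rn * \sum_i (tnth x i).2 * sf (W s c x) (v i))).
  apply: integrable_scale; apply: integrable_bigsum => i.
  exact: integrable_coord2_sf.
apply/funext => x; rewrite /Ysum sfield_comb; congr (_ * _).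
by apply: eq_bigr => i _; rewrite /sfield meanZ mulrCA.
Qed.

End gauge.
End stein.

(** * Anti-concentration and Gaussian approximation of the maximum *)

Section subgaussian.
Context d (T : measurableType d) (R : realType) (F : probability T R).

Lemma hoeffding_mgf (f : T -> R) (theta : R) : measurable_fun setT f ->
  (forall a, `|f a| <= 1) -> \int[F]_a f a = 0 -> `|theta| <= 1 / 2 ->
  (\int[F]_a (expR (theta * f a))%:E <= (expR (2 * theta ^+ 2))%:E)%E.
Proof.
move=> mf f1 f0 th.
have if_ : F.-integrable setT (EFin \o f) by exact: integrable_bounded f1.
have ic (r : R) : F.-integrable setT (EFin \o (fun=> r)).
  exact: finite_measure_integrable_cst.
have thf a : `|theta * f a| <= `|theta|.
  by rewrite normrM -[leRHS]mulr1 ler_pM.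
have mexp : measurable_fun setT (fun a => expR (theta * f a)).
  by apply: measurableT_comp => //; exact: measurable_funM.
apply: (@le_trans _ _ (\int[F]_a (1 + theta * f a + 2 * theta ^+ 2)%:E)%E).
  apply: ge0_le_integral => //.
  - exact/measurable_EFinP.
  - apply/measurable_EFinP; apply: measurable_funD => //.
    by apply: measurable_funD => //; exact: measurable_funM.
  - move=> a _; rewrite lee_fin.
    have h := thf a; have h2 : theta * f a <= 1 / 2.
      by apply: le_trans th; apply: le_trans h; exact: ler_norm.
    apply: le_trans (expR_le_quadratic h2) _.
    rewrite lerD2l ler_pM2l// -real_normK ?num_real// -[leRHS]real_normK ?num_real//.
    by rewrite ler_sqr ?nnegrE.
rewrite -EFin_Rintegral; last by do ! apply: integrable_add => //; exact: integrable_scale.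
rewrite lee_fin RintegralD//; last by apply: integrable_add => //; exact: integrable_scale.
rewrite RintegralD//; last exact: integrable_scale.
rewrite RintegralZl// f0 mulr0 addr0 !Rintegral_const.
exact: expR_ge1Dx.
Qed.

End subgaussian.

Section gaussian_comparison.
Context dT (T : measurableType dT) (R : realType) (n : nat) (J : finType) (j0 : J).
Notation N01 := (@normal_prob R 0 1).
Notation E := (T * measurableTypeR R)%type.
Variables (F : probability T R) (mu : probability (n.-tuple E) R).
Hypothesis hiid : iid_law mu (F \x N01)%E.
Hypothesis n_gt0 : (0 < n)%N.
Variables (G : T -> J -> R) (v : 'I_n -> J -> R).
Hypothesis mG : forall j, measurable_fun setT (fun a => G a j).
Hypothesis G_le1 : forall a j, `|G a j| <= 1.
Hypothesis G_mean0 : forall j, \int[F]_a G a j = 0.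
Hypothesis v_le1 : forall i j, `|v i j| <= 1.

Notation rn := (@rn R n).
Notation W := (W G v).
Notation Gam := (Gam F G).
Notation Sig := (Sig v).
Notation NJ := (#|J|%:R : R).

Lemma WE s c x j : W s c x j = s * Ssum G x j + c * Ysum v x j.
Proof. by []. Qed.

Lemma unit_circle_le1 (s c : R) : s ^+ 2 + c ^+ 2 = 1 -> `|s| <= 1 /\ `|c| <= 1.
Proof.
have h (a b : R) : a ^+ 2 + b ^+ 2 = 1 -> `|a| <= 1.
  move=> ab; have := sqr_ge0 b; rewrite -(@ler_sqr _ `|a| 1) ?nnegrE//.
  by rewrite real_normK ?num_real// expr1n; lra.
by move=> sc; split; [exact: h sc|apply: (h c s); rewrite addrC].
Qed.

Lemma normr_Sig_le j k : `|Sig j k| <= 1.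
Proof.
have r0 := rn_gt0 R n_gt0.
rewrite /Sig (le_trans (ler_norm_sum _ _ _))// -[leRHS](rn2n R n_gt0).
rewrite mulr_natl -[X in _ *+ X](card_ord n) -sumr_const; apply: ler_sum => i _.
rewrite normrM ger0_norm ?mulr_ge0 ?(ltW r0)// -[leRHS]mulr1.
by rewrite ler_wpM2l ?mulr_ge0 ?(ltW r0)// normrM mulr_ile1.
Qed.

(** Each pair contributes a Hoeffding factor with constant 2 and a Gaussian one with constant 1/2,
    both in [(l * rn) ^+ 2]; the sum 5/2 is rounded up to 3, and [n * rn ^ 2 = 1] removes the
    dimension of the sample. *)
Lemma W_mgf s c (l : R) j : `|s| <= 1 -> `|c| <= 1 -> `|l| * rn <= 1 / 2 ->
  (\int[mu]_x (expR (l * W s c x j))%:E <= (expR (3 * l ^+ 2))%:E)%E.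
Proof.
move=> s1 c1 lr; have r0 := rn_gt0 R n_gt0.
pose th := l * s * rn; pose ga i := l * c * rn * v i j.
pose D (i : 'I_n) (x : n.-tuple E) := expR (th * G (tnth x i).1 j) * expR (ga i * (tnth x i).2).
have hth : `|th| <= `|l| * rn.
  rewrite /th !normrM (gtr0_norm r0) mulrAC -[leRHS]mulr1 ler_pM//.
  by rewrite mulr_ge0// ltW.
have hga i : `|ga i| <= `|l| * rn.
  rewrite /ga !normrM (gtr0_norm r0) -[leRHS]mulr1 ler_pM ?mulr_ge0 ?(ltW r0)//.
  by rewrite mulrAC -[leRHS]mulr1 ler_pM ?mulr_ge0 ?(ltW r0).
have mD i : measurable_fun setT (D i).
  apply: measurable_funM; apply: measurableT_comp => //; apply: measurable_funM => //.
    exact: measurable_Gcoord.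
  exact: measurable_coord2.
have D0 i x : 0 <= D i x by rewrite mulr_ge0 ?expR_ge0.
have hD : (\int[mu]_x (\prod_(i <- index_enum 'I_n) D i x)%:E <=
    (expR (3 * (l * rn) ^+ 2) ^+ size (index_enum 'I_n))%:E)%E.
  apply: (prod_resample (fun i => measurable_upd i) hiid) => //=.
    move=> i _ x.
    have mz : measurable_fun setT (fun z : E => (D i (upd x i z))%:E : \bar R).
      apply/measurable_EFinP; apply: (measurableT_comp (mD i)).
      exact: measurable_updr.
    rewrite fubini_tonelli1//; last by move=> z; rewrite lee_fin.
    have e a : fubini_F N01 (fun z : E => (D i (upd x i z))%:E) a =
       ((expR ((ga i) ^+ 2 / 2))%:E * (expR (th * G a j))%:E)%E.
      rewrite /fubini_F /D.
      under eq_integral do rewrite tnth_upd eqxx /= EFinM.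
      rewrite ge0_integralZl//.
      - by rewrite normal_mgf muleC.
      - apply/measurable_EFinP; apply: measurableT_comp => //.
    under eq_integral do rewrite e.
    rewrite ge0_integralZl//.
    - apply: (@le_trans _ _ ((expR (ga i ^+ 2 / 2))%:E * (expR (2 * th ^+ 2))%:E)%E).
        rewrite lee_wpmul2l ?lee_fin ?expR_ge0//; apply: hoeffding_mgf => //.
        exact: le_trans lr.
      rewrite -EFinM lee_fin -expRD ler_expR.
      have q (y : R) : `|y| <= `|l| * rn -> y ^+ 2 <= (l * rn) ^+ 2.
        move=> hy; rewrite -real_normK ?num_real// -[leRHS]real_normK ?num_real//.
        by rewrite ler_sqr ?nnegrE// normrM (gtr0_norm r0).
      by have := q _ hth; have := q _ (hga i); have := sqr_ge0 (ga i); lra.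
    - apply/measurable_EFinP; apply: measurableT_comp => //; exact: measurable_funM.
  have : uniq (index_enum 'I_n) by exact: index_enum_uniq.
  elim: (index_enum _) => [//|i r ih] /= /andP[ir ur]; rewrite ih// andbT.
  apply/allP => k kr; apply/asboolP => x z; rewrite /D tnth_upd.
  by case: eqP => // ki; move: ir; rewrite -ki kr.
have eW x : expR (l * W s c x j) = \prod_(i <- index_enum 'I_n) D i x.
  rewrite /D (eq_bigr (fun i => expR (th * G (tnth x i).1 j + ga i * (tnth x i).2))).
    rewrite -expR_sum; congr expR; rewrite WE /Ssum /Ysum big_split -!mulr_sumr /=.
    rewrite !mulr_sumr mulrDr !mulr_sumr; congr (_ + _); apply: eq_bigr => i _.
      by rewrite /th; ring.
    by rewrite /ga; ring.
  by move=> i _; rewrite expRD.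
under eq_integral do rewrite eW.
apply: le_trans hD _; rewrite lee_fin -expRM_natl ler_expR.
have -> : size (index_enum 'I_n) = n.
  by rewrite -[RHS](card_ord n) cardT enumT.
rewrite exprMn [leLHS](_ : _ = (n%:R * (rn * rn)) * (3 * l ^+ 2)); last by ring.
by rewrite rn2n// mul1r.
Qed.

Section scales.
Variables (beta kappa lam c1 : R).
Hypothesis beta_gt0 : 0 < beta.
Hypothesis kappa_gt0 : 0 < kappa.
Hypothesis kappa_beta : kappa <= beta.
Hypothesis kappa_rn : 4 * (kappa * rn) <= 1.
Hypothesis lam_gt0 : 0 < lam.
Hypothesis lam_rn : lam * rn <= 1 / 2.
Hypothesis c1_gt0 : 0 < c1.
Hypothesis Gam_diag : forall j, c1 <= Gam j j.
Hypothesis Sig_diag : forall j, c1 <= Sig j j.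

Notation warg t := (@arg R J beta kappa t).

(** [dev] is the Chernoff bound with parameter [lam] for the mean of max |W_j|, the 2 standing for
    the two signs. [anti] is what the Stein identities leave for the mean of [bump] after division
    by the lower bound [kappa * c1]. *)
Definition dev : R := (ln (2 * NJ) + 3 * lam ^+ 2) / lam.
Definition anti : R := (dev + 208 * beta ^+ 2 * rn) / (kappa * c1).

Lemma card_gt0 : 0 < NJ.
Proof. by rewrite ltr0n; apply/card_gt0P; exists j0. Qed.

(** The hypothesis on [f] says that it lies below max |W_j| without naming that maximum. *)
Lemma max_deviation s c (f : n.-tuple E -> R) : `|s| <= 1 -> `|c| <= 1 ->
  mu.-integrable setT (EFin \o f) ->
  (forall x b, (forall j, `|W s c x j| <= b) -> f x <= b) ->
  \int[mu]_x f x <= dev.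
Proof.
move=> s1 cc1 if_ fb.
pose a := 2 * NJ * expR (3 * lam ^+ 2).
have NJ0 := card_gt0.
have a0 : 0 < a by rewrite !mulr_gt0 ?expR_gt0.
pose h x := \sum_j (expR (lam * W s c x j) + expR ((- lam) * W s c x j)).
have mW j : measurable_fun setT (fun x => W s c x j) by exact: measurable_W.
have mexp l j : measurable_fun setT (fun x => expR (l * W s c x j)).
  by apply: measurableT_comp => //; exact: measurable_funM.
have lamn : `|lam| * rn <= 1 / 2 by rewrite gtr0_norm.
have iexp l j : `|l| = lam -> mu.-integrable setT (EFin \o (fun x => expR (l * W s c x j))) /\
     \int[mu]_x expR (l * W s c x j) <= expR (3 * lam ^+ 2).
  move=> hl; have hl2 : l ^+ 2 = lam ^+ 2 by rewrite -hl real_normK ?num_real.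
  have hl1 : `|l| * rn <= 1 / 2 by rewrite hl.
  have := W_mgf j s1 cc1 hl1; rewrite hl2 => hb.
  have il : mu.-integrable setT (EFin \o (fun x => expR (l * W s c x j))).
    apply/integrableP; split; first exact/measurable_EFinP.
    rewrite (_ : (fun x => _) = (fun x => (expR (l * W s c x j))%:E)).
      exact: le_lt_trans hb (ltry _).
    by apply/funext => x /=; rewrite ger0_norm ?expR_ge0.
  by split=> //; rewrite -lee_fin EFin_Rintegral.
have i1 j := (iexp lam j (gtr0_norm lam_gt0)).
have i2 j := (iexp (- lam) j (etrans (normrN _) (gtr0_norm lam_gt0))).
have ih : mu.-integrable setT (EFin \o h).
  by apply: integrable_bigsum => j; apply: integrable_add; [exact: (i1 j).1|exact: (i2 j).1].
have hI : \int[mu]_x h x <= a.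
  rewrite Rintegral_bigsum; last first.
    by move=> j; apply: integrable_add; [exact: (i1 j).1|exact: (i2 j).1].
  rewrite [leRHS](_ : _ = \sum_(j : J) (expR (3 * lam ^+ 2) + expR (3 * lam ^+ 2))).
    apply: ler_sum => j _; rewrite RintegralD//; last first.
    - exact: (i2 j).1.
    - exact: (i1 j).1.
    by apply: lerD; [exact: (i1 j).2|exact: (i2 j).2].
  by rewrite sumr_const -[RHS]mulr_natl /a; ring.
have ic (r : R) : mu.-integrable setT (EFin \o (fun=> r)).
  exact: finite_measure_integrable_cst.
apply: (@le_trans _ _ (\int[mu]_x ((ln a - 1) / lam + (lam * a)^-1 * h x))).
  apply: le_Rintegral => //; first by apply: integrable_add => //; exact: integrable_scale.
  move=> x _; apply: fb => j.
  have hx : expR (lam * `|W s c x j|) <= h x.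
    rewrite /h (bigD1 j)//= -[leLHS]addr0 lerD//; last first.
      by apply: sumr_ge0 => k _; rewrite addr_ge0 ?expR_ge0.
    case: (ger0P (W s c x j)) => _; first by rewrite lerDl expR_ge0.
    by rewrite mulrN mulNr lerDr expR_ge0.
  have e0 := expR_gt0 (lam * `|W s c x j|).
  (* The tangent line of [ln] at [a], affine in [h x], does the work of Jensen's inequality. *)
  have hl : lam * `|W s c x j| <= ln a + (h x / a - 1).
    have := expR_ge1Dx (lam * `|W s c x j| - ln a).
    rewrite expRD expRN lnK ?posrE// => hh.
    have : expR (lam * `|W s c x j|) / a <= h x / a by rewrite ler_pM2r ?invr_gt0.
    lra.
  rewrite -(ler_pM2l lam_gt0) [leRHS](_ : _ = ln a + (h x / a - 1))//.
  by field; rewrite !gt_eqF.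
rewrite RintegralD//; last exact: integrable_scale.
rewrite Rintegral_const RintegralZl//.
have -> : dev = (ln a - 1) / lam + (lam * a)^-1 * a.
  have -> : ln a = ln (2 * NJ) + 3 * lam ^+ 2.
    by rewrite /a lnM ?posrE ?expR_gt0// ?expRK// mulr_gt0.
  by rewrite /dev; field; rewrite !gt_eqF.
by rewrite lerD2l ler_wpM2l// invr_ge0 mulr_ge0// ltW.
Qed.

Lemma softmax2_rank1 y (w : J -> R) :
  \sum_j \sum_k softmax beta y j * softmax beta y k * (w j * w k) = mean beta y w ^+ 2.
Proof.
rewrite expr2 {1}/mean mulr_suml; apply: eq_bigr => j _.
by rewrite /mean mulr_sumr; apply: eq_bigr => k _; ring.
Qed.

(** Both inequalities are averages over [a] of the rank one case, where they say that a square is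
    nonnegative and that a squared mean is at most the mean of the squares. *)
Lemma Gam_psd y :
  0 <= \sum_j \sum_k softmax beta y j * softmax beta y k * Gam j k <=
    \sum_j softmax beta y j * Gam j j.
Proof.
have iGG j k : F.-integrable setT (EFin \o (fun a => G a j * G a k)).
  apply: (@integrable_bounded _ _ _ _ _ 1); first exact: measurable_funM.
  by move=> a; rewrite normrM mulr_ile1.
have e1 : \sum_j \sum_k softmax beta y j * softmax beta y k * Gam j k =
    \int[F]_a (mean beta y (G a) ^+ 2).
  transitivity (\int[F]_a (\sum_j \sum_k softmax beta y j * softmax beta y k * (G a j * G a k))).
    rewrite Rintegral_bigsum; last first.
      by move=> j; apply: integrable_bigsum => k; exact: integrable_scale.
    apply: eq_bigr => j _; rewrite Rintegral_bigsum; last first.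
      by move=> k; exact: integrable_scale.
    by apply: eq_bigr => k _; rewrite RintegralZl.
  by apply: eq_Rintegral => a _; rewrite softmax2_rank1.
have e2 : \sum_j softmax beta y j * Gam j j = \int[F]_a (\sum_j softmax beta y j * (G a j * G a j)).
  rewrite Rintegral_bigsum; last by move=> j; exact: integrable_scale.
  by apply: eq_bigr => j _; rewrite RintegralZl.
rewrite e1 e2; apply/andP; split; first by apply: Rintegral_ge0 => a _; exact: sqr_ge0.
apply: le_Rintegral => //.
- rewrite (_ : (fun a => _) = (fun a => \sum_j \sum_k softmax beta y j * softmax beta y k * (G a j * G a k))).
    by apply: integrable_bigsum => j; apply: integrable_bigsum => k; exact: integrable_scale.
  by apply/funext => a; rewrite softmax2_rank1.
- by apply: integrable_bigsum => j; exact: integrable_scale.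
by move=> a _; have := @cov_self_ge0 R J j0 beta y (G a); rewrite /cov subr_ge0 expr2.
Qed.

Lemma Sig_psd y :
  0 <= \sum_j \sum_k softmax beta y j * softmax beta y k * Sig j k <=
    \sum_j softmax beta y j * Sig j j.
Proof.
have r0 := rn_gt0 R n_gt0.
have e1 : \sum_j \sum_k softmax beta y j * softmax beta y k * Sig j k =
    \sum_i (rn * rn) * mean beta y (v i) ^+ 2.
  under [RHS]eq_bigr do rewrite -softmax2_rank1 mulr_sumr.
  rewrite [RHS]exchange_big; apply: eq_bigr => j _.
  under [RHS]eq_bigr do rewrite mulr_sumr.
  rewrite [RHS]exchange_big; apply: eq_bigr => k _.
  by rewrite /Sig mulr_sumr; apply: eq_bigr => i _; ring.
have e2 : \sum_j softmax beta y j * Sig j j =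
    \sum_i (rn * rn) * mean beta y (fun j => v i j * v i j).
  under [RHS]eq_bigr do rewrite /mean mulr_sumr.
  rewrite [RHS]exchange_big; apply: eq_bigr => j _.
  by rewrite /Sig mulr_sumr; apply: eq_bigr => i _; ring.
rewrite e1 e2; apply/andP; split.
  by apply: sumr_ge0 => i _; rewrite mulr_ge0 ?sqr_ge0// mulr_ge0// ltW.
apply: ler_sum => i _; rewrite ler_wpM2l ?mulr_ge0 ?(ltW r0)//.
by have := @cov_self_ge0 R J j0 beta y (v i); rewrite /cov subr_ge0 expr2.
Qed.

(* The identities for the increasing gauge [sigmoid] bound the integral of [hform] by the mean of
   the maximum, while [hform] is at least [kappa * c1] times the bump, which charges the levels
   near [t]: no separate Gaussian anti-concentration inequality is required. *)
Lemma anti_concentration s c t : s ^+ 2 + c ^+ 2 = 1 ->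
  \int[mu]_x bump (warg t (W s c x)) <= anti.
Proof.
move=> sc; have [s1 cc1] := unit_circle_le1 sc.
have ts := tame_sigmoid R; have r0 := rn_gt0 R n_gt0.
have H1 := stein_sample j0 hiid n_gt0 v mG G_le1 G_mean0 t c ts beta_gt0 kappa_gt0
   kappa_beta kappa_rn s1.
have H2 := stein_gauss j0 hiid n_gt0 mG v_le1 t s ts beta_gt0 kappa_gt0
   kappa_beta cc1.
have iS := integrable_sf_Ssum j0 mu v mG G_le1 beta kappa t s c ts.
have iY := integrable_sf_Ysum j0 hiid mG v_le1 beta kappa t s c ts.
set sf := sfield _ _ _ _ in H1 H2 iS iY.
set hf := hform _ _ _ _ _ in H1 H2.
have eW x : sf (W s c x) (W s c x) =
   s * sf (W s c x) (Ssum G x) + c * sf (W s c x) (Ysum v x).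
  by rewrite /sf /sfield meanD !meanZ; ring.
have iW : mu.-integrable setT (EFin \o (fun x => sf (W s c x) (W s c x))).
  rewrite (_ : (fun x => _) = (fun x => s * sf (W s c x) (Ssum G x) + c * sf (W s c x) (Ysum v x))).
    by apply: integrable_add; exact: integrable_scale.
  exact/funext.
have hdev : \int[mu]_x sf (W s c x) (W s c x) <= dev.
  apply: max_deviation s1 cc1 iW _ => x b hb.
  apply: le_trans (ler_norm _) _.
  have b0 : 0 <= b by apply: le_trans (hb j0); exact: normr_ge0.
  rewrite /sf /sfield normrM -[leRHS]mul1r ler_pM//; last exact: normr_mean_le.
  by rewrite ger0_norm ?(tame_ge0 ts) ?(tame_le1 ts).
have Sig1 j k : `|Sig j k| <= 1 by exact: normr_Sig_le.
have Gam1 j k : `|Gam j k| <= 1 by exact: normr_Gam_le.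
have iG : mu.-integrable setT (EFin \o (fun x => hf (W s c x) Gam)).
  exact: (integrable_hfW j0 mu v mG t s c ts beta_gt0 kappa_gt0 kappa_beta Gam1).
have iSi : mu.-integrable setT (EFin \o (fun x => hf (W s c x) Sig)).
  exact: (integrable_hfW j0 mu v mG t s c ts beta_gt0 kappa_gt0 kappa_beta Sig1).
have ib : mu.-integrable setT (EFin \o (fun x => bump (warg t (W s c x)))).
  exact: (integrable_Aw mu v mG beta kappa t s c (tame_bump R)).
have iA : mu.-integrable setT (EFin \o (fun x => sigmoid (warg t (W s c x)))).
  exact: (integrable_Aw mu v mG beta kappa t s c ts).
have low : kappa * c1 * \int[mu]_x bump (warg t (W s c x)) <=
    s ^+ 2 * \int[mu]_x hf (W s c x) Gam + c ^+ 2 * \int[mu]_x hf (W s c x) Sig.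
  rewrite -!RintegralZl// -RintegralD//; [|exact: integrable_scale|exact: integrable_scale].
  apply: le_Rintegral => //.
  - exact: integrable_scale.
  - by apply: integrable_add; exact: integrable_scale.
  move=> x _; set y := W s c x.
  rewrite -hformZ -hformZ -hformD.
  have /andP[g0 g1] := Gam_psd y; have /andP[s0 s1'] := Sig_psd y.
  have sq1 := sqr_ge0 s; have sq2 := sqr_ge0 c.
  have e2 : \sum_j \sum_k softmax beta y j * softmax beta y k * (s ^+ 2 * Gam j k + c ^+ 2 * Sig j k)
    = s ^+ 2 * (\sum_j \sum_k softmax beta y j * softmax beta y k * Gam j k) +
      c ^+ 2 * (\sum_j \sum_k softmax beta y j * softmax beta y k * Sig j k).
    rewrite !mulr_sumr -big_split; apply: eq_bigr => j _ /=.
    by rewrite !mulr_sumr -big_split; apply: eq_bigr => k _ /=; ring.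
  have e1 : \sum_j softmax beta y j * (s ^+ 2 * Gam j j + c ^+ 2 * Sig j j)
    = s ^+ 2 * (\sum_j softmax beta y j * Gam j j) + c ^+ 2 * (\sum_j softmax beta y j * Sig j j).
    by rewrite !mulr_sumr -big_split; apply: eq_bigr => j _ /=; ring.
  apply: hform_sigmoid_ge => //.
  - move=> j; have := Gam_diag j; have := Sig_diag j => h1 h2.
    have : s ^+ 2 * c1 <= s ^+ 2 * Gam j j by rewrite ler_wpM2l.
    have : c ^+ 2 * c1 <= c ^+ 2 * Sig j j by rewrite ler_wpM2l.
    have : s ^+ 2 * c1 + c ^+ 2 * c1 = c1 by rewrite -mulrDl sc mul1r.
    lra.
  - exact: ltW.
  - by rewrite e1 e2 lerD// ler_wpM2l.
  - by rewrite e2 addr_ge0// mulr_ge0.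
have EA : \int[mu]_x sigmoid (warg t (W s c x)) <= 1.
  rewrite -[leRHS](Rintegral_const mu); apply: le_Rintegral => //.
    exact: finite_measure_integrable_cst.
  by move=> x _; exact: tame_le1 ts _.
have eI : \int[mu]_x sf (W s c x) (W s c x) =
   s * \int[mu]_x sf (W s c x) (Ssum G x) + c * (c * \int[mu]_x hf (W s c x) Sig).
  rewrite -H2 -!RintegralZl// -RintegralD//; [|exact: integrable_scale|exact: integrable_scale].
  exact: eq_Rintegral.
rewrite /anti ler_pdivlMr ?mulr_gt0// mulrC; apply: le_trans low _.
set IS := \int[mu]_x sf _ (Ssum G x) in H1 eI *.
set IG := \int[mu]_x hf _ Gam in H1 *.
set ISig := \int[mu]_x hf _ Sig in eI *.
(* By [eI], s^2 IG + c^2 ISig is the mean of [sf W W] minus s (IS - s IG); [hdev] bounds the former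
   and the Stein estimate the latter. *)
have B0 : 0 <= 208 * beta ^+ 2 * rn by rewrite !mulr_ge0 ?sqr_ge0// ltW.
have H3 : `|s * (IS - s * IG)| <= 208 * beta ^+ 2 * rn.
  rewrite normrM -[leRHS]mul1r ler_pM//; apply: le_trans H1 _.
  by rewrite -[leRHS]mulr1 ler_wpM2l.
have H4 := le_trans (ler_norm _) (eq_ind _ (fun z => z <= _) H3 _ (esym (normrN _))).
have : - (s * (IS - s * IG)) <= 208 * beta ^+ 2 * rn by exact: H4.
rewrite !expr2; lra.
Qed.

End scales.

End gaussian_comparison.

(** * Events, indicators and their smoothing *)

Section indicators.
Context d (X : measurableType d) (R : realType) (mu : probability X R).

Lemma indic_bool (b : X -> bool) x : \1_[set x | b x] x = (b x)%:R :> R.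
Proof.
rewrite indicE; case: (boolP (b x)) => bx; first by rewrite mem_set.
by rewrite memNset//; exact/negP.
Qed.

Lemma integrable_bool (b : X -> bool) : measurable [set x | b x] ->
  mu.-integrable setT (EFin \o (fun x => (b x)%:R)).
Proof.
move=> mb; apply: (@integrable_bounded _ _ _ _ _ 1).
  rewrite (_ : (fun x => _) = \1_[set x | b x]); first exact: measurable_indic.
  by apply/funext => x; rewrite indic_bool.
by move=> x; case: (b x); rewrite ?normr1 ?normr0.
Qed.

Lemma probability_bool (b : X -> bool) : measurable [set x | b x] ->
  fine (mu [set x | b x]) = \int[mu]_x (b x)%:R.
Proof.
move=> mb; apply: EFin_inj; rewrite EFin_Rintegral; last exact: integrable_bool.
rewrite fineK; last exact: fin_num_measure.
under eq_integral do rewrite -indic_bool.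
by rewrite integral_indic// setIT.
Qed.

Lemma measurable_existsb (I : finType) (b : I -> X -> bool) :
  (forall i, measurable [set x | b i x]) -> measurable [set x | [exists i, b i x]].
Proof.
move=> mb; rewrite (_ : [set x | _] = \bigcup_(i in [set: I]) [set x | b i x]).
  exact: fin_bigcup_measurable.
by apply/seteqP; split=> [x /existsP[i bi]|x [i _ bi]]; [exists i|apply/existsP; exists i].
Qed.

Lemma measurable_orb (b b' : X -> bool) : measurable [set x | b x] ->
  measurable [set x | b' x] -> measurable [set x | b x || b' x].
Proof.
move=> mb mb'; rewrite (_ : [set x | _] = [set x | b x] `|` [set x | b' x]).
  exact: measurableU.
by apply/seteqP; split=> x /= => [/orP|h]; last apply/orP.
Qed.

Lemma measurable_leb (f : X -> R) (r : R) : measurable_fun setT f ->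
  measurable [set x | r <= f x].
Proof.
move=> mf; rewrite (_ : [set x | _] = setT `&` f @^-1` `[r, +oo[%classic).
  by apply: mf => //; exact: measurable_itv.
by rewrite setTI; apply/seteqP; split=> x /=; rewrite in_itv/= andbT.
Qed.

Lemma measurable_gtb (f : X -> R) (r : R) : measurable_fun setT f ->
  measurable [set x | r < f x].
Proof.
move=> mf; rewrite (_ : [set x | _] = setT `&` f @^-1` `]r, +oo[%classic).
  by apply: mf => //; exact: measurable_itv.
by rewrite setTI; apply/seteqP; split=> x /=; rewrite in_itv/= andbT.
Qed.

Lemma measurable_exists_lt (J : finType) (Z : X -> J -> R) (t : R) :
  (forall j, measurable_fun setT (fun x => Z x j)) ->
  measurable [set x | [exists j, t < Z x j]].
Proof. by move=> mZ; apply: measurable_existsb => j; exact: measurable_gtb. Qed.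

End indicators.

Section smoothed_indicator.
Variables (R : realType) (J : finType) (j0 : J) (beta kappa : R).
Hypothesis beta_gt0 : 0 < beta.
Hypothesis kappa_gt0 : 0 < kappa.
Hypothesis ln_card : kappa * ln #|J|%:R <= 2 * beta.
Implicit Types (y : J -> R) (t u : R).

Notation warg t := (@arg R J beta kappa t).
Notation exceeds y t := [exists j, t < y j].

Lemma sigmoid_ge_half u : 0 <= u -> 1 / 2 <= sigmoid u.
Proof.
move=> u0; rewrite /sigmoid mul1r lef_pV2 ?posrE ?addr_gt0 ?expR_gt0//.
by rewrite -[leRHS]/(1 + 1) lerD2l -expR0 ler_expR oppr_le0.
Qed.

Lemma sigmoid_compl_ge (k : nat) u : u <= k%:R -> (1 + 4 ^+ k)^-1 <= 1 - sigmoid u.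
Proof.
move=> uk; rewrite -sigmoidN /sigmoid opprK.
rewrite lef_pV2 ?posrE ?addr_gt0 ?expR_gt0 ?exprn_gt0// lerD2l.
apply: (@le_trans _ _ (expR k%:R)); first by rewrite ler_expR.
have -> : expR k%:R = expR 1 ^+ k :> R by rewrite -expRM_natl mulr1.
by apply: lerXn2r; rewrite ?nnegrE ?expR_ge0// expR1_le4.
Qed.

Lemma warg_gt0 y t j : t < y j -> 0 < warg t y.
Proof.
move=> tj; rewrite /arg mulr_gt0// subr_gt0 (lt_le_trans tj)//.
exact: lse_ge.
Qed.

Lemma warg_le y t b : (forall j, y j <= b) -> warg t y <= kappa * (b - t) + 2.
Proof.
move=> yb; have := lse_le j0 beta_gt0 yb => h.
have : kappa * ln #|J|%:R / beta <= 2 by rewrite ler_pdivrMr// mulrC.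
have : kappa * lse beta y <= kappa * (b + ln #|J|%:R / beta) by rewrite ler_pM2l.
have -> : kappa * (b + ln #|J|%:R / beta) = kappa * b + kappa * ln #|J|%:R / beta by ring.
by rewrite /arg !mulrBr; lra.
Qed.

(** If the maximum exceeds [t], then [arg] is positive and [sigmoid] at least 1/2, so the error
    [1 - sigmoid] is at most twice the bump. Otherwise the overshoot keeps [arg] below 2, so
    [1 - sigmoid] is at least 1/(1 + 4^2), rounded to 1/20, and the error [sigmoid] is at most 20
    bumps. *)
Lemma exceeds_sigmoid y t :
  `|(exceeds y t)%:R - sigmoid (warg t y)| <= 20 * bump (warg t y).
Proof.
have s0 := sigmoid_gt0 (warg t y); have s1 := sigmoid_lt1 (warg t y).
case: existsP => [[j tj]|hn].
  have h := sigmoid_ge_half (ltW (warg_gt0 tj)).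
  rewrite (_ : true%:R = 1 :> R)// ger0_norm /bump ?subr_ge0 ?ltW//.
  set s := sigmoid _ in s0 s1 h *.
  have : 0 <= (1 - s) * (s - 1 / 2) by rewrite mulr_ge0// subr_ge0// ltW.
  nra.
have yt j : y j <= t by rewrite leNgt; apply/negP => tj; apply: hn; exists j.
have := warg_le t yt; rewrite subrr mulr0 add0r => /(sigmoid_compl_ge (k := 2)).
rewrite sub0r normrN gtr0_norm// /bump => h.
have : 1 / 20 <= 1 - sigmoid (warg t y).
  by apply: le_trans h; rewrite mul1r lef_pV2 ?posrE; lra.
set s := sigmoid _ in s0 s1 *; move=> hs.
have : 0 <= s * (1 - s - 1 / 20) by rewrite mulr_ge0 ?subr_ge0// ltW.
nra.
Qed.

(** When the left side is 1, [arg] lies in (0, 3], where [sigmoid] is at least 1/2 and its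
    complement at least 1/(1 + 4^3) = 1/65; hence 130. *)
Lemma exceeds_gap y t delta : kappa * delta <= 1 ->
  (exceeds y t)%:R - (exceeds y (t + delta))%:R <= 130 * bump (warg t y) :> R.
Proof.
move=> kd.
have s0 := sigmoid_gt0 (warg t y); have s1 := sigmoid_lt1 (warg t y).
have b0 := bump_gt0 (warg t y).
case: (boolP (exceeds y t)) => [/existsP[j tj]|_]; last first.
  by case: existsP => _ /=; rewrite ?subr0 ?sub0r ?mulr1n ?mulr0n; lra.
case: existsP => [_|hn]; first by rewrite subrr; lra.
have yt k : y k <= t + delta.
  by rewrite leNgt; apply/negP => tk; apply: hn; exists k.
have := warg_le t yt; have -> : t + delta - t = delta by ring.
move=> hw.
have hw3 : warg t y <= 3%:R.
  apply: le_trans hw _; rewrite [3%:R](_ : _ = 1 + 2 :> R); last by ring.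
  by rewrite lerD2r.
have hh := sigmoid_ge_half (ltW (warg_gt0 tj)).
have := sigmoid_compl_ge hw3; rewrite /bump => h.
have : 1 / 65 <= 1 - sigmoid (warg t y).
  by apply: le_trans h; rewrite mul1r lef_pV2 ?posrE; lra.
rewrite (_ : true%:R = 1 :> R)// subr0.
set s := sigmoid _ in s0 s1 hh *; move=> hs.
have : 0 <= (s - 1 / 2) * (1 - s - 1 / 65) by rewrite mulr_ge0 ?subr_ge0.
nra.
Qed.

End smoothed_indicator.

Lemma dist_via (R : realType) (p q p' q' a b : R) : `|p - p'| <= 20 * a ->
  `|q - q'| <= 20 * a -> `|p' - q'| <= 2 * b -> `|p - q| <= 40 * a + 2 * b.
Proof.
move=> h1 h2 h3; have -> : p - q = (p - p') + (p' - q') - (q - q') by ring.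
apply: le_trans (ler_normB _ _) _; apply: le_trans (lerD (ler_normD _ _) (lexx _)) _.
lra.
Qed.

Lemma normr_mul_le2 (R : realType) (a b c : R) : `|a| <= b -> 0 <= c -> c <= 2 ->
  `|a * (c - 0)| <= 2 * b.
Proof. by move=> ab c0 c2; rewrite subr0 normrM mulrC ler_pM// ger0_norm. Qed.

(** * Kolmogorov distance between the maxima by interpolation *)

Section kolmogorov.
Context dT (T : measurableType dT) (R : realType) (n : nat) (J : finType) (j0 : J).
Notation N01 := (@normal_prob R 0 1).
Notation E := (T * measurableTypeR R)%type.
Variables (F : probability T R) (mu : probability (n.-tuple E) R).
Hypothesis hiid : iid_law mu (F \x N01)%E.
Hypothesis n_gt0 : (0 < n)%N.
Variables (G : T -> J -> R) (v : 'I_n -> J -> R).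
Hypothesis mG : forall j, measurable_fun setT (fun a => G a j).
Hypothesis G_le1 : forall a j, `|G a j| <= 1.
Hypothesis G_mean0 : forall j, \int[F]_a G a j = 0.
Hypothesis v_le1 : forall i j, `|v i j| <= 1.

Notation rn := (@rn R n).
Notation W := (W G v).
Notation Gam := (Gam F G).
Notation Sig := (Sig v).

Variables (beta kappa lam c1 Delta : R).
Hypothesis beta_gt0 : 0 < beta.
Hypothesis kappa_gt0 : 0 < kappa.
Hypothesis kappa_beta : kappa <= beta.
Hypothesis kappa_rn : 4 * (kappa * rn) <= 1.
Hypothesis lam_gt0 : 0 < lam.
Hypothesis lam_rn : lam * rn <= 1 / 2.
Hypothesis c1_gt0 : 0 < c1.
Hypothesis Gam_diag : forall j, c1 <= Gam j j.
Hypothesis Sig_diag : forall j, c1 <= Sig j j.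
Hypothesis ln_card : kappa * ln #|J|%:R <= 2 * beta.
Hypothesis Gam_Sig : forall j k, `|Gam j k - Sig j k| <= Delta.

Notation warg t := (@arg R J beta kappa t).
Notation sb t := (@sfield R J beta (@bump R) kappa t).
Notation hb t := (@hform R J beta (@bump R) (fun x => bump x * (1 - 2 * sigmoid x)) kappa t).
Notation anti := (anti n J beta kappa lam c1).
Notation Wa a := (W (sin a) (cos a)).

Let anti_conc s c t : s ^+ 2 + c ^+ 2 = 1 -> \int[mu]_x bump (warg t (W s c x)) <= anti.
Proof. exact: anti_concentration. Qed.

Let sc a : sin a ^+ 2 + cos a ^+ 2 = 1 :> R.
Proof. by rewrite addrC cos2Dsin2. Qed.

Let r0 : 0 < rn := rn_gt0 R n_gt0.

Lemma integrable_Ssum j : mu.-integrable setT (EFin \o (fun x => Ssum G x j)).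
Proof.
apply: integrable_scale; apply: integrable_bigsum => i.
by apply: (@integrable_bounded _ _ _ _ _ 1); [exact: measurable_Gcoord|move=> x].
Qed.

Lemma integrable_Ysum j : mu.-integrable setT (EFin \o (fun x => Ysum v x j)).
Proof.
apply: integrable_scale; apply: integrable_bigsum => i.
rewrite (_ : (fun x => _) = (fun x => v i j * (tnth x i).2)).
  by apply: integrable_scale; exact: (integrable_coord2 hiid).
by apply/funext => x; rewrite mulrC.
Qed.

(** The angle 0 is Y and pi/2 is S. In the angle, the weights [sin] and [cos] have bounded
    derivatives up to both ends, whereas those of sqrt t and sqrt (1 - t) blow up. *)
Definition path_der t (a : R) : R := kappa *
  (cos a * \int[mu]_x sb t (Wa a x) (Ssum G x) - sin a * \int[mu]_x sb t (Wa a x) (Ysum v x)).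

Lemma is_derive_path t x (a : R) :
  is_derive a 1 (fun a => sigmoid (warg t (Wa a x)))
    (kappa * (cos a * sb t (Wa a x) (Ssum G x) - sin a * sb t (Wa a x) (Ysum v x))).
Proof.
have dW j : is_derive a 1 (fun a => Wa a x j) (cos a * Ssum G x j + (- sin a) * Ysum v x j).
  have h1 := is_derive_mul (is_derive_sin a) (is_derive_const (Ssum G x j) a).
  have h2 := is_derive_mul (is_derive_cos a) (is_derive_const (Ysum v x j) a).
  apply: (is_derive_ext (is_derive_add h1 h2)) => //; ring.
have := @is_derive_comp R (@sigmoid R) (fun a => warg t (Wa a x)) a _ _
  (is_derive_sigmoid (warg t (Wa a x)))
  (is_derive_arg j0 beta_gt0 kappa t (Y := fun a => Wa a x)
     (Y' := fun a j => cos a * Ssum G x j + (- sin a) * Ysum v x j) dW).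
move/is_derive_ext; apply => //.
by rewrite /sfield meanD !meanZ; ring.
Qed.

Lemma is_derive_expected_path t (a : R) :
  is_derive a 1 (fun a => \int[mu]_x sigmoid (warg t (Wa a x))) (path_der t a).
Proof.
pose f (a : R) (x : n.-tuple E) := sigmoid (warg t (Wa a x)).
(* The dominating function must not depend on the angle; a sum over all coordinates is wasteful but
   integrable, and only its finiteness matters. *)
pose H x := kappa * \sum_j (`|Ssum G x j| + `|Ysum v x j|).
have iH : mu.-integrable setT (EFin \o H).
  apply: integrable_scale; apply: integrable_bigsum => j; apply: integrable_add.
    exact: (integrable_norm (integrable_Ssum j)).
  exact: (integrable_norm (integrable_Ysum j)).
have intf b : mu.-integrable setT (EFin \o f b).
  exact: (integrable_Aw mu v mG beta kappa t (sin b) (cos b) (tame_sigmoid R)).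
have derf b x : derivable (f ^~ x) b 1.
  by have := is_derive_path t x b => ?; apply: ex_derive.
have H0 x : 0 <= H x by rewrite mulr_ge0 ?(ltW kappa_gt0)// sumr_ge0// => j _; rewrite addr_ge0.
have d1E b x : partial1of2 f b x =
   kappa * (cos b * sb t (Wa b x) (Ssum G x) - sin b * sb t (Wa b x) (Ysum v x)).
  by rewrite partial1of2E; have := is_derive_path t x b => ?; apply: derive_val.
have Hub b x : `|partial1of2 f b x| <= H x.
  rewrite d1E normrM (gtr0_norm kappa_gt0) ler_pM2l//.
  have -> : cos b * sb t (Wa b x) (Ssum G x) - sin b * sb t (Wa b x) (Ysum v x) =
     sb t (Wa b x) (fun j => cos b * Ssum G x j + (- sin b) * Ysum v x j).
    by rewrite /sfield meanD !meanZ; ring.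
  rewrite /sfield normrM -[leRHS]mul1r ler_pM//.
    by rewrite ger0_norm ?(tame_ge0 (tame_bump R)) ?(tame_le1 (tame_bump R)).
  apply: normr_mean_le => // j; rewrite (bigD1 j)//= -[leLHS]addr0 lerD//; last first.
    by apply: sumr_ge0 => k _; rewrite addr_ge0.
  apply: le_trans (ler_normD _ _) _; rewrite !normrM normrN.
  by apply: lerD; rewrite -[leRHS]mul1r ler_wpM2r// ?cos_max ?sin_max.
have Ia : `]a - 1, a + 1[%classic a.
  by rewrite /= in_itv /= ltrBlDr ltrDl ltr01.
have e := differentiation_under_integral measurableT Ia (fun b _ => intf b)
  (fun b x _ _ => derf b x) H0 iH (fun b x _ _ => Hub b x).
have d := derivable_under_integral measurableT Ia (fun b _ => intf b)
  (fun b x _ _ => derf b x) H0 iH (fun b x _ _ => Hub b x).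
apply: (is_derive_ext (derivableP d)) => //.
rewrite -derive1E e /path_der.
have iS := integrable_sf_Ssum j0 mu v mG G_le1 beta kappa t (sin a) (cos a) (tame_bump R).
have iY := integrable_sf_Ysum j0 hiid mG v_le1 beta kappa t (sin a) (cos a) (tame_bump R).
rewrite -[in RHS]RintegralZl// -[in RHS]RintegralZl// -RintegralB//; last 2 first.
- exact: integrable_scale.
- exact: integrable_scale.
rewrite -[RHS]RintegralZl//; last by apply: integrable_sub; exact: integrable_scale.
by apply: eq_Rintegral => x _; rewrite d1E.
Qed.

(** The two identities contribute [sin a * IG] and [cos a * ISi], which combine to [cos a * sin a]
    times the difference of the two covariance forms. This difference and the Stein error both carry
    the mean of [bump], which is at most [anti]. *)
Lemma path_der_le t a :
  `|path_der t a| <= kappa * (3 * beta * Delta + 208 * beta ^+ 2 * rn) * anti.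
Proof.
have tb := tame_bump R.
have s1 := @sin_max R a; have c1' := @cos_max R a.
have H1 := stein_sample j0 hiid n_gt0 v mG G_le1 G_mean0 t (cos a) tb beta_gt0 kappa_gt0
   kappa_beta kappa_rn s1.
have H2 := stein_gauss j0 hiid n_gt0 mG v_le1 t (sin a) tb beta_gt0 kappa_gt0
   kappa_beta c1'.
have Sig1 j k : `|Sig j k| <= 1 by exact: normr_Sig_le.
have Gam1 j k : `|Gam j k| <= 1 by exact: normr_Gam_le.
have iG := integrable_hfW j0 mu v mG t (sin a) (cos a) tb beta_gt0 kappa_gt0 kappa_beta Gam1.
have iSi := integrable_hfW j0 mu v mG t (sin a) (cos a) tb beta_gt0 kappa_gt0 kappa_beta Sig1.
have ib := integrable_Aw mu v mG beta kappa t (sin a) (cos a) tb.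
have hD : `|\int[mu]_x hb t (Wa a x) Gam - \int[mu]_x hb t (Wa a x) Sig| <=
    3 * beta * Delta * \int[mu]_x bump (warg t (Wa a x)).
  rewrite -RintegralB// -RintegralZl//; apply: normr_Rintegral_le.
  - exact: integrable_sub.
  - exact: integrable_scale.
  move=> x; rewrite -mulN1r -hformZ -hformD.
  apply: (hform_le j0 beta_gt0 t tb kappa_gt0 kappa_beta) => j k.
  by rewrite mulN1r.
have ac := anti_conc t (sc a).
have b0 : 0 <= \int[mu]_x bump (warg t (Wa a x)).
  by apply: Rintegral_ge0 => x _; exact: tame_ge0 tb _.
have D0 : 0 <= Delta by apply: le_trans (Gam_Sig j0 j0).
rewrite /path_der H2 normrM (gtr0_norm kappa_gt0) -mulrA ler_pM2l//.
set IS := \int[mu]_x sb t _ _ in H1 *.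
set IG := \int[mu]_x hb t _ Gam in H1 hD *.
set ISi := \int[mu]_x hb t _ Sig in hD *.
set Ib := \int[mu]_x bump _ in H1 hD ac b0 *.
have -> : cos a * IS - sin a * (cos a * ISi) =
   cos a * (IS - sin a * IG) + (cos a * sin a) * (IG - ISi) by ring.
apply: le_trans (ler_normD _ _) _; rewrite !normrM.
apply: (@le_trans _ _ (208 * beta ^+ 2 * rn * Ib + 3 * beta * Delta * Ib)).
  apply: lerD; rewrite -[leRHS]mul1r ler_pM// ?mulr_ge0//.
  by rewrite mulr_ile1.
rewrite addrC -mulrDl ler_wpM2l//.
have bb := ltW beta_gt0; have rr := ltW r0.
by rewrite addr_ge0 ?mulr_ge0 ?sqr_ge0.
Qed.

Notation exceeds y t := [exists j, t < y j].

Lemma measurable_exceeds_Ssum t : measurable [set x : n.-tuple E | exceeds (Ssum G x) t].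
Proof. by apply: measurable_exists_lt => j; exact: measurable_Ssum. Qed.

Lemma measurable_exceeds_Ysum t : measurable [set x : n.-tuple E | exceeds (Ysum v x) t].
Proof. by apply: measurable_exists_lt => j; exact: measurable_Ysum. Qed.

Let W10 (x : n.-tuple E) : W 1 0 x = Ssum G x.
Proof. by apply/funext => j; rewrite WE mul1r mul0r addr0. Qed.

Let W01 (x : n.-tuple E) : W 0 1 x = Ysum v x.
Proof. by apply/funext => j; rewrite WE mul1r mul0r add0r. Qed.

Let smooth_gap (Z : n.-tuple E -> J -> R) s c t : s ^+ 2 + c ^+ 2 = 1 ->
  (forall x, W s c x = Z x) -> measurable [set x | exceeds (Z x) t] ->
  `|fine (mu [set x | exceeds (Z x) t]) - \int[mu]_x sigmoid (warg t (Z x))| <= 20 * anti.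
Proof.
move=> sc1 hZ mZ; have eZ : Z = W s c by apply/funext.
rewrite {}eZ {hZ} in mZ *; rewrite probability_bool//.
have iA := integrable_Aw mu v mG beta kappa t s c (tame_sigmoid R).
have ib := integrable_Aw mu v mG beta kappa t s c (tame_bump R).
have iE := integrable_bool mu mZ.
rewrite -RintegralB//; apply: le_trans (_ : _ <= 20 * \int[mu]_x bump (warg t (W s c x))) _.
  rewrite -RintegralZl//; apply: normr_Rintegral_le.
  - exact: integrable_sub.
  - exact: integrable_scale.
  by move=> x; exact: exceeds_sigmoid.
by rewrite ler_pM2l//; exact: anti_conc.
Qed.

(** Smoothing costs [20 * anti] at each end, and the path has length pi/2 < 2. *)
Lemma kolmogorov t :
  `|fine (mu [set x | exceeds (Ssum G x) t]) - fine (mu [set x | exceeds (Ysum v x) t])|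
  <= 40 * anti + 2 * (kappa * (3 * beta * Delta + 208 * beta ^+ 2 * rn) * anti).
Proof.
have sc10 : (1 : R) ^+ 2 + 0 ^+ 2 = 1 by rewrite expr1n expr0n addr0.
have sc01 : (0 : R) ^+ 2 + 1 ^+ 2 = 1 by rewrite expr1n expr0n add0r.
have h1 := smooth_gap sc10 W10 (measurable_exceeds_Ssum t).
have h2 := smooth_gap sc01 W01 (measurable_exceeds_Ysum t).
have pi0 : 0 <= pi / 2 :> R by rewrite divr_ge0// pi_ge0.
pose f a := \int[mu]_x sigmoid (warg t (Wa a x)).
have fS : \int[mu]_x sigmoid (warg t (Ssum G x)) = f (pi / 2).
  by apply: eq_Rintegral => x _; rewrite sin_pihalf cos_pihalf W10.
have fY : \int[mu]_x sigmoid (warg t (Ysum v x)) = f 0.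
  by apply: eq_Rintegral => x _; rewrite sin0 cos0 W01.
have [b _ e] : exists2 b, 0 <= b <= pi / 2 & f (pi / 2) - f 0 = path_der t b * (pi / 2 - 0).
  exact: (MVT_is_derive pi0 (is_derive_expected_path t)).
have e' := etrans (congr2 (fun p q => p - q) fS fY) e.
apply: (dist_via h1 h2).
have h : `|path_der t b * (pi / 2 - 0)| <=
    2 * (kappa * (3 * beta * Delta + 208 * beta ^+ 2 * rn) * anti).
  exact: normr_mul_le2 (path_der_le t b) pi0 (ltW (pihalf_lt2 R)).
exact: (eq_ind _ (fun z => `|z| <= _) h _ (esym e')).
Qed.

Lemma max_anti_concentration t delta : 0 <= delta -> kappa * delta <= 1 ->
  fine (mu [set x | exceeds (Ssum G x) t]) - fine (mu [set x | exceeds (Ssum G x) (t + delta)])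
  <= 130 * anti.
Proof.
move=> d0 kd.
have sc10 : (1 : R) ^+ 2 + 0 ^+ 2 = 1 by rewrite expr1n expr0n addr0.
have m1 := measurable_exceeds_Ssum t; have m2 := measurable_exceeds_Ssum (t + delta).
have i1 := integrable_bool mu m1; have i2 := integrable_bool mu m2.
have ib := integrable_Aw mu v mG beta kappa t 1 0 (tame_bump R).
rewrite !probability_bool// -RintegralB//.
apply: le_trans (_ : _ <= 130 * \int[mu]_x bump (warg t (W 1 0 x))) _.
  rewrite -RintegralZl//; apply: le_Rintegral => //.
  - exact: integrable_sub.
  - exact: integrable_scale.
  by move=> x _; rewrite W10; exact: exceeds_gap.
by rewrite ler_pM2l//; exact: anti_conc.
Qed.

End kolmogorov.

(** * Concentration of the U-statistic *)

Section union_bound.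
Context d (X : measurableType d) (R : realType) (mu : probability X R).

Lemma union_bound (I : finType) (b : I -> X -> bool) (c : R) :
  (forall i, measurable [set x | b i x]) ->
  (forall i, fine (mu [set x | b i x]) <= c) ->
  fine (mu [set x | [exists i, b i x]]) <= #|I|%:R * c.
Proof.
move=> mb hb; have me := measurable_existsb mb.
rewrite probability_bool//.
apply: (@le_trans _ _ (\int[mu]_x \sum_i (b i x)%:R)).
  apply: le_Rintegral => //; first exact: integrable_bool.
    by apply: integrable_bigsum => i; exact: integrable_bool.
  move=> x _; case: existsP => [[i bi]|_] /=; last by rewrite sumr_ge0.
  by rewrite (bigD1 i)//= bi lerDl sumr_ge0.
rewrite Rintegral_bigsum; last by move=> i; exact: integrable_bool.
rewrite mulr_natl -sumr_const; apply: ler_sum => i _.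
by rewrite -probability_bool.
Qed.

Lemma union_bound2 (b b' : X -> bool) : measurable [set x | b x] ->
  measurable [set x | b' x] ->
  fine (mu [set x | b x || b' x]) <= fine (mu [set x | b x]) + fine (mu [set x | b' x]).
Proof.
move=> mb mb'; have mo := measurable_orb mb mb'.
rewrite !probability_bool// -RintegralD//; try exact: integrable_bool.
apply: le_Rintegral => //; first exact: integrable_bool.
  by apply: integrable_add; exact: integrable_bool.
by move=> x _; case: (b x) => /=; rewrite ?add0r// lerDl.
Qed.

Lemma probability_subset (b b' : X -> bool) : measurable [set x | b x] ->
  measurable [set x | b' x] -> (forall x, b x -> b' x) ->
  fine (mu [set x | b x]) <= fine (mu [set x | b' x]).
Proof.
move=> mb mb' bb'; rewrite !probability_bool//; apply: le_Rintegral => //.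
- exact: integrable_bool.
- exact: integrable_bool.
move=> x _; case: (boolP (b x)) => [/bb' ->//|_] /=; exact: ler0n.
Qed.

End union_bound.

Section conditional_hoeffding.
Context d d' (X : measurableType d) (Y : measurableType d') (R : realType).
Variables (mu : probability X R) (Q : probability Y R) (I : eqType).
Variable u : I -> X * Y -> X.
Hypothesis mu_u : forall l, measurable_fun setT (u l).
Hypothesis hu : forall l, preserved mu Q (u l).

(** Refreshing an index has to leave fixed only the terms listed after it, so the order of [s]
    matters for martingale differences. *)
Definition independent_coords (phi : I -> X -> R) (s : seq I) : bool :=
  pairwise (fun l l' => `[< forall x z, phi l' (u l (x, z)) = phi l' x >]) s.

Lemma conditional_chernoff (phi : I -> X -> R) (s : seq I) (theta c r : R) :
  (forall l, measurable_fun setT (phi l)) ->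
  (forall l, l \in s -> forall x,
     \int[Q]_z (expR (theta * phi l (u l (x, z))))%:E <= (expR c)%:E)%E ->
  independent_coords phi s ->
  0 <= theta ->
  fine (mu [set x | r <= \sum_(l <- s) phi l x]) <= expR ((size s)%:R * c - theta * r).
Proof.
move=> mphi hphi ind th0.
pose D l x := expR (theta * phi l x).
have mD l : measurable_fun setT (D l).
  by apply: measurableT_comp => //; exact: measurable_funM.
have hD : (\int[mu]_x (\prod_(l <- s) D l x)%:E <= (expR c ^+ size s)%:E)%E.
  apply: (prod_resample mu_u hu) => //; first by move=> l x; exact: expR_ge0.
  by apply: sub_pairwise ind => l l' /asboolP h; apply/asboolP => x z; rewrite /D h.
have eS x : \prod_(l <- s) D l x = expR (theta * \sum_(l <- s) phi l x).
  by rewrite mulr_sumr expR_sum.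
have msum : measurable_fun setT (fun x => \sum_(l <- s) phi l x) by exact: measurable_sum.
have mexp : measurable_fun setT (fun x => expR (theta * \sum_(l <- s) phi l x)).
  by apply: measurableT_comp => //; exact: measurable_funM.
have hD2 : (\int[mu]_x (expR (theta * \sum_(l <- s) phi l x))%:E <= (expR ((size s)%:R * c))%:E)%E.
  by rewrite expRM_natl; under eq_integral do rewrite -eS.
have := markov_ge0 mexp (fun x => expR_ge0 _) (expR_gt0 (theta * r)) hD2.
rewrite -expRN -expRD; apply: le_trans.
apply: probability_subset; [exact: measurable_leb|exact: measurable_leb|].
by move=> x hx; rewrite ler_expR ler_wpM2l.
Qed.

Lemma conditional_hoeffding_upper (phi : I -> X -> R) (s : seq I) (m : nat) (r : R) :
  (forall l, measurable_fun setT (phi l)) ->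
  (forall l x, `|phi l x| <= 1) ->
  (forall l, l \in s -> forall x, \int[Q]_z phi l (u l (x, z)) = 0) ->
  independent_coords phi s -> (size s <= m)%N -> 0 <= r <= 2 * m%:R -> (0 < m)%N ->
  fine (mu [set x | r <= \sum_(l <- s) phi l x]) <= expR (- (r ^+ 2 / (8 * m%:R))).
Proof.
move=> mphi phi1 phi0 ind sm /andP[r0 rm] m0.
have m0' : (0 : R) < m%:R by rewrite ltr0n.
(* The minimiser of [m * (2 * th ^ 2) - th * r]; the restriction [r <= 2 * m] is the condition
   [th <= 1 / 2] of [hoeffding_mgf]. *)
pose th := r / (4 * m%:R).
have th0 : 0 <= th by rewrite divr_ge0// mulr_ge0// ltW.
have th1 : th <= 1 / 2.
  by rewrite ler_pdivrMr ?mulr_gt0//; lra.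
apply: le_trans (conditional_chernoff (c := 2 * th ^+ 2) r mphi _ ind th0) _.
  move=> l ls x; apply: hoeffding_mgf => //.
  - by apply: (measurableT_comp (mphi l)); exact: (measurableT_comp (mu_u l) (pair1_measurable x)).
  - exact: phi0.
  - by rewrite ger0_norm.
rewrite ler_expR; apply: (@le_trans _ _ (m%:R * (2 * th ^+ 2) - th * r)).
  by rewrite lerD2r ler_wpM2r ?ler_nat// mulr_ge0 ?sqr_ge0.
by rewrite /th le_eqVlt; apply/orP; left; apply/eqP; field; rewrite gt_eqF.
Qed.

Lemma conditional_hoeffding (phi : I -> X -> R) (s : seq I) (m : nat) (r : R) :
  (forall l, measurable_fun setT (phi l)) ->
  (forall l x, `|phi l x| <= 1) ->
  (forall l, l \in s -> forall x, \int[Q]_z phi l (u l (x, z)) = 0) ->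
  independent_coords phi s -> (size s <= m)%N -> 0 <= r <= 2 * m%:R -> (0 < m)%N ->
  fine (mu [set x | r <= `|\sum_(l <- s) phi l x|]) <= 2 * expR (- (r ^+ 2 / (8 * m%:R))).
Proof.
move=> mphi phi1 phi0 ind sm rm m0.
have msum : measurable_fun setT (fun x => \sum_(l <- s) phi l x) by exact: measurable_sum.
have msumN : measurable_fun setT (fun x => \sum_(l <- s) - phi l x).
  by apply: measurable_sum => l; exact: measurableT_comp.
have h1 := conditional_hoeffding_upper mphi phi1 phi0 ind sm rm m0.
have h2 : fine (mu [set x | r <= \sum_(l <- s) - phi l x]) <= expR (- (r ^+ 2 / (8 * m%:R))).
  apply: (@conditional_hoeffding_upper (fun l x => - phi l x) s m r) => //.
  - by move=> l; exact: measurableT_comp.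
  - by move=> l x; rewrite normrN.
  - move=> l ls x; transitivity (\int[Q]_z (-1 * phi l (u l (x, z)))).
      by apply: eq_Rintegral => z _; rewrite mulN1r.
    rewrite RintegralZl ?phi0 ?mulr0//; apply: (@integrable_bounded _ _ _ _ _ 1) => //.
    by apply: (measurableT_comp (mphi l)); exact: (measurableT_comp (mu_u l) (pair1_measurable x)).
  - by apply: sub_pairwise ind => l l' /asboolP h; apply/asboolP => x z; rewrite h.
apply: le_trans (_ : _ <= fine (mu [set x | r <= \sum_(l <- s) phi l x]) +
   fine (mu [set x | r <= \sum_(l <- s) - phi l x])) _; last by rewrite mulr_natl mulr2n lerD.
apply: le_trans (union_bound2 _ (measurable_leb r msum) (measurable_leb r msumN)).
apply: probability_subset.
- by apply: measurable_leb; exact: measurableT_comp.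
- rewrite (_ : [set x | _] = [set x | r <= \sum_(l <- s) phi l x] `|` [set x | r <= \sum_(l <- s) - phi l x]).
    by apply: measurableU; exact: measurable_leb.
  by apply/seteqP; split=> x /= => [/orP|h]; last apply/orP.
by move=> x; rewrite sumrN ler_normr.
Qed.

End conditional_hoeffding.

Lemma pairwise_uniq (I : eqType) (r : rel I) (s : seq I) : uniq s ->
  (forall l l', l \in s -> l' \in s -> l != l' -> r l l') -> pairwise r s.
Proof.
elim: s => [//|l s ih] /= /andP[ls us] h; apply/andP; split.
  apply/allP => l' l's; apply: h; rewrite ?mem_head// ?inE ?l's ?orbT//.
  by apply: contraNneq ls => ->.
by apply: ih => // k k' ks k's; apply: h; rewrite inE ?ks ?k's orbT.
Qed.

Section partial_integral.
Context d d' (X : measurableType d) (Y : measurableType d') (R : realType).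
Variables (mu : probability X R) (Q : probability Y R).
Variables (h : X -> Y -> R) (C : R).
Hypothesis mh : measurable_fun setT (fun p : X * Y => h p.1 p.2).
Hypothesis hC : forall a b, `|h a b| <= C.

Let ih : (mu \x Q)%E.-integrable setT (EFin \o (fun p : X * Y => h p.1 p.2)).
Proof. exact: (@integrable_bounded _ _ _ (mu \x Q)%E _ C mh (fun p => hC p.1 p.2)). Qed.

Lemma measurable_section a : measurable_fun setT (fun b => h a b).
Proof. exact: (measurableT_comp mh (pair1_measurable a)). Qed.

Lemma integrable_section a : Q.-integrable setT (EFin \o (fun b => h a b)).
Proof. exact: (@integrable_bounded _ _ _ _ _ C (measurable_section a) (hC a)). Qed.

Lemma measurable_partial_integral : measurable_fun setT (fun a => \int[Q]_b h a b).
Proof. exact: measurableT_comp (measurable_fubini_F ih). Qed.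

Lemma integral_pair : (\int[(mu \x Q)%E]_p h p.1 p.2)%R = \int[mu]_a \int[Q]_b h a b.
Proof.
rewrite /Rintegral -(integral12_prod_meas1 ih); congr fine.
apply: eq_integral => a _; rewrite /fubini_F /=.
by rewrite -EFin_Rintegral//; exact: integrable_section.
Qed.

Lemma exchange_Rintegral : \int[mu]_x \int[Q]_y h x y = \int[Q]_y \int[mu]_x h x y.
Proof.
rewrite -integral_pair /Rintegral; congr fine.
rewrite -(integral21_prod_meas1 ih).
apply: eq_integral => y _; rewrite /fubini_G /=.
rewrite -EFin_Rintegral//; apply: (@integrable_bounded _ _ _ _ _ C) => //.
exact: (measurableT_comp mh (pair2_measurable y)).
Qed.

End partial_integral.

(** The uniform bound [B] only restricts [th], while the exponent carries the second moment [V].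
    This matters for sums that may reach order [n] but are typically of order sqrt n. *)
Lemma bernstein_mgf d (T : measurableType d) (R : realType) (F : probability T R)
    (w : T -> R) (B V th : R) : measurable_fun setT w -> (forall a, `|w a| <= B) ->
  \int[F]_a w a = 0 -> \int[F]_a (w a ^+ 2) <= V -> `|th| * B <= 1 / 2 ->
  (\int[F]_a (expR (th * w a))%:E <= (expR (2 * th ^+ 2 * V))%:E)%E.
Proof.
move=> mw wB w0 wV thB.
(* Any point of [T] gives the sign of [B], and [T] has a point because it carries a probability. *)
have B0 : 0 <= B.
  have [a|T0] := pselect (exists a : T, True); first by case: a => a _; exact: le_trans (wB a).
  rewrite leNgt; apply/negP => _; apply: T0.
  have /negP := @oner_neq0 R; apply: contra_notP => T0.
  have := Rintegral_const F (1 : R); rewrite (_ : (fun=> _) = (fun=> 0)).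
    by rewrite Rintegral_const => /eqP; rewrite eq_sym.
  by apply/funext => a; case: T0; exists a.
have iw : F.-integrable setT (EFin \o w) by exact: integrable_bounded wB.
have iw2 : F.-integrable setT (EFin \o (fun a => w a ^+ 2)).
  apply: (@integrable_bounded _ _ _ _ _ (B ^+ 2)); first exact: measurable_funX.
  move=> a; rewrite normrX; apply: lerXn2r => //; rewrite ?nnegrE//.
have ic (r : R) : F.-integrable setT (EFin \o (fun=> r)).
  exact: finite_measure_integrable_cst.
have mexp : measurable_fun setT (fun a => expR (th * w a)).
  by apply: measurableT_comp => //; exact: measurable_funM.
apply: (@le_trans _ _ (\int[F]_a (1 + th * w a + 2 * th ^+ 2 * w a ^+ 2)%:E)%E).
  apply: ge0_le_integral => //.
  - exact/measurable_EFinP.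
  - apply/measurable_EFinP; apply: measurable_funD => //.
      by apply: measurable_funD => //; exact: measurable_funM.
    by apply: measurable_funM => //; exact: measurable_funX.
  - move=> a _; rewrite lee_fin.
    have h2 : th * w a <= 1 / 2.
      apply: le_trans thB; apply: le_trans (ler_norm _) _.
      by rewrite normrM ler_wpM2l.
    by apply: le_trans (expR_le_quadratic h2) _; rewrite exprMn mulrA.
rewrite -EFin_Rintegral; last by do ! apply: integrable_add => //; exact: integrable_scale.
rewrite lee_fin RintegralD//; last 2 first.
- by apply: integrable_add => //; exact: integrable_scale.
- exact: integrable_scale.
rewrite RintegralD//; last exact: integrable_scale.
rewrite !RintegralZl// w0 mulr0 addr0 !Rintegral_const.
apply: le_trans (expR_ge1Dx _); rewrite lerD2l ler_wpM2l// mulr_ge0 ?sqr_ge0//.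
Qed.

Section ustatistic.
Context dT (T : measurableType dT) (R : realType) (n : nat) (K : finType).
Notation E := (T * measurableTypeR R)%type.
Notation N01 := (@normal_prob R 0 1).
Variables (F : probability T R) (mu : probability (n.-tuple E) R).
Hypothesis hiid : iid_law mu (F \x N01)%E.
Hypothesis n_ge2 : (2 <= n)%N.
Variable h : T -> T -> K -> R.
Hypothesis mh : forall k, measurable_fun setT (fun p : T * T => h p.1 p.2 k).
Hypothesis h01 : forall a b k, 0 <= h a b k <= 1.
Hypothesis hsym : forall a b k, h a b k = h b a k.

(** Hoeffding's decomposition: [h a b] is [theta + proj a + proj b + degen a b], where [degen] is
    centred in each argument separately. *)
Definition h1 (a : T) (k : K) : R := \int[F]_b h a b k.
Definition theta (k : K) : R := \int[F]_a h1 a k.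
Definition proj (a : T) (k : K) : R := h1 a k - theta k.
Definition degen (a b : T) (k : K) : R := h a b k - h1 a k - h1 b k + theta k.
Definition row (x : n.-tuple E) (i : 'I_n) (k : K) : R :=
  (n%:R - 1)^-1 * \sum_(l < n | l != i) h (tnth x i).1 (tnth x l).1 k.
Definition ustat (x : n.-tuple E) (k : K) : R := n%:R^-1 * \sum_i row x i k.

Let h_le1 a b k : `|h a b k| <= 1.
Proof. by have /andP[h0 h1'] := h01 a b k; rewrite ger0_norm. Qed.

Lemma h1_01 a k : 0 <= h1 a k <= 1.
Proof.
apply/andP; split; first by apply: Rintegral_ge0 => b _; have /andP[] := h01 a b k.
rewrite -[leRHS](Rintegral_const F); apply: le_Rintegral => //.
- exact: (integrable_section F (mh k) (fun a b => h_le1 a b k)).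
- exact: finite_measure_integrable_cst.
- by move=> b _; have /andP[] := h01 a b k.
Qed.

Lemma measurable_h1 k : measurable_fun setT (fun a => h1 a k).
Proof. exact: (measurable_partial_integral F F (mh k) (fun a b => h_le1 a b k)). Qed.

Let ih1 k : F.-integrable setT (EFin \o (fun a => h1 a k)).
Proof.
apply: (@integrable_bounded _ _ _ _ _ 1 (measurable_h1 k)) => a.
by have /andP[h0 h1'] := h1_01 a k; rewrite ger0_norm.
Qed.

Let ic (r : R) : F.-integrable setT (EFin \o (fun=> r)).
Proof. exact: finite_measure_integrable_cst. Qed.

Lemma theta_01 k : 0 <= theta k <= 1.
Proof.
apply/andP; split; first by apply: Rintegral_ge0 => a _; have /andP[] := h1_01 a k.
rewrite -[leRHS](Rintegral_const F); apply: le_Rintegral => //.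
by move=> a _; have /andP[] := h1_01 a k.
Qed.

Lemma measurable_proj k : measurable_fun setT (fun a => proj a k).
Proof. by apply: measurable_funB => //; exact: measurable_h1. Qed.

Lemma normr_proj_le a k : `|proj a k| <= 1.
Proof.
have /andP[? ?] := h1_01 a k; have /andP[? ?] := theta_01 k.
by rewrite /proj ler_norml; lra.
Qed.

Lemma proj_mean0 k : \int[F]_a proj a k = 0.
Proof. by rewrite RintegralB// Rintegral_const subrr. Qed.

Lemma measurable_degen k : measurable_fun setT (fun p : T * T => degen p.1 p.2 k).
Proof.
apply: measurable_funD => //; apply: measurable_funB; first apply: measurable_funB => //.
  by apply: (measurableT_comp (measurable_h1 k)); exact: measurable_fst.
by apply: (measurableT_comp (measurable_h1 k)); exact: measurable_snd.
Qed.

Lemma degen_le a b k : `|degen a b k| <= 2.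
Proof.
have /andP[? ?] := h1_01 a k; have /andP[? ?] := theta_01 k.
have /andP[? ?] := h1_01 b k; have /andP[? ?] := h01 a b k.
by rewrite /degen ler_norml; lra.
Qed.

Lemma degen_sym a b k : degen a b k = degen b a k.
Proof. by rewrite /degen hsym; ring. Qed.

Lemma degen_mean0 a k : \int[F]_b degen a b k = 0.
Proof.
have i1 := integrable_section F (mh k) (fun a b => h_le1 a b k) a.
rewrite /degen RintegralD//; last first.
  by apply: integrable_sub => //; exact: integrable_sub.
rewrite RintegralB//; last exact: integrable_sub.
by rewrite RintegralB// !Rintegral_const -/(h1 a k) -/(theta k); ring.
Qed.

Lemma degen_mean0_l b k : \int[F]_a degen a b k = 0.
Proof. by rewrite -(degen_mean0 b k); apply: eq_Rintegral => a _; exact: degen_sym. Qed.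

Let u := @upd_fst _ _ T (measurableTypeR R) n.
Let mu_u l : measurable_fun setT (u l) := @measurable_upd_fst _ _ T (measurableTypeR R) n l.
Let hu l : preserved mu F (u l) := preserved_upd_fst hiid l.

Let tnth_u l x z i : (tnth (u l (x, z)) i).1 = if i == l then z else (tnth x i).1.
Proof. by rewrite /u /upd_fst tnth_upd; case: eqP. Qed.

Let mpair i l k : measurable_fun setT (fun x : n.-tuple E => h (tnth x i).1 (tnth x l).1 k).
Proof.
apply: (measurableT_comp (mh k) (f := fun p : T * T => h p.1 p.2 k)
  (g := fun x : n.-tuple E => ((tnth x i).1, (tnth x l).1))).
by apply: measurable_fun_pair; exact: measurable_coord1.
Qed.

Let n_gt0 : (0 < n)%N := ltnW n_ge2.
Let nR : (0 : R) < n%:R.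
Proof. by rewrite ltr0n. Qed.

Definition tail (r : R) : R := 2 * expR (- (r ^+ 2 / (8 * n%:R))).

Definition row_dev (x : n.-tuple E) (p : 'I_n * K) : R :=
  \sum_(l <- [seq l <- index_enum 'I_n | l != p.1])
     (h (tnth x p.1).1 (tnth x l).1 p.2 - h1 (tnth x p.1).1 p.2).

Lemma measurable_row_dev p : measurable_fun setT (row_dev^~ p).
Proof.
apply: measurable_sum => l; apply: measurable_funB; first exact: mpair.
by apply: (measurableT_comp (measurable_h1 p.2)); exact: measurable_coord1.
Qed.

(** The index [i] itself is left out of the sum, so refreshing any [l] keeps the i-th observation;
    given it, each term is centred in the l-th one. *)
Lemma row_dev_tail p r : 0 <= r <= 2 * n%:R ->
  fine (mu [set x | r <= `|row_dev x p|]) <= tail r.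
Proof.
case: p => i k /= hr.
apply: (@conditional_hoeffding _ _ _ _ _ mu F _ u mu_u hu
  (fun l x => h (tnth x i).1 (tnth x l).1 k - h1 (tnth x i).1 k)) => //.
- move=> l; apply: measurable_funB; first exact: mpair.
  by apply: (measurableT_comp (measurable_h1 k)); exact: measurable_coord1.
- move=> l x; have /andP[? ?] := h1_01 (tnth x i).1 k.
  have /andP[? ?] := h01 (tnth x i).1 (tnth x l).1 k.
  by rewrite ler_norml; lra.
- move=> l; rewrite mem_filter => /andP[li _] x.
  transitivity (\int[F]_z (h (tnth x i).1 z k - h1 (tnth x i).1 k)).
    by apply: eq_Rintegral => z _; rewrite !tnth_u eqxx eq_sym (negbTE li).
  rewrite RintegralB//; last exact: (integrable_section F (mh k) (fun a b => h_le1 a b k)).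
  by rewrite Rintegral_const subrr.
- apply: pairwise_uniq; first by rewrite filter_uniq// index_enum_uniq.
  move=> l l'; rewrite !mem_filter => /andP[li _] /andP[l'i _] ll'.
  apply/asboolP => x z; rewrite !tnth_u (eq_sym l') (negbTE ll').
  by rewrite eq_sym (negbTE li).
- rewrite size_filter (leq_trans (count_size _ _))//.
  by rewrite -[X in (_ <= X)%N](card_ord n) cardT enumT.
Qed.

Definition proj_dev (x : n.-tuple E) (k : K) : R := \sum_i proj (tnth x i).1 k.

Lemma size_index_ord : size (index_enum 'I_n) = n.
Proof. by rewrite -[RHS](card_ord n) cardT enumT. Qed.

Let additive_tail (w : T -> R) r : measurable_fun setT w -> (forall a, `|w a| <= 1) ->
  \int[F]_a w a = 0 -> 0 <= r <= 2 * n%:R ->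
  fine (mu [set x | r <= `|\sum_i w (tnth x i).1|]) <= tail r.
Proof.
move=> mw w1 w0 hr.
apply: (@conditional_hoeffding _ _ _ _ _ mu F _ u mu_u hu
  (fun l x => w (tnth x l).1)) => //.
- by move=> l; apply: (measurableT_comp mw); exact: measurable_coord1.
- move=> l _ x; rewrite -w0; apply: eq_Rintegral => z _.
  by rewrite tnth_u eqxx.
- apply: pairwise_uniq; first exact: index_enum_uniq.
  move=> l l' _ _ ll'; apply/asboolP => x z.
  by rewrite tnth_u eq_sym (negbTE ll').
- by rewrite size_index_ord.
Qed.

Lemma measurable_proj_dev k : measurable_fun setT (proj_dev^~ k).
Proof.
apply: measurable_sum => l.
by apply: (measurableT_comp (measurable_proj k)); exact: measurable_coord1.
Qed.

Lemma proj_dev_tail k r : 0 <= r <= 2 * n%:R ->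
  fine (mu [set x | r <= `|proj_dev x k|]) <= tail r.
Proof.
apply: (@additive_tail (fun a => proj a k)); first exact: measurable_proj.
  by move=> a; exact: normr_proj_le.
exact: proj_mean0.
Qed.

(** The division by 2 brings the summands into [-1, 1], as the additive tail bound requires. *)
Definition cov_dev (x : n.-tuple E) (p : K * K) : R :=
  \sum_i (proj (tnth x i).1 p.1 * proj (tnth x i).1 p.2 - Gam F proj p.1 p.2) / 2.

Lemma measurable_cov_dev p : measurable_fun setT (cov_dev^~ p).
Proof.
apply: measurable_sum => l; apply: measurable_funM => //; apply: measurable_funB => //.
by apply: measurable_funM;
   apply: (measurableT_comp (measurable_proj _)); exact: measurable_coord1.
Qed.

Lemma cov_dev_tail p r : 0 <= r <= 2 * n%:R ->
  fine (mu [set x | r <= `|cov_dev x p|]) <= tail r.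
Proof.
have mpp : measurable_fun setT (fun a => proj a p.1 * proj a p.2).
  by apply: measurable_funM; exact: measurable_proj.
have pp1 a : `|proj a p.1 * proj a p.2| <= 1.
  by rewrite normrM mulr_ile1// normr_proj_le.
have ipp : F.-integrable setT (EFin \o (fun a => proj a p.1 * proj a p.2)).
  exact: integrable_bounded pp1.
apply: (@additive_tail (fun a => (proj a p.1 * proj a p.2 - Gam F proj p.1 p.2) / 2)).
- by apply: measurable_funM => //; exact: measurable_funB.
- move=> a; have := pp1 a; have := normr_Gam_le F measurable_proj normr_proj_le p.1 p.2.
  by rewrite !ler_norml; lra.
- rewrite RintegralZr//; last exact: integrable_sub.
  by rewrite RintegralB// Rintegral_const subrr mul0r.
Qed.

(** Restricting to [l > i] keeps each unordered pair once and makes the double sum a martingale when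
    the observations are revealed from the last to the first. *)
Definition inner (b : T) (x : n.-tuple E) (i : 'I_n) (k : K) : R :=
  \sum_(l <- [seq l : 'I_n <- index_enum 'I_n | (i < l)%N]) degen b (tnth x l).1 k.

(** The conditional probability, given the observations after the i-th, that a fresh observation
    makes the inner sum reach [d]. *)
Definition exceedance (d : R) (x : n.-tuple E) (p : 'I_n * K) : R :=
  \int[F]_b (d <= `|inner b x p.1 p.2|)%R%:R.

Let minner i k : measurable_fun setT (fun p : n.-tuple E * T => inner p.2 p.1 i k).
Proof.
apply: measurable_sum => l.
apply: (measurableT_comp (measurable_degen k) (f := fun p : T * T => degen p.1 p.2 k)
  (g := fun p : n.-tuple E * T => (p.2, (tnth p.1 l).1))).
apply: measurable_fun_pair; first exact: measurable_snd.
apply: (measurableT_comp (measurable_coord1 l) (f := fun x : n.-tuple E => (tnth x l).1)).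
exact: measurable_fst.
Qed.

Lemma size_gt_ord (i : 'I_n) : (size [seq l : 'I_n <- index_enum 'I_n | (i < l)%N] <= n)%N.
Proof.
by rewrite size_filter (leq_trans (count_size _ _))// size_index_ord.
Qed.

Lemma inner_le b x i k : `|inner b x i k| <= 2 * n%:R.
Proof.
apply: le_trans (ler_norm_sum _ _ _) _.
apply: (@le_trans _ _ (\sum_(l <- [seq l : 'I_n <- index_enum 'I_n | (i < l)%N]) 2)).
  by apply: ler_sum => l _; exact: degen_le.
rewrite big_const_seq count_predT iter_addr_0 -[leLHS]mulr_natr ler_pM2l// ler_nat.
exact: size_gt_ord.
Qed.

Let mexc_ind d i k :
  measurable_fun setT (fun p : n.-tuple E * T => (d <= `|inner p.2 p.1 i k|)%R%:R : R).
Proof.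
rewrite (_ : (fun p => _) = \1_[set p : n.-tuple E * T | d <= `|inner p.2 p.1 i k|]).
  by apply: measurable_indic; apply: measurable_leb; exact: measurableT_comp.
by apply/funext => p; rewrite indic_bool.
Qed.

Let bool_le1 (b : bool) : `|b%:R : R| <= 1.
Proof. by case: b; rewrite ?normr1 ?normr0. Qed.

Let lerb1 (b : bool) : b%:R <= 1 :> R.
Proof. by case: b. Qed.

Lemma measurable_exceedance d p : measurable_fun setT (exceedance d ^~ p).
Proof.
case: p => i k.
exact: (measurable_partial_integral mu F (mexc_ind d i k) (fun x b => bool_le1 _)).
Qed.

(** After exchanging the integrals [b] is fixed, and the inner sum has independent centred terms of
    size at most 2; halving them reduces to Hoeffding, hence [d / 2]. *)
Lemma exceedance_mean d p : 0 <= d <= 4 * n%:R ->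
  \int[mu]_x exceedance d x p <= tail (d / 2).
Proof.
case: p => i k /andP[d0 dn].
rewrite (exchange_Rintegral mu F (mexc_ind d i k) (fun x b => bool_le1 _)).
have hb b : \int[mu]_x (d <= `|inner b x i k|)%R%:R <= tail (d / 2).
  have mb : measurable [set x : n.-tuple E | d <= `|inner b x i k|].
    apply: measurable_leb; apply: measurableT_comp => //.
    exact: (measurableT_comp (minner i k) (pair2_measurable b)).
  rewrite -(probability_bool mu mb).
  have -> : [set x : n.-tuple E | d <= `|inner b x i k|] =
    [set x | d / 2 <= `|\sum_(l <- [seq l : 'I_n <- index_enum 'I_n | (i < l)%N])
        degen b (tnth x l).1 k / 2|].
    apply/seteqP; split => x /=; rewrite -mulr_suml normrM (gtr0_norm (_ : 0 < 2^-1)) ?invr_gt0//;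
      by rewrite ler_pM2r ?invr_gt0.
  apply: (@conditional_hoeffding _ _ _ _ _ mu F _ u mu_u hu
    (fun l x => degen b (tnth x l).1 k / 2)) => //.
  - move=> l; apply: measurable_funM => //.
    apply: (measurableT_comp (f := fun z => degen b z k) (g := fun x : n.-tuple E => (tnth x l).1)).
      exact: (measurable_section (h := fun a b => degen a b k) (measurable_degen k) b).
    exact: measurable_coord1.
  - move=> l x; have := degen_le b (tnth x l).1 k; rewrite !ler_norml; lra.
  - move=> l _ x; transitivity (\int[F]_z (degen b z k / 2)).
      by apply: eq_Rintegral => z _; rewrite tnth_u eqxx.
    rewrite RintegralZr ?degen_mean0 ?mul0r//.
    exact: (integrable_section F (measurable_degen k) (fun a b => degen_le a b k)).
  - apply: pairwise_uniq; first by rewrite filter_uniq// index_enum_uniq.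
    move=> l l' _ _ ll'; apply/asboolP => x z.
    by rewrite tnth_u eq_sym (negbTE ll').
  - exact: size_gt_ord.
  - by apply/andP; split; lra.
rewrite -[leRHS](Rintegral_const F); apply: le_Rintegral => //.
apply: (@integrable_bounded _ _ _ _ _ 1).
  have mw : measurable_fun setT (fun p : T * n.-tuple E => (d <= `|inner p.1 p.2 i k|)%R%:R : R).
    apply: (measurableT_comp (mexc_ind d i k) (g := fun p : T * n.-tuple E => (p.2, p.1))).
    by apply: measurable_fun_pair; [exact: measurable_snd|exact: measurable_fst].
  exact: (measurable_partial_integral F mu mw (fun x b => bool_le1 _)).
move=> b; rewrite ger0_norm; last by apply: Rintegral_ge0.
rewrite -[leRHS](Rintegral_const mu); apply: le_Rintegral => //.
- apply: integrable_bool; apply: measurable_leb; apply: measurableT_comp => //.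
  exact: (measurableT_comp (minner i k) (pair2_measurable b)).
- exact: finite_measure_integrable_cst.
Qed.

Lemma exceedance_tail d tau p : 0 <= d <= 4 * n%:R -> 0 < tau ->
  fine (mu [set x | tau <= exceedance d x p]) <= tail (d / 2) / tau.
Proof.
move=> hd tau0; have me := measurable_exceedance d p.
have e0 x : 0 <= exceedance d x p by apply: Rintegral_ge0.
apply: markov_ge0 => //.
have ie : mu.-integrable setT (EFin \o (exceedance d ^~ p)).
  apply: (@integrable_bounded _ _ _ _ _ 1) => // x.
  rewrite ger0_norm// -[leRHS](Rintegral_const F); apply: le_Rintegral => //.
    exact: (integrable_section (h := fun x b => (d <= `|inner b x p.1 p.2|)%R%:R) F (mexc_ind d p.1 p.2) (fun x b => bool_le1 _)).
by rewrite -EFin_Rintegral// lee_fin exceedance_mean.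
Qed.

(* [inner] can be of size [n], but given the observations [l > i] it is centred in the [i]-th one,
   with second moment at most [d ^+ 2 + 4 * n%:R ^+ 2 * tau] as soon as [exceedance] is below
   [tau].  Since [exceedance] does not depend on the observations [l <= i], truncating on it keeps
   the conditional centring. *)
Definition trunc (d tau : R) (k : K) (i : 'I_n) (x : n.-tuple E) : R :=
  inner (tnth x i).1 x i k * (exceedance d x (i, k) < tau)%R%:R.

Lemma inner_u b x (i l : 'I_n) k z : (l <= i)%N -> inner b (u l (x, z)) i k = inner b x i k.
Proof.
move=> li; rewrite /inner; apply: eq_big_seq => l'.
rewrite mem_filter => /andP[il' _]; rewrite tnth_u ifN//.
by rewrite -val_eqE /= gtn_eqF// (leq_ltn_trans li).
Qed.

Lemma exceedance_u d x (i l : 'I_n) k z : (l <= i)%N ->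
  exceedance d (u l (x, z)) (i, k) = exceedance d x (i, k).
Proof. by move=> li; apply: eq_Rintegral => b _ /=; rewrite inner_u. Qed.

Lemma measurable_inner_self i k :
  measurable_fun setT (fun x : n.-tuple E => inner (tnth x i).1 x i k).
Proof.
apply: (measurableT_comp (minner i k) (g := fun x : n.-tuple E => (x, (tnth x i).1))).
by apply: measurable_fun_pair => //; exact: measurable_coord1.
Qed.

Lemma measurable_trunc d tau k i : measurable_fun setT (trunc d tau k i).
Proof.
apply: measurable_funM; first exact: measurable_inner_self.
rewrite (_ : (fun x => _) = \1_(~` [set x : n.-tuple E | tau <= exceedance d x (i, k)])).
  apply: measurable_indic; apply: measurableC; apply: measurable_leb.
  exact: measurable_exceedance.
rewrite (_ : ~` _ = [set x | exceedance d x (i, k) < tau]).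
  by apply/funext => x; rewrite indic_bool.
by apply/seteqP; split => x /=; rewrite ltNge => /negP.
Qed.

Lemma trunc_tail d tau k r (V := d ^+ 2 + 4 * n%:R ^+ 2 * tau) : 0 <= d -> 0 < tau ->
  fine (mu [set x | r <= `|\sum_i trunc d tau k i x|]) <=
  2 * expR (V / (8 * n%:R) - r / (4 * n%:R)).
Proof.
move=> d0 tau0.
(* The largest parameter permitted by the bound [2 * n] on inner sums, [th * (2 * n) = 1 / 2]; the
   exponent [n * (2 * th ^ 2 * V) - th * r] is then the stated one. *)
pose th : R := (4 * n%:R)^-1.
have th0 : 0 < th by rewrite invr_gt0 mulr_gt0.
have mtr i := measurable_trunc d tau k i.
(* In increasing order of indices: the term at [j] involves only observations from [j] on, so
   refreshing a smaller index leaves it alone. *)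
have ind (sg : R) : independent_coords u (fun i x => sg * trunc d tau k i x) (index_enum 'I_n).
  have : pairwise (fun i j : 'I_n => (i < j)%N) (index_enum 'I_n).
    rewrite (_ : index_enum 'I_n = enum 'I_n); last by rewrite enumT.
    have : pairwise ltn (map val (enum 'I_n)).
      by rewrite val_enum_ord -sorted_pairwise; [exact: iota_ltn_sorted|exact: ltn_trans].
    by rewrite pairwise_map.
  apply: sub_pairwise => i j ij; apply/asboolP => x z.
  rewrite /trunc exceedance_u ?(ltnW ij)// inner_u ?(ltnW ij)//.
  by rewrite tnth_u -val_eqE /= gtn_eqF.
have bnd (sg : R) : `|sg| = 1 -> fine (mu [set x | r <= \sum_i sg * trunc d tau k i x]) <=
    expR (V / (8 * n%:R) - r / (4 * n%:R)).
  move=> sg1.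
  have hc l : l \in index_enum 'I_n -> forall x,
     (\int[F]_z (expR (th * (sg * trunc d tau k l (u l (x, z)))))%:E <= (expR (2 * th ^+ 2 * V))%:E)%E.
    move=> _ x.
    have eT z : th * (sg * trunc d tau k l (u l (x, z))) =
      (th * sg) * (inner z x l k * (exceedance d x (l, k) < tau)%R%:R).
      by rewrite /trunc exceedance_u// inner_u// tnth_u eqxx mulrA.
    under eq_integral do rewrite eT.
    have V0 : 0 <= V by rewrite addr_ge0 ?sqr_ge0// !mulr_ge0 ?exprn_ge0 ?(ltW tau0)// ltW.
    (* The exceedance at [l] ignores the fresh draw, so truncation is decided before integrating:
       either the term vanishes identically or the second moment bound is available. *)
    case: (boolP (exceedance d x (l, k) < tau)) => [ex|_]; last first.
      under eq_integral do rewrite mulr0 mulr0 expR0.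
      rewrite integral_cst//= mul1e; apply: le_trans (_ : _ <= 1%:E)%E _.
        exact: probability_le1.
      by rewrite lee_fin -[leLHS]expR0 ler_expR; apply: mulr_ge0 => //; apply: mulr_ge0 => //; exact: sqr_ge0.
    under eq_integral do rewrite mulr1.
    have mw : measurable_fun setT (fun z => inner z x l k).
      exact: (measurableT_comp (minner l k) (pair1_measurable x)).
    have -> : 2 * th ^+ 2 * V = 2 * (th * sg) ^+ 2 * V.
      by rewrite exprMn -[sg ^+ 2]real_normK ?num_real// sg1 expr1n mulr1.
    apply: (bernstein_mgf (B := 2 * n%:R)) => //.
    - by move=> z; exact: inner_le.
    - rewrite Rintegral_bigsum; last first.
        move=> l'; rewrite (_ : (fun z => _) = (fun z => degen (tnth x l').1 z k)).
          exact: (integrable_section F (measurable_degen k) (fun a b => degen_le a b k)).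
        by apply/funext => z; rewrite degen_sym.
      by rewrite big1// => l' _; exact: degen_mean0_l.
    - have iex := integrable_section (h := fun x b => (d <= `|inner b x l k|)%R%:R) F (mexc_ind d l k) (fun x b => bool_le1 _) x.
      apply: (@le_trans _ _ (\int[F]_z (d ^+ 2 + 4 * n%:R ^+ 2 * (d <= `|inner z x l k|)%R%:R))).
        apply: le_Rintegral => //.
        + apply: (@integrable_bounded _ _ _ _ _ ((2 * n%:R) ^+ 2)); first exact: measurable_funX.
          by move=> z; rewrite normrX; apply: lerXn2r; rewrite ?nnegrE ?inner_le// mulr_ge0// ltW.
        + by apply: integrable_add => //; exact: integrable_scale.
        move=> z _; rewrite -[leLHS]real_normK ?num_real//.
        have iz0 : 0 <= `|inner z x l k| by [].
        have n0 : 0 <= 2 * n%:R :> R by rewrite mulr_ge0// ltW.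
        have iz := inner_le z x l k.
        have [_|hlt] := boolP (d <= `|inner z x l k|); last first.
          rewrite -ltNge in hlt; rewrite mulr0 addr0.
          by rewrite ler_pXn2r ?nnegrE// ltW.
        rewrite mulr1.
        apply: (@le_trans _ _ ((2 * n%:R) ^+ 2)); first by rewrite ler_pXn2r ?nnegrE.
        by have := sqr_ge0 d; move: (n%:R : R) => q; lra.
      rewrite RintegralD//; last exact: integrable_scale.
      rewrite Rintegral_const RintegralZl// lerD2l; apply: ler_wpM2l.
        by rewrite mulr_ge0 ?exprn_ge0// ltW.
      exact: ltW ex.
    - rewrite normrM sg1 mulr1 gtr0_norm// /th.
      by rewrite le_eqVlt; apply/orP; left; apply/eqP; field; rewrite gt_eqF.
  have := @conditional_chernoff _ _ _ _ _ mu F _ u mu_u hu (fun i x => sg * trunc d tau k i x)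
    (index_enum 'I_n) th (2 * th ^+ 2 * V) r (fun i => measurable_funM (measurable_cst sg) (mtr i))
    hc (ind sg) (ltW th0).
  move/le_trans; apply; rewrite size_index_ord ler_expR le_eqVlt; apply/orP; left; apply/eqP.
  by rewrite /th; field; rewrite gt_eqF.
have msum (sg : R) : measurable_fun setT (fun x => \sum_i sg * trunc d tau k i x).
  by apply: measurable_sum => i; exact: measurable_funM.
have h1' := bnd 1 (normr1 _); have h2' := bnd (-1) (normrN1 _).
apply: le_trans (_ : _ <= fine (mu [set x | r <= \sum_i 1 * trunc d tau k i x]) +
   fine (mu [set x | r <= \sum_i (-1) * trunc d tau k i x])) _; last by rewrite mulr_natl mulr2n lerD.
apply: le_trans (union_bound2 _ (measurable_leb r (msum 1)) (measurable_leb r (msum (-1)))).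
apply: probability_subset.
- by apply: measurable_leb; apply: measurableT_comp => //; exact: measurable_sum.
- rewrite (_ : [set x | _] = [set x | r <= \sum_i 1 * trunc d tau k i x] `|`
     [set x | r <= \sum_i (-1) * trunc d tau k i x]).
    by apply: measurableU; exact: measurable_leb.
  by apply/seteqP; split=> x /= => [/orP|h']; last apply/orP.
by move=> x; rewrite -!mulr_sumr mul1r mulN1r ler_normr.
Qed.

End ustatistic.

Lemma sum_neq_sym (R : realType) n (f : 'I_n -> 'I_n -> R) :
  (forall i l, f i l = f l i) ->
  \sum_(i < n) \sum_(l | l != i) f i l = 2 * \sum_(i < n) \sum_(l : 'I_n | (i < l)%N) f i l.
Proof.
move=> fs.
have split_i i : \sum_(l | l != i) f i l =
    \sum_(l : 'I_n | (i < l)%N) f i l + \sum_(l : 'I_n | (l < i)%N) f i l.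
  rewrite (bigID (fun l : 'I_n => (i < l)%N))/=; congr (_ + _); apply: eq_bigl => l.
    by rewrite -val_eqE/= andb_idl// => /gtn_eqF ->.
  by rewrite -val_eqE/= -leqNgt ltn_neqAle.
under eq_bigr do rewrite split_i.
rewrite big_split/= mulr_natl mulr2n; congr (_ + _).
rewrite (exchange_big_dep predT)//=; apply: eq_bigr => i _.
by apply: eq_bigr => l _; exact: fs.
Qed.

(** * The exceptional event and its complement *)

Section events.
Context dT (T : measurableType dT) (R : realType) (n : nat) (K : finType).
Notation E := (T * measurableTypeR R)%type.
Notation N01 := (@normal_prob R 0 1).
Variables (F : probability T R) (mu : probability (n.-tuple E) R).
Hypothesis hiid : iid_law mu (F \x N01)%E.
Hypothesis n_ge2 : (2 <= n)%N.
Variable h : T -> T -> K -> R.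
Hypothesis mh : forall k, measurable_fun setT (fun p : T * T => h p.1 p.2 k).
Hypothesis h01 : forall a b k, 0 <= h a b k <= 1.
Hypothesis hsym : forall a b k, h a b k = h b a k.

Variables D d r : R.
Hypothesis D_ge0 : 0 <= D.

Let tau : R := (4 * n%:R ^+ 2)^-1.

(** The common level [n * D / 2] controls the three averages that enter the covariance comparison.
    The threshold [(4 * n ^ 2)^-1] makes truncation add exactly 1 to [d ^+ 2] in the conditional
    second moment. *)
Definition bad (x : n.-tuple E) : bool :=
  [|| [exists p : 'I_n * K, n%:R * D / 2 <= `|row_dev F h x p|],
      [exists k : K, n%:R * D / 2 <= `|proj_dev F h x k|],
      [exists p : K * K, n%:R * D / 2 <= `|cov_dev F h x p|],
      [exists p : 'I_n * K, (4 * n%:R ^+ 2)^-1 <= exceedance F h d x p] |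
      [exists k : K, r <= `|\sum_i trunc F h d (4 * n%:R ^+ 2)^-1 k i x|]].

Let n_gt0 : (0 < n)%N := ltnW n_ge2.
Let nR : (0 : R) < n%:R.
Proof. by rewrite ltr0n. Qed.
Let nR2 : (2 : R) <= n%:R.
Proof. by rewrite ler_nat. Qed.
Let n1 : (0 : R) < n%:R - 1.
Proof. by have := nR2; lra. Qed.

Let card_neq (i : 'I_n) : (\sum_(l < n | l != i) 1 : R) = n%:R - 1.
Proof.
have := sumr_const 'I_n (1 : R); rewrite card_ord (bigD1 i)//= => <-.
by rewrite addrAC subrr add0r.
Qed.

Lemma row_01 (x : n.-tuple E) i k : 0 <= row h x i k <= 1.
Proof.
rewrite /row; apply/andP; split.
  by rewrite mulr_ge0 ?invr_ge0 ?(ltW n1)// sumr_ge0// => l _; have /andP[] := h01 (tnth x i).1 (tnth x l).1 k.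
rewrite mulrC ler_pdivrMr// mul1r -(card_neq i); apply: ler_sum => l _.
by have /andP[] := h01 (tnth x i).1 (tnth x l).1 k.
Qed.

Lemma ustat_01 (x : n.-tuple E) k : 0 <= ustat h x k <= 1.
Proof.
rewrite /ustat; apply/andP; split.
  by rewrite mulr_ge0 ?invr_ge0// sumr_ge0// => i _; have /andP[] := row_01 x i k.
rewrite mulrC ler_pdivrMr// mul1r -[leRHS](_ : \sum_(i < n) 1 = _); last first.
  by rewrite sumr_const card_ord.
by apply: ler_sum => i _; have /andP[] := row_01 x i k.
Qed.

Definition resid (x : n.-tuple E) (i : 'I_n) (k : K) : R := row h x i k - ustat h x k.

Lemma normr_resid_le x i k : `|resid x i k| <= 1.
Proof.
have /andP[? ?] := row_01 x i k; have /andP[? ?] := ustat_01 x k.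
by rewrite /resid ler_norml; lra.
Qed.

Lemma row_devE (x : n.-tuple E) i k :
  row_dev F h x (i, k) = (n%:R - 1) * (row h x i k - h1 F h (tnth x i).1 k).
Proof.
rewrite /row_dev /row big_filter sumrB mulrBr mulrA divff ?gt_eqF// mul1r; congr (_ - _).
by rewrite -(card_neq i) mulr_suml; apply: eq_bigr => l _; rewrite mul1r.
Qed.

Lemma normr_avg_le (f : 'I_n -> R) c : (forall i, `|f i| <= c) -> `|n%:R^-1 * \sum_i f i| <= c.
Proof.
move=> fc; rewrite normrM gtr0_norm ?invr_gt0// mulrC ler_pdivrMr//.
apply: le_trans (ler_norm_sum _ _ _) _.
rewrite (@le_trans _ _ (\sum_(i < n) c))//; first by apply: ler_sum => i _; exact: fc.
by rewrite sumr_const card_ord mulr_natr.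
Qed.

Lemma avg_cst (c : R) : n%:R^-1 * \sum_(i < n) c = c.
Proof. by rewrite sumr_const card_ord -[c *+ n]mulr_natl mulKf// gt_eqF. Qed.

Section good.
Variable x : n.-tuple E.
Hypothesis good_x : ~~ bad x.

Lemma row_close i k : `|row h x i k - h1 F h (tnth x i).1 k| <= D.
Proof.
move: good_x; rewrite !negb_or => /andP[/existsPn/(_ (i, k))].
rewrite -ltNge row_devE normrM gtr0_norm// => hlt _.
rewrite -(ler_pM2l n1); apply: le_trans (ltW hlt) _.
have : 0 <= (n%:R - 2) * D by rewrite mulr_ge0// subr_ge0.
by move: (n%:R : R) => q; lra.
Qed.

Lemma proj_avg_close k : `|n%:R^-1 * \sum_i proj F h (tnth x i).1 k| <= D / 2.
Proof.
move: good_x; rewrite !negb_or => /and3P[_ /existsPn/(_ k) + _].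
rewrite -ltNge -/(proj_dev F h x k) => hlt.
rewrite normrM gtr0_norm ?invr_gt0// mulrC ler_pdivrMr//.
apply: le_trans (ltW hlt) _; lra.
Qed.

Lemma cov_avg_close k k' :
  `|n%:R^-1 * \sum_i proj F h (tnth x i).1 k * proj F h (tnth x i).1 k' - Gam F (proj F h) k k'|
  <= D.
Proof.
move: good_x; rewrite !negb_or => /and4P[_ _ /existsPn/(_ (k, k')) + _].
rewrite -ltNge /cov_dev /= -mulr_suml normrM (gtr0_norm (_ : 0 < 2^-1)) ?invr_gt0// => hlt.
rewrite -[X in _ - X](avg_cst) -mulrBr -sumrB normrM gtr0_norm ?invr_gt0// mulrC ler_pdivrMr//.
by move: hlt; rewrite ltr_pM2r ?invr_gt0// => /ltW; rewrite mulrC.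
Qed.

(** The 5/2 collects [D] from the row, [D] from the mean of the rows inside [ustat], and [D / 2]
    from the average projection. *)
Lemma resid_close i k : `|resid x i k - proj F h (tnth x i).1 k| <= 5 / 2 * D.
Proof.
have -> : resid x i k - proj F h (tnth x i).1 k =
    (row h x i k - h1 F h (tnth x i).1 k)
    - n%:R^-1 * (\sum_i (row h x i k - h1 F h (tnth x i).1 k))
    - n%:R^-1 * (\sum_i proj F h (tnth x i).1 k).
  have -> : n%:R^-1 * (\sum_i (row h x i k - h1 F h (tnth x i).1 k)) =
      ustat h x k - n%:R^-1 * (\sum_i proj F h (tnth x i).1 k) - theta F h k.
    rewrite /ustat -[X in _ - X](avg_cst) -!mulrBr -!sumrB; congr (_ * _).
    by apply: eq_bigr => l _; rewrite /proj; ring.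
  by rewrite /resid {1}/proj; ring.
have a1 := row_close i k; have a2 := proj_avg_close k.
have a3 := normr_avg_le (fun l => row_close l k).
move: a1 a2 a3; rewrite !ler_norml => /andP[? ?] /andP[? ?] /andP[? ?]; apply/andP.
by split; lra.
Qed.

(** [D] comes from the empirical covariance of the projections; replacing projections by residuals
    costs [5 / 2 * D] for each of the two factors, all factors being at most 1. *)
Lemma resid_cov_close k k' :
  `|Gam F (proj F h) k k' - Sig (resid x) k k'| <= 6 * D.
Proof.
have -> : Sig (resid x) k k' = n%:R^-1 * \sum_i resid x i k * resid x i k'.
  rewrite /Sig -mulr_sumr; congr (_ * _).
  by rewrite /rn -invfM -expr2 sqr_sqrtr.
have := cov_avg_close k k'.
have hp : `|n%:R^-1 * (\sum_i (resid x i k * resid x i k' -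
     proj F h (tnth x i).1 k * proj F h (tnth x i).1 k'))| <= 5 * D.
  apply: normr_avg_le => i.
  rewrite (_ : _ - _ = (resid x i k - proj F h (tnth x i).1 k) * resid x i k' +
     proj F h (tnth x i).1 k * (resid x i k' - proj F h (tnth x i).1 k')); last by ring.
  have c1 := resid_close i k; have c2 := resid_close i k'.
  have p1 := normr_proj_le F mh h01 (tnth x i).1 k; have v1 := normr_resid_le x i k'.
  apply: le_trans (ler_normD _ _) _; rewrite !normrM (_ : 5 * D = 5 / 2 * D * 1 + 1 * (5 / 2 * D)).
    by apply: lerD; apply: ler_pM.
  by field.
move: hp; rewrite sumrB mulrBr !ler_norml => /andP[? ?] /andP[? ?]; apply/andP.
by split; lra.
Qed.

(** On good data every exceedance is below the threshold, so truncation is inactive and the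
    truncated sum is the full one. *)
Lemma degenerate_sum_lt k :
  `|\sum_(i < n) \sum_(l : 'I_n | (i < l)%N) degen F h (tnth x i).1 (tnth x l).1 k| < r.
Proof.
move: good_x; rewrite !negb_or => /and5P[_ _ _ /existsPn ex /existsPn/(_ k)].
rewrite -ltNge; congr (`|_| < _); apply: eq_bigr => i _.
have := ex (i, k); rewrite -ltNge => exi.
by rewrite /trunc exi mulr1 /inner big_filter.
Qed.

(** Summing Hoeffding's decomposition over ordered pairs counts every projection [2 * (n - 1)] times
    and every degenerate pair twice; the 2 accounts for the normalisation sqrt n / 2. *)
Lemma hajek_remainder k :
  `|Num.sqrt n%:R / 2 * (ustat h x k - theta F h k) - Ssum (proj F h) x k|
  <= rn R n * (r / (n%:R - 1)).
Proof.
have hS : \sum_(i < n) \sum_(l < n | l != i) (h (tnth x i).1 (tnth x l).1 k - theta F h k) =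
   2 * (n%:R - 1) * \sum_i proj F h (tnth x i).1 k
   + 2 * \sum_(i < n) \sum_(l : 'I_n | (i < l)%N) degen F h (tnth x i).1 (tnth x l).1 k.
  rewrite -(@sum_neq_sym _ _ (fun i l => degen F h (tnth x i).1 (tnth x l).1 k)); last first.
    by move=> i l; exact: degen_sym.
  have -> : 2 * (n%:R - 1) * \sum_i proj F h (tnth x i).1 k =
      \sum_(i < n) \sum_(l < n | l != i) (proj F h (tnth x i).1 k + proj F h (tnth x l).1 k).
    transitivity (\sum_i (n%:R - 1) * proj F h (tnth x i).1 k +
        \sum_l (n%:R - 1) * proj F h (tnth x l).1 k).
      by rewrite -mulr_sumr; ring.
    under [RHS]eq_bigr do rewrite big_split/=.
    rewrite big_split/=; congr (_ + _).
      by apply: eq_bigr => i _; rewrite -(card_neq i) mulr_suml; apply: eq_bigr => l _; rewrite mul1r.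
    rewrite [RHS](exchange_big_dep predT)//=; apply: eq_bigr => l _.
    rewrite -(card_neq l) mulr_suml; apply: eq_big => [i|i _]; last by rewrite mul1r.
    by rewrite eq_sym.
  rewrite -big_split/=; apply: eq_bigr => i _; rewrite -big_split/=.
  by apply: eq_bigr => l _; rewrite /degen /proj; ring.
have hU : ustat h x k - theta F h k = n%:R^-1 * (n%:R - 1)^-1 *
    \sum_(i < n) \sum_(l < n | l != i) (h (tnth x i).1 (tnth x l).1 k - theta F h k).
  rewrite -[X in _ - X](avg_cst) /ustat -mulrBr -sumrB -mulrA; congr (_ * _).
  rewrite mulr_sumr; apply: eq_bigr => i _; rewrite /row sumrB mulrBr; congr (_ - _).
  have -> : \sum_(l < n | l != i) theta F h k = (n%:R - 1) * theta F h k.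
    by rewrite -(card_neq i) mulr_suml; apply: eq_bigr => l _; rewrite mul1r.
  by rewrite mulrA mulVf ?gt_eqF// mul1r.
have hd := degenerate_sum_lt k; rewrite hU hS /Ssum.
move: (\sum_i proj F h (tnth x i).1 k) => sp.
move: (\sum_(i < n) \sum_(l : 'I_n | (i < l)%N) _) hd => sd hd.
have rq : Num.sqrt n%:R * n%:R^-1 = rn R n :> R.
  have s0 : 0 < Num.sqrt (n%:R : R) by rewrite sqrtr_gt0.
  by rewrite -{2}(sqr_sqrtr (ltW nR)) /rn expr2 invfM mulrA divff ?mul1r// gt_eqF.
have -> : Num.sqrt n%:R / 2 * (n%:R^-1 * (n%:R - 1)^-1 * (2 * (n%:R - 1) * sp + 2 * sd)) - rn R n * sp
   = rn R n * (sd / (n%:R - 1)).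
  by rewrite -rq; field; rewrite !gt_eqF.
rewrite normrM (gtr0_norm (rn_gt0 R n_gt0)) ler_pM2l ?rn_gt0//.
by rewrite normrM [X in _ * X]gtr0_norm ?invr_gt0// ler_pM2r ?invr_gt0// ltW.
Qed.

End good.

End events.

Section bad_event.
Context dT (T : measurableType dT) (R : realType) (n : nat) (K : finType).
Notation E := (T * measurableTypeR R)%type.
Notation N01 := (@normal_prob R 0 1).
Variables (F : probability T R) (mu : probability (n.-tuple E) R).
Hypothesis hiid : iid_law mu (F \x N01)%E.
Hypothesis n_ge2 : (2 <= n)%N.
Variable h : T -> T -> K -> R.
Hypothesis mh : forall k, measurable_fun setT (fun p : T * T => h p.1 p.2 k).
Hypothesis h01 : forall a b k, 0 <= h a b k <= 1.
Hypothesis hsym : forall a b k, h a b k = h b a k.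
Variables D d r : R.
Hypothesis D_ge0 : 0 <= D.
Hypothesis d_ge0 : 0 <= d.

Let nR : (0 : R) < n%:R.
Proof. by rewrite ltr0n ltnW. Qed.

Let m1 : forall p, measurable [set x : n.-tuple E | n%:R * D / 2 <= `|row_dev F h x p|].
Proof.
by move=> p; apply: measurable_leb; apply: measurableT_comp => //; exact: measurable_row_dev.
Qed.

Let m2 : forall k, measurable [set x : n.-tuple E | n%:R * D / 2 <= `|proj_dev F h x k|].
Proof.
by move=> p; apply: measurable_leb; apply: measurableT_comp => //; exact: measurable_proj_dev.
Qed.

Let m3 : forall p, measurable [set x : n.-tuple E | n%:R * D / 2 <= `|cov_dev F h x p|].
Proof.
by move=> p; apply: measurable_leb; apply: measurableT_comp => //; exact: measurable_cov_dev.
Qed.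

Let m4 : forall p, measurable
  [set x : n.-tuple E | (4 * n%:R ^+ 2)^-1 <= exceedance F h d x p].
Proof. by move=> p; apply: measurable_leb; exact: measurable_exceedance. Qed.

Let m5 : forall k, measurable
  [set x : n.-tuple E | r <= `|\sum_i trunc F h d (4 * n%:R ^+ 2)^-1 k i x|].
Proof.
move=> k; apply: measurable_leb; apply: measurableT_comp => //.
by apply: measurable_sum => i; exact: measurable_trunc.
Qed.

Lemma measurable_bad : measurable [set x : n.-tuple E | bad F h D d r x].
Proof.
exact: (measurable_orb (measurable_existsb m1) (measurable_orb (measurable_existsb m2)
  (measurable_orb (measurable_existsb m3) (measurable_orb (measurable_existsb m4)
  (measurable_existsb m5))))).
Qed.

Lemma bad_le : D <= 4 -> d <= 4 * n%:R ->
  fine (mu [set x : n.-tuple E | bad F h D d r x]) <=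
    (n%:R * #|K|%:R + #|K|%:R + #|K|%:R ^+ 2) * (2 * expR (- (n%:R * D ^+ 2 / 32)))
    + n%:R * #|K|%:R * (2 * expR (- (d ^+ 2 / (32 * n%:R))) * (4 * n%:R ^+ 2))
    + #|K|%:R * (2 * expR ((d ^+ 2 + 1) / (8 * n%:R) - r / (4 * n%:R))).
Proof.
move=> D4 dn.
have hD : 0 <= n%:R * D / 2 <= 2 * n%:R.
  have : 0 <= n%:R * (4 - D) by rewrite mulr_ge0// ?subr_ge0// ltW.
  have : 0 <= n%:R * D by rewrite mulr_ge0// ltW.
  by move: (n%:R : R) => q; lra.
have eD : tail n (n%:R * D / 2) = 2 * expR (- (n%:R * D ^+ 2 / 32)).
  by rewrite /tail; congr (_ * expR (- _)); field; rewrite gt_eqF.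
have ed : tail n (d / 2) = 2 * expR (- (d ^+ 2 / (32 * n%:R))).
  by rewrite /tail; congr (_ * expR (- _)); field; rewrite gt_eqF.
have hd : 0 <= d <= 4 * n%:R by rewrite d_ge0.
have tau0 : 0 < (4 * n%:R ^+ 2 : R)^-1 by rewrite invr_gt0 mulr_gt0// exprn_gt0.
have b1 := union_bound m1 (fun p => row_dev_tail hiid n_ge2 mh h01 p hD).
have b2 := union_bound m2 (fun p => proj_dev_tail hiid n_ge2 mh h01 p hD).
have b3 := union_bound m3 (fun p => cov_dev_tail hiid n_ge2 mh h01 p hD).
have b4 := union_bound m4 (fun p => exceedance_tail hiid n_ge2 mh h01 p hd tau0).
have b5 := union_bound m5 (fun p => trunc_tail hiid n_ge2 mh h01 hsym p r d_ge0 tau0).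
have e1 := measurable_existsb m1; have e2 := measurable_existsb m2.
have e3 := measurable_existsb m3; have e4 := measurable_existsb m4.
have e5 := measurable_existsb m5.
apply: le_trans (union_bound2 mu e1 (measurable_orb e2 (measurable_orb e3 (measurable_orb e4 e5)))) _.
have u2 := union_bound2 mu e2 (measurable_orb e3 (measurable_orb e4 e5)).
have u3 := union_bound2 mu e3 (measurable_orb e4 e5).
have u4 := union_bound2 mu e4 e5.
rewrite !card_prod !card_ord !natrM ?eD ?ed ?invrK in b1 b2 b3 b4 b5.
rewrite divff in b5; last by rewrite mulf_neq0// expf_neq0// gt_eqF.
move: b1 b2 b3 b4 b5 u2 u3 u4.
move: (expR _) (expR _) (expR _) => x1 x2 x3.
move: (fine _) (fine _) (fine _) (fine _) (fine _) (fine _) (fine _) (fine _).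
move=> y1 y2 y3 y4 y5 y6 y7 y8.
lra.
Qed.

(** Everything is measured in [N = n * q = expR L]. The three groups contribute 6, 8 and 2 over [N];
    the second one also pays Markov's factor [4 * n ^+ 2], which is why its tail is taken one power
    smaller. *)
Lemma bad_prob (L q : R) : 1 <= q -> #|K|%:R <= q ^+ 2 -> expR L = n%:R * q -> 1 <= L ->
  12 * L <= n%:R -> n%:R * D ^+ 2 = 160 * L -> d ^+ 2 = 192 * n%:R * L ->
  r = 120 * n%:R * L ->
  fine (mu [set x : n.-tuple E | bad F h D d r x]) <= 16 / (n%:R * q).
Proof.
move=> q1 Kq eL L1 Ln hD hd hr.
have q0 : 0 < q by exact: lt_le_trans q1.
have n1 : 1 <= n%:R :> R by rewrite ler1n ltnW.
set N := n%:R * q in eL *.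
have N0 : 0 < N by rewrite mulr_gt0.
have N1 : 1 <= N by rewrite mulr_ege1.
apply: le_trans (bad_le _ _) _.
- rewrite -(@ler_pXn2r _ 2)// ?nnegrE//.
  by rewrite -(ler_pM2l nR) hD; lra.
- rewrite -(@ler_pXn2r _ 2)// ?nnegrE ?mulr_ge0 ?(ltW nR)// hd.
  rewrite (_ : (4 * n%:R) ^+ 2 = n%:R * (16 * n%:R)); last by ring.
  by rewrite (_ : 192 * _ * L = n%:R * (16 * (12 * L))); [rewrite ler_pM2l// ler_pM2l|ring].
have x5 : expR (- (5 * L)) = N ^- 5 by rewrite expRN expRM_natl eL.
have x6 : expR (- (6 * L)) = N ^- 6 by rewrite expRN expRM_natl eL.
have -> : - (n%:R * D ^+ 2 / 32) = - (5 * L) by rewrite hD; field.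
have -> : - (d ^+ 2 / (32 * n%:R)) = - (6 * L) by rewrite hd; field; rewrite gt_eqF.
(* The choices of [d] and [r] give 24 L - 30 L = -6 L; the stray [(8 * n)^-1] is at most [1 <= L]
   and is absorbed in one [L]. *)
have hV : expR ((d ^+ 2 + 1) / (8 * n%:R) - r / (4 * n%:R)) <= expR (- (5 * L)).
  rewrite ler_expR hd hr.
  rewrite (_ : _ - _ = - (6 * L) + (8 * n%:R)^-1); last by field; rewrite gt_eqF.
  have : (8 * n%:R : R)^-1 <= 1 by rewrite invf_le1 ?mulr_gt0//; lra.
  by lra.
move: hV; rewrite x5 x6 => hV.
have K0 : 0 <= #|K|%:R :> R by [].
have qN : q <= N by rewrite ler_peMl// ltW.
have KN : #|K|%:R <= N ^+ 2.
  by apply: le_trans Kq _; rewrite ler_pXn2r ?nnegrE// ltW.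
have nN : n%:R <= N by rewrite ler_peMr// ltW.
have nKN : n%:R * #|K|%:R <= N ^+ 2.
  apply: le_trans (_ : n%:R * q ^+ 2 <= _).
    by rewrite ler_pM2l.
  by rewrite /N exprMn ler_pM2r ?exprn_gt0// expr2 ler_peMr// ltW.
have N24 : N ^+ 2 <= N ^+ 4 by rewrite ler_weXn2l.
have N45 : N ^+ 4 <= N ^+ 5 by rewrite ler_weXn2l.
have N5 : 0 < N ^+ 5 by rewrite exprn_gt0.
have y1 : (n%:R * #|K|%:R + #|K|%:R + #|K|%:R ^+ 2) * (2 * N ^- 5) <= 6 / N.
  have K2 : #|K|%:R ^+ 2 <= N ^+ 4.
    by rewrite (_ : N ^+ 4 = (N ^+ 2) ^+ 2); [rewrite ler_pXn2r ?nnegrE// exprn_ge0// ltW|ring].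
  rewrite (_ : 6 / N = 3 * N ^+ 4 * (2 * N ^- 5)); last by field; rewrite gt_eqF.
  by rewrite ler_wpM2r// ?mulr_ge0 ?invr_ge0 ?(ltW N5)//; lra.
have y2 : n%:R * #|K|%:R * (2 * N ^- 6 * (4 * n%:R ^+ 2)) <= 8 / N.
  rewrite (_ : 8 / N = N ^+ 5 * (8 * N ^- 6)); last by field; rewrite gt_eqF.
  rewrite (_ : _ * _ * _ = n%:R * #|K|%:R * n%:R ^+ 2 * (8 * N ^- 6)); last by ring.
  rewrite ler_wpM2r ?mulr_ge0 ?invr_ge0 ?exprn_ge0 ?(ltW N0)//.
  apply: le_trans (_ : N ^+ 2 * N ^+ 2 <= _); last by rewrite -exprD.
  by apply: ler_pM; rewrite ?mulr_ge0 ?exprn_ge0// ler_pXn2r ?nnegrE// ltW.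
have y3 : #|K|%:R * (2 * expR ((d ^+ 2 + 1) / (8 * n%:R) - r / (4 * n%:R))) <= 2 / N.
  apply: le_trans (_ : N ^+ 4 * (2 * N ^- 5) <= _).
    by apply: ler_pM; rewrite ?mulr_ge0 ?expR_ge0//; [exact: le_trans N24|rewrite ler_pM2l].
  by rewrite le_eqVlt; apply/orP; left; apply/eqP; field; rewrite gt_eqF.
move: y1 y2 y3; rewrite (_ : 16 / N = 6 / N + 8 / N + 2 / N); last by ring.
by move=> y1 y2 y3; rewrite lerD// lerD.
Qed.

End bad_event.

(** Log-sum-exp approximates one-sided maxima, so absolute values are encoded by doubling the index
    set with a sign. *)
Definition signed (R : realType) (K : Type) (w : K -> R) (j : bool * K) : R :=
  (-1) ^+ j.1 * w j.2.

(** A negative level is always exceeded, by one of the two signs at [k0]. *)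
Lemma exists_signed (R : realType) (K : finType) (w : K -> R) (k0 : K) t :
  [exists j : bool * K, t < signed w j] = (t < 0) || [exists k, t < `|w k|].
Proof.
apply/existsP/orP => [[[b k]]|[t0|/existsP[k]]].
- rewrite /signed /= => tw; have [_|t0] := ltP t 0; [by left|right].
  apply/existsP; exists k; apply: (lt_le_trans tw); apply: le_trans (ler_norm _) _.
  by rewrite normrM normr_sign mul1r.
- exists (w k0 < 0, k0); rewrite /signed /=; apply: lt_le_trans t0 _.
  by case: (ltP (w k0) 0) => h; rewrite ?expr1 ?expr0 ?mulN1r ?mul1r// oppr_ge0 ltW.
- move=> tw; exists (w k < 0, k); rewrite /signed /=.
  by rewrite -normrEsign.
Qed.

(** * Rates *)

Section signed_clt.
Context dT (T : measurableType dT) (R : realType) (n : nat) (K : finType) (k0 : K).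
Notation N01 := (@normal_prob R 0 1).
Notation E := (T * measurableTypeR R)%type.
Variables (F : probability T R) (mu : probability (n.-tuple E) R).
Hypothesis hiid : iid_law mu (F \x N01)%E.
Hypothesis n_gt0 : (0 < n)%N.
Variables (G : T -> K -> R) (v : 'I_n -> K -> R).
Hypothesis mG : forall k, measurable_fun setT (fun a => G a k).
Hypothesis G_le1 : forall a k, `|G a k| <= 1.
Hypothesis G_mean0 : forall k, \int[F]_a G a k = 0.
Hypothesis v_le1 : forall i k, `|v i k| <= 1.

Local Notation sG := (fun a => signed (G a)).
Local Notation sv := (fun i => signed (v i)).
Local Notation J := (bool * K)%type.

(* [s ^+ 2] is [ln (n p)] and [eps ^+ 6 = s ^+ 14 / n], so that [n^-1/2 = eps ^+ 3 / s ^+ 7]. *)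
Variables (s eps C1 Delta : R).
Hypothesis s_ge1 : 1 <= s.
Hypothesis eps_gt0 : 0 < eps.
Hypothesis eps_small : 16 * eps <= 1.
Hypothesis rn_eps : rn R n = eps ^+ 3 / s ^+ 7.
Hypothesis C1_gt0 : 0 < C1.
Hypothesis Gam_diag : forall k, C1 <= Gam F G k k.
Hypothesis Delta_le : Delta <= 78 * (eps ^+ 3 / s ^+ 6).
Hypothesis Delta_C1 : Delta <= C1 / 2.
Hypothesis Gam_Sig : forall k k', `|Gam F G k k' - Sig v k k'| <= Delta.
Hypothesis ln_card : ln (4 * #|K|%:R) <= 2 * s ^+ 2.

Let s0 : 0 < s. Proof. exact: lt_le_trans s_ge1. Qed.

(** [beta / kappa = s ^+ 2] matches the log-cardinality, and [beta ^+ 2 * rn = eps / s], so that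
    [kappa * beta ^+ 2 * rn = 1]. The Chernoff parameter [lam] is taken to be [s]. *)
Let beta : R := s ^+ 3 / eps.
Let kappa : R := s / eps.

Let beta_gt0 : 0 < beta. Proof. by rewrite divr_gt0// exprn_gt0. Qed.
Let kappa_gt0 : 0 < kappa. Proof. by rewrite divr_gt0. Qed.

Let kappa_beta : kappa <= beta.
Proof. by rewrite ler_pM2r ?invr_gt0// ler_eXnr. Qed.

Let eps1 : eps <= 1.
Proof. by have := eps_small; have := eps_gt0; lra. Qed.

Let inv_s k : (s ^+ k)^-1 <= 1.
Proof. by rewrite invf_le1 ?exprn_gt0// exprn_ege1. Qed.

Let eps2 : eps ^+ 2 <= 1 / 256.
Proof.
rewrite (_ : 1 / 256 = (1 / 16) ^+ 2); last by field.
by rewrite ler_pXn2r ?nnegrE ?(ltW eps_gt0)//; have := eps_small; lra.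
Qed.

Let kappa_rn : 4 * (kappa * rn R n) <= 1.
Proof.
rewrite rn_eps /kappa (_ : _ * _ = 4 * eps ^+ 2 * (s ^+ 6)^-1).
  apply: le_trans (_ : 1 * 1 <= _); last by rewrite mulr1.
  apply: ler_pM => //; rewrite ?mulr_ge0 ?exprn_ge0 ?invr_ge0 ?(ltW eps_gt0) ?exprn_ge0 ?(ltW s0)//.
  by have := eps2; lra.
by field; rewrite !gt_eqF.
Qed.

Let lam_rn : s * rn R n <= 1 / 2.
Proof.
apply: le_trans (_ : eps ^+ 2 * (s ^+ 6)^-1 <= _).
  rewrite rn_eps (_ : s * _ = eps * (eps ^+ 2 * (s ^+ 6)^-1)).
    rewrite ler_piMl// mulr_ge0 ?sqr_ge0// invr_ge0 exprn_ge0// ltW//.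
  by field; rewrite !gt_eqF.
apply: le_trans (_ : 1 / 256 * 1 <= _); last by lra.
by apply: ler_pM; rewrite ?sqr_ge0 ?invr_ge0 ?exprn_ge0 ?(ltW s0).
Qed.

Let card_gt0 : 0 < #|K|%:R :> R.
Proof. by rewrite ltr0n; apply/card_gt0P; exists k0. Qed.

Let cardJ : #|{: J}|%:R = 2 * #|K|%:R :> R.
Proof. by rewrite card_prod card_bool natrM. Qed.

Let ln_cardJ : kappa * ln #|{: J}|%:R <= 2 * beta.
Proof.
rewrite (_ : 2 * beta = kappa * (2 * s ^+ 2)); last by rewrite /beta /kappa; field; rewrite gt_eqF.
rewrite ler_pM2l// cardJ; apply: le_trans ln_card; rewrite ler_ln ?posrE ?mulr_gt0//.
by rewrite ler_pM2r// ler_nat.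
Qed.

Let sign2 (b b' : bool) (x : R) : `|(-1) ^+ b * (-1) ^+ b' * x| = `|x|.
Proof. by rewrite !normrM !normr_sign !mul1r. Qed.

Let Gam_signed j j' : Gam F sG j j' = (-1) ^+ j.1 * (-1) ^+ j'.1 * Gam F G j.2 j'.2.
Proof.
rewrite /Gam -RintegralZl//; last first.
  apply: (@integrable_bounded _ _ _ _ _ 1); first exact: measurable_funM.
  by move=> a; rewrite normrM mulr_ile1.
by apply: eq_Rintegral => a _; rewrite /signed mulrACA.
Qed.

Let Sig_signed j j' : Sig sv j j' = (-1) ^+ j.1 * (-1) ^+ j'.1 * Sig v j.2 j'.2.
Proof.
rewrite /Sig mulr_sumr; apply: eq_bigr => i _.
by rewrite /signed; ring.
Qed.

Let sG_le1 a j : `|sG a j| <= 1.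
Proof. by rewrite normrM normr_sign mul1r. Qed.

Let sv_le1 i j : `|sv i j| <= 1.
Proof. by rewrite normrM normr_sign mul1r. Qed.

Let msG j : measurable_fun setT (fun a => sG a j).
Proof. exact: measurable_funM. Qed.

Let sG_mean0 j : \int[F]_a sG a j = 0.
Proof.
rewrite /signed RintegralZl ?G_mean0 ?mulr0//.
by apply: (@integrable_bounded _ _ _ _ _ 1) => // a; exact: G_le1.
Qed.

Let sq_sign (b : bool) : (-1) ^+ b * (-1) ^+ b = 1 :> R.
Proof. by rewrite -expr2 sqrr_sign. Qed.

Let c1_gt0 : 0 < C1 / 2. Proof. by rewrite divr_gt0. Qed.

Let sGam_diag j : C1 / 2 <= Gam F sG j j.
Proof. by rewrite Gam_signed sq_sign mul1r; have := Gam_diag j.2; have := C1_gt0; lra. Qed.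

Let sSig_diag j : C1 / 2 <= Sig sv j j.
Proof.
rewrite Sig_signed sq_sign mul1r; have := Gam_diag j.2; have := Gam_Sig j.2 j.2.
by rewrite ler_norml => /andP[_]; have := Delta_C1; lra.
Qed.

Let sGam_Sig j j' : `|Gam F sG j j' - Sig sv j j'| <= Delta.
Proof. by rewrite Gam_signed Sig_signed -mulrBr sign2. Qed.

Let beta_rn : beta ^+ 2 * rn R n = eps / s.
Proof. by rewrite rn_eps /beta; field; rewrite !gt_eqF. Qed.

Lemma anti_ge0 : 0 <= anti n {: J} beta kappa s (C1 / 2).
Proof.
apply: divr_ge0; last by rewrite ltW// mulr_gt0.
apply: addr_ge0; last by rewrite -mulrA beta_rn mulr_ge0// divr_ge0// ltW.
apply: divr_ge0; last exact: ltW.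
apply: addr_ge0; last by rewrite mulr_ge0// sqr_ge0.
have : 1 <= #|K|%:R :> R by rewrite ler1n -(@ltr0n R).
by move=> h; apply: ln_ge0; rewrite cardJ; lra.
Qed.

(** [dev] is at most [5 * s], 2 from the log-cardinality and 3 from [lam = s]; the Stein error is at
    most [13 * s] since 208 / 16 = 13. Dividing [18 * s] by [kappa * (C1 / 2)] gives 36. *)
Lemma anti_le : anti n {: J} beta kappa s (C1 / 2) <= 36 * (eps / C1).
Proof.
rewrite /anti ler_pdivrMr; last by apply: mulr_gt0; [exact: kappa_gt0|exact: c1_gt0].
rewrite (_ : 36 * (eps / C1) * (kappa * (C1 / 2)) = 18 * s); last by rewrite /kappa; field; rewrite !gt_eqF.
rewrite -mulrA beta_rn.
have d5 : dev {: J} s <= 5 * s.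
  rewrite /dev ler_pdivrMr// cardJ (_ : 2 * (2 * #|K|%:R) = 4 * #|K|%:R); last by ring.
  by rewrite (_ : 5 * s * s = 2 * s ^+ 2 + 3 * s ^+ 2); [rewrite lerD2r|ring].
have h208 : 208 * (eps / s) <= 13 * s.
  rewrite mulrA ler_pdivrMr//; have : 1 * 1 <= s * s by apply: ler_pM.
  by have := eps_small; lra.
by rewrite (_ : 18 * s = 5 * s + 13 * s); [rewrite lerD|ring].
Qed.

(** The covariance term is at most 3 * 78 / 16 <= 15 and the Stein term equals 208, which add to
    223; then 36 * (40 + 2 * 223) = 17496. *)
Lemma kolmogorov_signed t :
  `|fine (mu [set x | [exists j, t < Ssum sG x j]]) -
    fine (mu [set x | [exists j, t < Ysum sv x j]])| <= 17500 * (eps / C1).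
Proof.
have := kolmogorov (false, k0) hiid n_gt0 msG sG_le1 sG_mean0 sv_le1 beta_gt0 kappa_gt0
  kappa_beta kappa_rn s0 lam_rn c1_gt0 sGam_diag sSig_diag ln_cardJ sGam_Sig t.
move/le_trans; apply.
have a0 := anti_ge0; have a1 := anti_le.
move: (anti _ _ _ _ _ _) a0 a1 => a a0 a1.
have hk : kappa * (3 * beta * Delta + 208 * beta ^+ 2 * rn R n) <= 223.
  rewrite -[208 * _ * _]mulrA beta_rn mulrDr.
  have -> : kappa * (208 * (eps / s)) = 208 by rewrite /kappa; field; rewrite !gt_eqF.
  have : kappa * (3 * beta * Delta) <= 15; last by lra.
  apply: le_trans (_ : kappa * (3 * beta * (78 * (eps ^+ 3 / s ^+ 6))) <= _).
    by rewrite ler_pM2l// ler_pM2l// mulr_gt0.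
  rewrite (_ : _ * _ = 234 * eps * (s ^+ 2)^-1); last by rewrite /kappa /beta; field; rewrite !gt_eqF.
  apply: le_trans (_ : 234 * eps * 1 <= _); last by have := eps_small; lra.
  by rewrite ler_pM2l ?mulr_gt0.
have : kappa * (3 * beta * Delta + 208 * beta ^+ 2 * rn R n) * a <= 223 * a.
  by rewrite ler_wpM2r.
move: (kappa * _ * a) => q; have : 0 < eps / C1 by rewrite divr_gt0.
by move: (eps / C1) a1 => z; lra.
Qed.

(** The step [eps / s] is [1 / kappa], the width of the smoothing, and 4680 = 130 * 36. *)
Lemma max_anti_concentration_signed t :
  fine (mu [set x | [exists j, t < Ssum sG x j]]) -
  fine (mu [set x | [exists j, t + eps / s < Ssum sG x j]]) <= 4680 * (eps / C1).
Proof.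
have es : 0 <= eps / s by rewrite divr_ge0// ltW.
have ke : kappa * (eps / s) <= 1 by rewrite le_eqVlt /kappa; apply/orP; left; apply/eqP; field; rewrite !gt_eqF.
have := max_anti_concentration (false, k0) hiid n_gt0 msG sG_le1 sG_mean0 sv_le1 beta_gt0 kappa_gt0
  kappa_beta kappa_rn s0 lam_rn c1_gt0 sGam_diag sSig_diag ln_cardJ t es ke.
move/le_trans; apply; have := anti_le.
by move: (anti _ _ _ _ _ _) (eps / C1) => a z; lra.
Qed.

End signed_clt.

(** * From uniformly close tails to the size of the test *)

Section quantile.
Context (R : realType).

(** [H] may jump over the level [th], so no exact crossing is available; walking from [s0] in steps
    of [dl], the first step that falls to [th] gives two neighbouring points on either side. *)
Lemma crossing_step (H : R -> R) (s0 M dl th : R) : 0 < dl -> th < H s0 ->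
  (forall t, M <= t -> H t <= th) -> exists s, th < H s /\ H (s + dl) <= th.
Proof.
move=> dl0 hs0 hM.
have ex : exists k : nat, H (s0 + k%:R * dl) <= th.
  exists (Num.bound `|(M - s0) / dl|); apply: hM.
  rewrite -lerBlDl -ler_pdivrMr//; apply: le_trans (ler_norm _) _.
  exact/ltW/archi_boundP.
have [] := ex_minnP ex; case=> [|k]; first by rewrite mul0r addr0 leNgt hs0.
move=> hk kmin; exists (s0 + k%:R * dl); split.
  by rewrite ltNge; apply/negP => /kmin; rewrite ltnn.
by move: hk; rewrite -natr1 mulrDl mul1r addrA.
Qed.

(** [H] is the deterministic tail of max S, [pr] the rejection probability and [rho] the uniform
    error of the bootstrap tails. At a crossing of [al - rho] or [al + rho] every good bootstrap
    tail is on a known side of [al]; reaching the tail that bounds [pr] from there takes two steps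
    of length [dl] below and three above, each costing [a]. *)
Lemma quantile_size (H : R -> R) (pr al rho pb a dl M : R) : 0 < dl ->
  0 < al < 1 -> 0 <= pr <= 1 -> 0 <= rho -> 0 <= pb -> 0 <= a ->
  H (-1) = 1 -> (forall t, M <= t -> H t = 0) ->
  (forall t, H t - H (t + dl) <= a) ->
  (forall s, al + rho < H s -> pr <= H (s - 2 * dl) + pb) ->
  (forall s, H s <= al - rho -> H (s + dl) <= pr + pb) ->
  `|pr - al| <= rho + 3 * a + pb.
Proof.
move=> dl0 /andP[al0 al1] /andP[pr0 pr1] rho0 pb0 a0 H1 H0 Ha hU hL.
rewrite ler_norml; apply/andP; split.
- have [|th0] := leP (al - rho) 0; first by lra.
  have [|t Mt|s [hs1 hs2]] := @crossing_step H (-1) M dl (al - rho) dl0.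
  - by rewrite H1; lra.
  - by rewrite H0// ltW.
  have := hL _ hs2; have := Ha s; have := Ha (s + dl); lra.
- have [|th1] := leP 1 (al + rho); first by lra.
  have [|t Mt|s [hs1 hs2]] := @crossing_step H (-1) M dl (al + rho) dl0.
  - by rewrite H1.
  - by rewrite H0//; lra.
  have := hU _ hs1; have := Ha (s - 2 * dl); have := Ha (s - 2 * dl + dl).
  rewrite (_ : s - 2 * dl + dl + dl = s); last by ring.
  by have := Ha s; lra.
Qed.

Variables (H : R -> R) (c al : R).
Hypothesis c_gt0 : 0 < c.
Hypothesis H_anti : forall s t, s <= t -> H t <= H s.
Notation q := (inf [set t | 1 - al <= 1 - H (c * t)]).

(** The existence hypothesis makes the set nonempty; for the empty set [inf] would return a default
    value. *)
Lemma le_quantile s : (exists t, H t <= al) -> al < H s -> s <= c * q.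
Proof.
move=> [t ht] hs; rewrite mulrC -ler_pdivrMr//; apply: lb_le_inf.
  by exists (t / c); rewrite /= mulrC divfK ?gt_eqF// lerD2l lerN2.
move=> u /= hu; rewrite leNgt; apply/negP; rewrite ltr_pdivlMr// mulrC => us.
by have := H_anti (ltW us); lra.
Qed.

(** Since [al < 1], no negative level belongs to the set, which is therefore bounded below, as its
    infimum must be to lie under its elements. *)
Lemma quantile_le s : al < 1 -> (forall t, t < 0 -> H t = 1) -> H s <= al -> c * q <= s.
Proof.
move=> al1 H1 hs; rewrite mulrC -ler_pdivlMr//; apply: ge_inf.
  exists 0 => u /= hu; rewrite leNgt; apply/negP => u0.
  by move: hu; rewrite H1; [lra|rewrite pmulr_rlt0].
by rewrite /= mulrC divfK ?gt_eqF// lerD2l lerN2.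
Qed.

End quantile.

Section size.
Context dT (T : measurableType dT) (R : realType) (n : nat) (K : finType) (k0 : K).
Notation E := (T * measurableTypeR R)%type.
Notation N01 := (@normal_prob R 0 1).
Variables (F : probability T R) (mu : probability (n.-tuple E) R).
Hypothesis hiid : iid_law mu (F \x N01)%E.
Hypothesis n_ge2 : (2 <= n)%N.
Variable h : T -> T -> K -> R.
Hypothesis mh : forall k, measurable_fun setT (fun p : T * T => h p.1 p.2 k).
Hypothesis h01 : forall a b k, 0 <= h a b k <= 1.
Hypothesis hsym : forall a b k, h a b k = h b a k.

(** Residuals are taken at [x] and multipliers at a separate point [y], so [mu] integrates over the
    multipliers alone; at level [c * t] this is the conditional probability that the bootstrap
    statistic exceeds [t]. *)
Definition boot_tail (x : n.-tuple E) (t : R) : R :=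
  fine (mu [set y | [exists j, t < Ysum (fun i => signed (resid h x i)) y j]]).

Variables (stat : n.-tuple E -> R) (al C1 s eps q : R).
Let c : R := Num.sqrt n%:R / 2.
Hypothesis lt_stat : forall x t, (t < stat x) =
  (t < 0) || [exists k, t < `|ustat h x k - theta F h k|].
Hypothesis al01 : 0 < al < 1.

Definition boot_rejects (x : n.-tuple E) : bool :=
  inf [set t | 1 - al <= 1 - boot_tail x (c * t)] <= stat x.

Hypothesis mrej : measurable [set x | boot_rejects x].
Hypothesis s_ge1 : 1 <= s.
Hypothesis eps_gt0 : 0 < eps.
Hypothesis eps_small : 16 * eps <= 1.
Hypothesis eps_C1 : eps <= C1.
Hypothesis rn_eps : rn R n = eps ^+ 3 / s ^+ 7.
Hypothesis Gam_diag : forall k, C1 <= Gam F (proj F h) k k.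
Hypothesis q_ge1 : 1 <= q.
Hypothesis card_q : #|K|%:R <= q ^+ 2.
Hypothesis n_ge4 : (4 <= n)%N.
Hypothesis exp_s : expR (s ^+ 2) = n%:R * q.

Let n_gt0 : (0 < n)%N := ltnW n_ge2.
Let nR : (0 : R) < n%:R. Proof. by rewrite ltr0n. Qed.
Let s0 : 0 < s. Proof. exact: lt_le_trans s_ge1. Qed.
Let C1_gt0 : 0 < C1. Proof. exact: lt_le_trans eps_C1. Qed.
Let c_gt0 : 0 < c. Proof. by rewrite divr_gt0// sqrtr_gt0. Qed.
Let eps1 : eps <= 1.
Proof. by have := eps_small; have := eps_gt0; lra. Qed.
Let eps2 : eps ^+ 2 <= 1 / 256.
Proof.
rewrite (_ : 1 / 256 = (1 / 16) ^+ 2); last by field.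
by rewrite ler_pXn2r ?nnegrE ?(ltW eps_gt0)//; have := eps_small; lra.
Qed.

Let nrn : n%:R * (rn R n * rn R n) = 1 := rn2n R n_gt0.

(* With [L = s ^+ 2 = ln (n q)], the tails at these levels are of order [(n q)^-5] for [D] and [r],
   and [(n q)^-6] for [d]; this pays for the union bounds over at most [(n q)^4] indices. *)
Let D : R := Num.sqrt 160 * (s * rn R n).
Let d : R := Num.sqrt (192 * n%:R * s ^+ 2).
Let r : R := 120 * n%:R * s ^+ 2.
Let dl : R := eps / s.

Let D_ge0 : 0 <= D.
Proof. by rewrite mulr_ge0 ?sqrtr_ge0// mulr_ge0 ?(ltW s0)// ltW// rn_gt0. Qed.

Let d_ge0 : 0 <= d. Proof. exact: sqrtr_ge0. Qed.

Let D_le : 6 * D <= 78 * (eps ^+ 3 / s ^+ 6).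
Proof.
have s160 : Num.sqrt 160 <= 13 :> R.
  rewrite -(@ler_pXn2r _ 2)// ?nnegrE ?sqrtr_ge0// sqr_sqrtr//.
  by rewrite -natrX ler_nat.
rewrite /D rn_eps (_ : s * _ = eps ^+ 3 / s ^+ 6); last by field; rewrite gt_eqF.
move: (eps ^+ 3 / s ^+ 6) (divr_ge0 (exprn_ge0 3 (ltW eps_gt0)) (exprn_ge0 6 (ltW s0))) => z z0.
by rewrite mulrA; apply: ler_wpM2r => //; lra.
Qed.

Let D_C1 : 6 * D <= C1 / 2.
Proof.
apply: le_trans D_le _.
have : eps ^+ 3 / s ^+ 6 <= eps / 256.
  rewrite ler_pdivrMr ?exprn_gt0//; apply: le_trans (_ : eps / 256 * 1 <= _).
    by rewrite mulr1 exprS ler_pM2l//; have := eps2; lra.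
  apply: ler_wpM2l; last exact: exprn_ege1.
  exact: divr_ge0 (ltW eps_gt0) (ler0n _ _).
by have := eps_C1; have := eps_gt0; lra.
Qed.

Let bad_x (x : n.-tuple E) := bad F h D d r x.

Let card_gt0 : 0 < #|K|%:R :> R.
Proof. by rewrite ltr0n; apply/card_gt0P; exists k0. Qed.

Let ln_card : ln (4 * #|K|%:R) <= 2 * s ^+ 2.
Proof.
rewrite -[leRHS]expRK ler_ln ?posrE ?expR_gt0 ?mulr_gt0//.
rewrite expRM_natl exp_s exprMn; apply: ler_pM => //.
by rewrite -natrX ler_nat (leq_trans n_ge4)// -mulnn leq_pmulr.
Qed.

Let n_eps : n%:R * eps ^+ 6 = s ^+ 14.
Proof.
have := nrn; rewrite rn_eps => e1.
transitivity (n%:R * (eps ^+ 3 / s ^+ 7 * (eps ^+ 3 / s ^+ 7)) * s ^+ 14).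
  by field; rewrite gt_eqF.
by rewrite e1 mul1r.
Qed.

Let bad_small : fine (mu [set x : n.-tuple E | bad_x x]) <= 16 * eps.
Proof.
have sn : 1 <= s ^+ 2 by rewrite exprn_ege1.
apply: le_trans (bad_prob hiid n_ge2 mh h01 hsym D_ge0 d_ge0 q_ge1 card_q exp_s sn _ _ _ _) _.
- have e6 : 12 * eps ^+ 6 <= 1.
    rewrite (_ : eps ^+ 6 = eps ^+ 2 * eps ^+ 4); last by ring.
    have : eps ^+ 2 * eps ^+ 4 <= 1 / 256 * 1.
      by apply: ler_pM; rewrite ?exprn_ge0 ?(ltW eps_gt0)// exprn_ile1// ltW.
    by lra.
  rewrite -(@ler_pM2r _ (eps ^+ 6)) ?exprn_gt0// n_eps mulrAC.
  rewrite (_ : s ^+ 14 = s ^+ 12 * s ^+ 2); last by ring.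
  rewrite ler_pM2r ?exprn_gt0//; apply: le_trans e6 _; exact: exprn_ege1.
- rewrite /D !exprMn sqr_sqrtr// (_ : _ * _ = 160 * s ^+ 2 * (n%:R * (rn R n * rn R n))); last by ring.
  by rewrite nrn mulr1.
- exact: sqr_sqrtr (mulr_ge0 (mulr_ge0 (ler0n _ _) (ltW nR)) (sqr_ge0 s)).
- by [].
have e6 : eps ^+ 6 <= eps by rewrite exprS ler_piMr ?(ltW eps_gt0)// exprn_ile1// ltW.
have nq0 : 0 < n%:R * q by rewrite mulr_gt0// (lt_le_trans _ q_ge1).
rewrite ler_pdivrMr// -mulrA ler_peMr//.
have neps : 1 <= n%:R * eps.
  apply: le_trans (_ : n%:R * eps ^+ 6 <= _); last by rewrite ler_pM2l.
  by rewrite n_eps exprn_ege1.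
by rewrite mulrA (mulrC eps) -[leLHS]mulr1; apply: ler_pM.
Qed.

Let sG a := signed (proj F h a).
Let PT (t : R) : R := fine (mu [set x : n.-tuple E | [exists j, t < Ssum sG x j]]).

Let msG j : measurable_fun setT (fun a => sG a j).
Proof. by apply: measurable_funM => //; exact: measurable_proj. Qed.

Let mS t : measurable [set x : n.-tuple E | [exists j, t < Ssum sG x j]].
Proof. by apply: measurable_exists_lt => j; exact: measurable_Ssum. Qed.

Let mY (v : 'I_n -> bool * K -> R) t : measurable [set x : n.-tuple E | [exists j, t < Ysum v x j]].
Proof. by apply: measurable_exists_lt => j; exact: measurable_Ysum. Qed.

Let Ssum_signed (x : n.-tuple E) j : Ssum sG x j = signed (Ssum (proj F h) x) j.
Proof.
by rewrite /sG /Ssum /signed [RHS]mulrCA -mulr_sumr.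
Qed.

Let Ysum_signed (v : 'I_n -> K -> R) (x : n.-tuple E) j :
  Ysum (fun i => signed (v i)) x j = signed (Ysum v x) j.
Proof.
rewrite /Ysum /signed [RHS]mulrCA; congr (_ * _); rewrite mulr_sumr.
by apply: eq_bigr => i _; rewrite mulrCA.
Qed.

Let exists_Ssum (x : n.-tuple E) t : [exists j, t < Ssum sG x j] =
  (t < 0) || [exists k, t < `|Ssum (proj F h) x k|].
Proof.
rewrite -(exists_signed _ k0); apply: eq_existsb => j.
by rewrite Ssum_signed.
Qed.

Let PT_neg t : t < 0 -> PT t = 1.
Proof.
move=> t0; rewrite /PT (_ : [set x | _] = setT) ?probability_setT//.
by apply/seteqP; split=> // x _ /=; rewrite exists_Ssum t0.
Qed.

Let PT_large t : rn R n * n%:R <= t -> PT t = 0.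
Proof.
move=> ht; rewrite /PT (_ : [set x | _] = set0) ?measure0//.
have rn0 := rn_gt0 R n_gt0.
apply/seteqP; split=> // x /=; rewrite exists_Ssum => /orP[|/existsP[k]].
  by move=> t0; move: (lt_le_trans t0 (mulr_ge0 (ltW rn0) (ltW nR))); rewrite ltNge ht.
rewrite ltNge => /negP; apply; apply: le_trans ht.
rewrite normrM gtr0_norm// ler_pM2l//; apply: le_trans (ler_norm_sum _ _ _) _.
rewrite -[X in _ <= X%:R]card_ord -sumr_const; apply: ler_sum => i _.
exact: normr_proj_le.
Qed.

Let boot_tail_neg x t : t < 0 -> boot_tail x t = 1.
Proof.
move=> t0; rewrite /boot_tail (_ : [set y | _] = setT) ?probability_setT//.
apply/seteqP; split=> // y _ /=.
rewrite (_ : [exists j, _] = [exists j, t < signed (Ysum (resid h x) y) j]).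
  by rewrite (exists_signed _ k0) t0.
by apply: eq_existsb => j; rewrite Ysum_signed.
Qed.

Let boot_tail_anti x t t' : t <= t' -> boot_tail x t' <= boot_tail x t.
Proof.
move=> tt; apply: probability_subset => // y /existsP[j hj]; apply/existsP; exists j.
exact: le_lt_trans hj.
Qed.

Let boot_tail_small x : exists t, boot_tail x t <= al.
Proof.
pose f (y : n.-tuple E) := rn R n * \sum_(i < n) `|(tnth y i).2|.
have rn0 := rn_gt0 R n_gt0.
have f0 y : 0 <= f y by rewrite mulr_ge0 ?(ltW rn0)// sumr_ge0.
have mf : measurable_fun setT f.
  apply: measurable_funM => //; apply: measurable_sum => i.
  by apply: measurableT_comp => //; exact: measurable_coord2.
have if_ : mu.-integrable setT (EFin \o f).
  apply: integrable_scale; apply: integrable_bigsum => i.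
  exact: integrable_norm (integrable_coord2 hiid i).
have [al0 _] := andP al01.
pose b := \int[mu]_y f y; have b0 : 0 <= b by apply: Rintegral_ge0.
exists ((b + 1) / al).
have t0 : 0 < (b + 1) / al by rewrite divr_gt0// ltr_wpDl.
have hb : (\int[mu]_y (f y)%:E <= (b + 1)%:E)%E.
  by rewrite -EFin_Rintegral// lee_fin lerDl.
have := markov_ge0 mf f0 t0 hb; rewrite invf_div mulrCA divff ?mulr1; last by rewrite gt_eqF// ltr_wpDl.
apply: le_trans; apply: probability_subset => //; first exact: measurable_leb.
move=> y /existsP[j]; rewrite Ysum_signed => /ltW/le_trans; apply.
rewrite /signed; apply: le_trans (ler_norm _) _; rewrite normrM normr_sign mul1r.
rewrite normrM gtr0_norm// ler_pM2l//; apply: le_trans (ler_norm_sum _ _ _) _.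
by apply: ler_sum => i _; rewrite normrM ler_piMr//; exact: normr_resid_le.
Qed.

Let dl_gt0 : 0 < dl. Proof. by rewrite divr_gt0. Qed.

(** The degenerate part is of order [s ^+ 2 * rn = eps ^+ 3 / s ^+ 5], smaller than [dl] by a factor
    of order [eps ^+ 2]; this leaves room for the constant 240. *)
Let remainder_le : rn R n * (r / (n%:R - 1)) <= dl.
Proof.
have n1 : 0 < n%:R - 1 :> R by rewrite subr_gt0 ltr1n.
have n2 : n%:R / (n%:R - 1) <= 2 :> R.
  by rewrite ler_pdivrMr//; have : (2 : R) <= n%:R; [rewrite ler_nat|lra].
have rn0 := rn_gt0 R n_gt0.
apply: le_trans (_ : rn R n * (240 * s ^+ 2) <= _).
  rewrite ler_pM2l// /r (_ : _ / _ = 120 * s ^+ 2 * (n%:R / (n%:R - 1))); last by ring.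
  rewrite (_ : 240 * s ^+ 2 = 120 * s ^+ 2 * 2); last by ring.
  by apply: ler_wpM2l n2; apply: mulr_ge0 (ler0n _ _) (sqr_ge0 s).
rewrite rn_eps (_ : _ * _ = 240 * eps ^+ 2 * (s ^+ 4)^-1 * dl); last first.
  by rewrite /dl; field; rewrite gt_eqF.
have : 240 * eps ^+ 2 <= 1 by have := eps2; lra.
move: (240 * eps ^+ 2) => z z1; rewrite -[leRHS]mul1r.
apply: ler_wpM2r; first exact: ltW.
rewrite ler_pdivrMr ?exprn_gt0// mul1r; exact: le_trans z1 (exprn_ege1 4 s_ge1).
Qed.

Let remainder (x : n.-tuple E) k : ~~ bad_x x ->
  `|c * (ustat h x k - theta F h k) - Ssum (proj F h) x k| <= dl.
Proof.
by move=> gx; apply: le_trans (hajek_remainder n_ge2 hsym gx k) remainder_le.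
Qed.

Let kolmogorov_x x t : ~~ bad_x x -> `|PT t - boot_tail x t| <= 17500 * (eps / C1).
Proof.
move=> gx.
apply: (kolmogorov_signed k0 hiid n_gt0 (measurable_proj F mh h01) (normr_proj_le F mh h01)
  (proj_mean0 F mh h01) (normr_resid_le n_ge2 h01 x) s_ge1 eps_gt0 eps_small rn_eps C1_gt0
  Gam_diag D_le D_C1 _ ln_card).
exact: resid_cov_close gx.
Qed.

Theorem bootstrap_size :
  `|fine (mu [set x | boot_rejects x]) - al| <=
  17500 * (eps / C1) + 3 * (4680 * (eps / C1)) + 16 * eps.
Proof.
have p01 (A : set (n.-tuple E)) : measurable A -> 0 <= fine (mu A) <= 1.
  move=> mA; rewrite fine_ge0//= -lee_fin fineK ?probability_le1//.
  exact: fin_num_measure.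
have e0 : 0 <= eps / C1 by rewrite divr_ge0// ltW.
have [al0 al1] := andP al01.
(* A good point is wanted below for the anti-concentration of S. If there is none, the bad event has
   probability 1, so [1 <= 16 * eps] and the claim is trivial. *)
have [[x0 gx0]|nogood] := pselect (exists x, ~~ bad_x x); last first.
  have badT : [set x : n.-tuple E | bad_x x] = setT.
    by apply/seteqP; split=> // x _ /=; apply/negPn/negP => gx; apply: nogood; exists x.
  have := bad_small; rewrite badT probability_setT /= => e16.
  apply: le_trans (_ : 1 <= _); last first.
    apply: le_trans e16 _; rewrite lerDr.
    exact: addr_ge0 (mulr_ge0 (ler0n _ _) e0) (mulr_ge0 (ler0n _ _) (mulr_ge0 (ler0n _ _) e0)).
  have /andP[pr0 pr1] := p01 _ mrej; rewrite ler_norml; apply/andP; split; lra.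
have mbad : measurable [set x : n.-tuple E | bad_x x] by exact: measurable_bad.
have split_bad (b b' : n.-tuple E -> bool) : measurable [set x | b x] ->
    measurable [set x | b' x] -> (forall x, b x -> ~~ bad_x x -> b' x) ->
    fine (mu [set x | b x]) <= fine (mu [set x | b' x]) + fine (mu [set x | bad_x x]).
  move=> mb mb' bb'; apply: le_trans (union_bound2 mu mb' mbad).
  apply: probability_subset => //; first exact: measurable_orb.
  by move=> x bx; case: (boolP (bad_x x)) => [_|gx]; rewrite ?orbT// bb'.
have dist_remainder (x : n.-tuple E) k : ~~ bad_x x ->
    `| `|Ssum (proj F h) x k| - c * `|ustat h x k - theta F h k| | <= dl.
  move=> gx; rewrite -(gtr0_norm c_gt0) -normrM distrC.
  exact: le_trans (ler_dist_dist _ _) (remainder k gx).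
have {}dist_remainder (x : n.-tuple E) k : ~~ bad_x x ->
    - dl <= `|Ssum (proj F h) x k| - c * `|ustat h x k - theta F h k| <= dl.
  by move=> gx; rewrite -ler_norml dist_remainder.
have core rho a : 0 <= rho -> 0 <= a ->
    (forall x t, ~~ bad_x x -> `|PT t - boot_tail x t| <= rho) ->
    (forall t, PT t - PT (t + dl) <= a) ->
    `|fine (mu [set x | boot_rejects x]) - al| <= rho + 3 * a + fine (mu [set x | bad_x x]).
  move=> rho0 a0 kx anti'.
  apply: (@quantile_size _ PT _ _ _ _ _ dl (rn R n * n%:R) dl_gt0).
  - exact: al01.
  - exact: p01.
  - exact: rho0.
  - by have /andP[] := p01 _ mbad.
  - exact: a0.
  - by apply: PT_neg; lra.
  - exact: PT_large.
  - exact: anti'.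
  (* On good data the quantile is at least [t / c]. Rejection gives [(t - dl) / c < stat x], one
     [dl] being spent on strictness, and the Hajek remainder spends the second. *)
  - move=> t hs; apply: split_bad => // x rx gx; rewrite exists_Ssum.
    have hb : al < boot_tail x t.
      by have := kx x t gx; rewrite ler_norml => /andP[_]; lra.
    have := le_quantile c_gt0 (boot_tail_anti x) (boot_tail_small x) hb => tq.
    have ts : (t - dl) / c < stat x.
      apply: lt_le_trans rx; rewrite ltr_pdivrMr// mulrC; apply: lt_le_trans tq.
      by have := dl_gt0; lra.
    move: ts; rewrite lt_stat => /orP[|/existsP[k]].
      by rewrite pmulr_llt0 ?invr_gt0// => ?; apply/orP; left; have := dl_gt0; lra.
    rewrite ltr_pdivrMr// mulrC => hk; apply/orP; right; apply/existsP; exists k.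
    have /andP[] := dist_remainder _ k gx; lra.
  - move=> t hs; apply: split_bad => // x; rewrite exists_Ssum => tx gx.
    have hb : boot_tail x t <= al.
      by have := kx x t gx; rewrite ler_norml => /andP[+ _]; lra.
    have := quantile_le c_gt0 al1 (boot_tail_neg x) hb => qt.
    rewrite /boot_rejects leNgt; apply/negP => hlt.
    (* Read at its own value, the characterisation of [stat] says that it is nonnegative and
       dominates every coordinate. *)
    have := lt_stat x (stat x); rewrite ltxx => /esym/negbT.
    rewrite negb_or -leNgt => /andP[st0 /existsPn stk].
    have ct : c * stat x < t by apply: lt_le_trans qt; rewrite ltr_pM2l.
    have ct0 : 0 <= c * stat x by rewrite mulr_ge0// ltW.
    have dl0 := dl_gt0.
    case/orP: tx => [|/existsP[k]]; first by lra.
    have := stk k; rewrite -leNgt -(ler_pM2l c_gt0).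
    have /andP[] := dist_remainder _ k gx; lra.
(* The bound speaks of S alone, but it is available for a pair S, Y with close covariances; the
   residuals at [x0] supply such a Y. *)
have anti t : PT t - PT (t + dl) <= 4680 * (eps / C1).
  apply: (max_anti_concentration_signed k0 hiid n_gt0 (measurable_proj F mh h01)
    (normr_proj_le F mh h01) (proj_mean0 F mh h01) (normr_resid_le n_ge2 h01 x0) s_ge1 eps_gt0
    eps_small rn_eps C1_gt0 Gam_diag D_C1 _ ln_card).
  exact: resid_cov_close gx0.
apply: le_trans (core _ _ _ _ (fun x t => @kolmogorov_x x t) anti) (lerD (lexx _) bad_small).
  exact: mulr_ge0 (ler0n _ _) e0.
exact: mulr_ge0 (ler0n _ _) e0.
Qed.

End size.

(** The rejection event involves an infimum over a continuum of levels that depends on the data. It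
    is nevertheless a function of finitely many concordance indicators, hence a finite union of
    cells on which these are constant. *)
Lemma measurable_finite_dependence d (X : measurableType d) (I : finType)
    (b : I -> X -> bool) (c : X -> bool) :
  (forall i, measurable [set x | b i x]) ->
  (forall x y, (forall i, b i x = b i y) -> c x = c y) -> measurable [set x | c x].
Proof.
move=> mb bc.
pose hit (v : {ffun I -> bool}) x := [forall i, b i x == v i].
have mhit v : measurable [set x | hit v x].
  rewrite (_ : [set x | _] = ~` [set x | [exists i, b i x != v i]]).
    apply: measurableC; apply: measurable_existsb => i; case: (v i).
      rewrite (_ : [set x | _] = ~` [set x | b i x]); first exact: measurableC.
      by apply/seteqP; split=> x /=; [move=> /negP|move=> /negP]; rewrite eqb_id// => /negP.
    rewrite (_ : [set x | _] = [set x | b i x])//.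
    by apply/seteqP; split=> x /=; rewrite eqbF_neg negbK.
  apply/seteqP; split=> x /=.
    by move=> /forallP hx; apply/negP/existsPn => i; rewrite negbK.
  by move=> /negP/existsPn hx; apply/forallP => i; have := hx i; rewrite negbK.
pose good v := `[< exists2 y, hit v y & c y >].
rewrite (_ : [set x | _] = [set x | [exists v, good v && hit v x]]).
  apply: measurable_existsb => v; case: (good v) => /=; first exact: mhit.
  by rewrite (_ : [set x | _] = set0)//; apply/seteqP; split.
apply/seteqP; split=> x /=.
  move=> cx; apply/existsP; exists [ffun i => b i x]; apply/andP.
  have hx : hit [ffun i => b i x] x by apply/forallP => i; rewrite ffunE.
  by split=> //; apply/asboolP; exists x.
move=> /existsP[v /andP[/asboolP[y /forallP hy cy] /forallP hx]].
by rewrite (bc x y)// => i; rewrite (eqP (hx i)) (eqP (hy i)).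
Qed.

(** * Kendall's tau *)

Section kendall.
Context (R : realType) (p : nat).
Notation T := (p.-tuple R).
Notation offdiag := {mk : 'I_p * 'I_p | mk.1 != mk.2}.

(** Only off-diagonal entries are indexed: without ties a diagonal entry is constantly 1, and its
    vanishing variance would break the anti-concentration. *)
Definition kern (a b : T) (k : offdiag) : R :=
  kendall_kernel a b (val k).1 (val k).2.

Lemma kernE a b k : kern a b k =
  (0 < (tnth a (val k).1 - tnth b (val k).1) * (tnth a (val k).2 - tnth b (val k).2))%R%:R.
Proof. by rewrite /kern mxE. Qed.

Lemma measurable_concordant (m k : 'I_p) : measurable
  [set z : T * T | 0 < (tnth z.1 m - tnth z.2 m) * (tnth z.1 k - tnth z.2 k)].
Proof.
have mc (l : 'I_p) : measurable_fun setT (fun z : T * T => tnth z.1 l - tnth z.2 l).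
  apply: measurable_funB.
    by apply: (measurableT_comp (measurable_tnth l)); exact: measurable_fst.
  by apply: (measurableT_comp (measurable_tnth l)); exact: measurable_snd.
by apply: measurable_gtb; exact: measurable_funM.
Qed.

Lemma measurable_kern k : measurable_fun setT (fun z : T * T => kern z.1 z.2 k).
Proof.
rewrite (_ : (fun z => _) = \1_[set z : T * T |
  0 < (tnth z.1 (val k).1 - tnth z.2 (val k).1) * (tnth z.1 (val k).2 - tnth z.2 (val k).2)]).
  by apply: measurable_indic; exact: measurable_concordant.
by apply/funext => z; rewrite kernE indic_bool.
Qed.

Lemma kern_01 a b k : 0 <= kern a b k <= 1.
Proof. by rewrite kernE; case: (0 < _); rewrite lexx ler01. Qed.

Lemma kern_sym a b k : kern a b k = kern b a k.
Proof.
rewrite !kernE; congr ((0 < _)%R%:R).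
by rewrite -mulrNN !opprB.
Qed.

Variable F : probability T R.

Lemma normr_kern_le a b k : `|kern a b k| <= 1.
Proof. by have /andP[k0 k1] := kern_01 a b k; rewrite ger0_norm. Qed.

Lemma U_diamondE (k : offdiag) : U_diamond F (val k).1 (val k).2 = theta F kern k.
Proof.
by rewrite mxE unlock /theta -(integral_pair F F (measurable_kern k) (fun a b => normr_kern_le a b k)).
Qed.

Lemma hajekE (k : offdiag) a : hajek F a (val k).1 (val k).2 = proj F kern a k.
Proof. by rewrite mxE U_diamondE unlock. Qed.

Lemma GammaE (k : offdiag) : Gamma F (val k) (val k) = Gam F (proj F kern) k k.
Proof.
have e0 : fine 'E_F[fun x => proj F kern x k]%E = 0.
  by rewrite unlock; exact: (proj_mean0 F measurable_kern kern_01).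
rewrite /Gamma covariance.unlock.
rewrite (_ : (fun x => hajek F x (val k).1 (val k).2) = (fun x => proj F kern x k)); last first.
  by apply/funext => x; exact: hajekE.
rewrite e0 unlock.
congr fine; apply: eq_integral => a _.
by transitivity ((proj F kern a k - 0) * (proj F kern a k - 0))%:E => //; rewrite !subr0.
Qed.

Lemma lt_max_off (A : 'M[R]_p) t :
  (t < max_off A) = (t < 0) || [exists k : offdiag, t < `|A (val k).1 (val k).2|].
Proof.
apply/idP/idP; last first.
  case/orP => [t0|/existsP[[[m k] /= mk]]].
    by apply: lt_le_trans t0 _; exact: bigmax_ge_id.
  move/lt_le_trans; apply; apply: le_trans (le_bigmax_cond _ (fun k => `|A m k|) mk) _.
  exact: (le_bigmax _ (fun m => \big[Num.max/0]_(k < p | m != k) `|A m k|) m).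
rewrite ltNge; apply: contraNT; rewrite negb_or -leNgt => /andP[t0 /existsPn h].
apply: bigmax_le => // m _; apply: bigmax_le => // k mk.
by have := h (exist _ (m, k) mk); rewrite -leNgt.
Qed.

Variable n : nat.
Notation E := (T * measurableTypeR R)%type.
Notation data x := (fun i : 'I_n => (tnth x i).1).

Lemma U_statE (x : n.-tuple E) k : U_stat (data x) (val k).1 (val k).2 = ustat kern x k.
Proof.
rewrite /U_stat !mxE summxE /ustat invfM -mulrA; congr (_ * _).
rewrite mulr_sumr; apply: eq_bigr => i _; rewrite summxE /row; congr (_ * _).
Qed.

Lemma T_sharpE (x y : n.-tuple E) k :
  T_sharp (data x) (fun i => (tnth y i).2) (val k).1 (val k).2 = Ysum (resid kern x) y k.
Proof.
rewrite /T_sharp mxE summxE /Ysum; congr (_ * _); apply: eq_bigr => i _.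
rewrite 2!mxE; congr (_ * _); rewrite 2!mxE U_statE /resid; congr (_ * _ - _).
by rewrite summxE.
Qed.

Lemma lt_Tbar_sharp (n_gt0 : (0 < n)%N) (k0 : offdiag) (x y : n.-tuple E) t :
  (t < Tbar_sharp (data x) (fun i => (tnth y i).2)) =
  [exists j, Num.sqrt n%:R / 2 * t < Ysum (fun i => signed (resid kern x i)) y j].
Proof.
have sn : 0 < Num.sqrt (n%:R : R) by rewrite sqrtr_gt0 ltr0n.
transitivity (Num.sqrt n%:R / 2 * t < max_off (T_sharp (data x) (fun i => (tnth y i).2))).
  rewrite /Tbar_sharp -[in RHS](ltr_pM2l (_ : 0 < 2 * (Num.sqrt n%:R)^-1)); last first.
    by rewrite mulr_gt0// invr_gt0.
  congr (_ < _); by field; rewrite gt_eqF.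
rewrite lt_max_off (_ : [exists j, _] =
   [exists j, Num.sqrt n%:R / 2 * t < signed (Ysum (resid kern x) y) j]).
  rewrite (exists_signed _ k0); congr (_ || _).
  by apply: eq_existsb => k; rewrite T_sharpE.
apply: eq_existsb => j; congr (_ < _).
rewrite /Ysum /signed [RHS]mulrCA; congr (_ * _); rewrite mulr_sumr.
by apply: eq_bigr => i _; rewrite mulrCA.
Qed.

Definition test_stat (x : n.-tuple E) : R := max_off (U_stat (data x) - U_diamond F).

Lemma lt_test_stat x t : (t < test_stat x) =
  (t < 0) || [exists k, t < `|ustat kern x k - theta F kern k|].
Proof.
rewrite lt_max_off; congr (_ || _); apply: eq_existsb => k.
by rewrite mxE [X in _ + X]mxE U_statE U_diamondE.
Qed.

Lemma measurable_boot_rejects (mu : probability (n.-tuple E) R) (al : R) :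
  measurable [set x | boot_rejects mu kern test_stat al x].
Proof.
apply: (@measurable_finite_dependence _ _ ('I_n * 'I_n * ('I_p * 'I_p))%type
  (fun q (x : n.-tuple E) =>
    0 < (tnth (tnth x q.1.1).1 q.2.1 - tnth (tnth x q.1.2).1 q.2.1) *
        (tnth (tnth x q.1.1).1 q.2.2 - tnth (tnth x q.1.2).1 q.2.2))).
  move=> [[i l] [m k]] /=.
  have mg : measurable_fun setT (fun x : n.-tuple E => ((tnth x i).1, (tnth x l).1)).
    by apply: measurable_fun_pair; exact: measurable_coord1.
  have := mg measurableT _ (measurable_concordant m k).
  by rewrite setTI.
move=> x y hxy.
have kxy i l : kendall_kernel (tnth x i).1 (tnth x l).1 = kendall_kernel (tnth y i).1 (tnth y l).1.
  by apply/matrixP => m k; rewrite !mxE (hxy ((i, l), (m, k))).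
have Uxy : U_stat (data x) = U_stat (data y).
  by rewrite /U_stat; congr (_ *: _); apply: eq_bigr => i _; apply: eq_bigr => l _.
have rxy : resid kern x = resid kern y.
  apply/funext => i; apply/funext => k; rewrite /resid -!U_statE Uxy; congr (_ - _).
  by rewrite /row; congr (_ * _); apply: eq_bigr => l _; rewrite /kern kxy.
by rewrite /boot_rejects /test_stat Uxy /boot_tail rxy.
Qed.

End kendall.

(** * Transfer from the original probability space to the sample law *)

Section kendall_bootstrap.
Context (R : realType) (n p : nat).
Variables (F : probability (p.-tuple R) R) (d : measure_display) (Omega : measurableType d).
Variables (P : probability Omega R).
Variables (X : 'I_n -> {RV P >-> p.-tuple R}) (e : 'I_n -> {RV P >-> measurableTypeR R}).
Hypothesis n_gt0 : (0 < n)%N.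
Variable k0 : {mk : 'I_p * 'I_p | mk.1 != mk.2}.
Notation T := (p.-tuple R).
Notation E := (T * measurableTypeR R)%type.

Let mu := @sample_law _ _ T (measurableTypeR R) R _ Omega P n X e.
Let smp : Omega -> n.-tuple E := @sample _ _ T (measurableTypeR R) R _ Omega P n X e.

Let smp1 w : (fun i : 'I_n => (tnth (smp w) i).1) = (fun i => X i w).
Proof. by apply/funext => i; rewrite tnth_sample. Qed.

Let smp2 w : (fun i : 'I_n => (tnth (smp w) i).2) = (fun i => e i w).
Proof. by apply/funext => i; rewrite tnth_sample. Qed.

(** With the data fixed at [w], only the law of the multipliers counts, so the probability is
    computed under the sample law; strict exceedance is the complement of [<= t]. *)
Lemma boot_quantileE w al : boot_quantile P (fun i => e i) (fun i => X i w) (1 - al) =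
  inf [set t | 1 - al <= 1 - boot_tail mu (@kern R p) (smp w) (Num.sqrt n%:R / 2 * t)].
Proof.
rewrite /boot_quantile; congr inf; apply/seteqP.
pose A t := [set y : n.-tuple E | [exists j, Num.sqrt n%:R / 2 * t <
  Ysum (fun i => signed (resid (@kern R p) (smp w) i)) y j]].
have mA t : measurable (A t) by apply: measurable_exists_lt => j; exact: measurable_Ysum.
have PE t : P [set w' | Tbar_sharp (fun i => X i w) (fun i => e i w') <= t] =
   (1 - boot_tail mu (@kern R p) (smp w) (Num.sqrt n%:R / 2 * t))%:E.
  transitivity (mu (~` A t)).
    rewrite /mu /sample_law /distribution /pushforward /=; congr (P _).
    apply/seteqP; split => w' /=; rewrite -smp1 -smp2 leNgt (lt_Tbar_sharp n_gt0 k0).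
      by move=> /negP.
    by move=> h; apply/negP.
  by rewrite probability_setC// EFinB /boot_tail fineK//; exact: fin_num_measure (mA t).
by split=> t /=; rewrite PE lee_fin.
Qed.

Lemma boot_rejectsE al U0 : U_diamond F = U0 ->
  P [set w | boot_quantile P (fun i => e i) (fun i => X i w) (1 - al)
                      <= max_off (U_stat (fun i => X i w) - U0)] =
  mu [set x | boot_rejects mu (@kern R p) (test_stat F (n := n)) al x].
Proof.
move=> <-; rewrite /mu /sample_law /distribution /pushforward /=; congr (P _).
by apply/seteqP; split=> w /=; rewrite boot_quantileE /boot_rejects /test_stat smp1.
Qed.

End kendall_bootstrap.

(* The same function, with the sigma-algebra of [R] seen as that of [measurableTypeR R],
   the type carrying the library's normal law. *)
Definition borelRV d (Omega : measurableType d) (R : realType) (P : probability Omega R)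
    (e : {RV P >-> R}) : {RV P >-> measurableTypeR R} :=
  HB.pack (e : Omega -> measurableTypeR R)
    (isMeasurableFun.Build _ _ Omega (measurableTypeR R) e (@measurable_funPT _ _ _ _ e)).

Lemma card_offdiag p : (#|{: {mk : 'I_p * 'I_p | mk.1 != mk.2}}| <= p ^ 2)%N.
Proof.
rewrite card_sig; apply: leq_trans (max_card _) _.
by rewrite card_prod card_ord -mulnn.
Qed.

Lemma rate_bound (R : realType) (n : nat) (L C2 K : R) : (0 < n)%N -> 0 < L -> 0 < C2 ->
  L ^+ 7 <= C2 * n%:R `^ (1 - K) ->
  (L ^+ 7 / n%:R) `^ (6^-1) <= C2 `^ (6^-1) * n%:R `^ (- (K / 6)).
Proof.
move=> n0 L0 C20 hL; have nR : 0 < n%:R :> R by rewrite ltr0n.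
apply: le_trans (_ : (C2 * n%:R `^ (- K)) `^ (6^-1) <= _).
  apply: ge0_ler_powR.
  - by rewrite invr_ge0.
  - by rewrite nnegrE divr_ge0 ?exprn_ge0// ltW.
  - by rewrite nnegrE mulr_ge0 ?powR_ge0// ltW.
  rewrite ler_pdivrMr// -mulrA (_ : _ * n%:R = n%:R `^ (1 - K))//.
  rewrite powRD; last by apply/implyP => _; rewrite pnatr_eq0 -lt0n.
  by rewrite powRr1 ?ltW// mulrC.
rewrite powRM ?powR_ge0// ?(ltW C20)// ler_wpM2l ?powR_ge0//.
by rewrite -powRrM mulNr.
Qed.

Lemma rate_pow6 (R : realType) (x : R) : 0 <= x -> (x `^ (6^-1)) ^+ 6 = x.
Proof.
by move=> x0; rewrite -powR_mulrn ?powR_ge0// -powRrM mulVf ?powRr1// pnatr_eq0.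
Qed.

Theorem corollary4p4 (R : realType) (C1 C2 alpha beta K : R)
  (hC1 : 0 < C1) (hC2 : 0 < C2)
  (halpha : 0 < alpha < 1) (hbeta : 0 < beta < 1) (hK : 0 < K < 1) :
  exists C : R,
  forall (n p : nat), (4 <= n)%N -> (3 <= p ^ 2)%N ->
  ln (n * p)%N%:R ^+ 7 <= C2 * n%:R `^ (1 - K) ->
  forall (F : probability (p.-tuple R) R),
  (forall j k : 'I_p, j != k -> C1 <= Gamma F (j, k) (j, k)) ->
  forall (d : measure_display) (Omega : measurableType d)
    (P : probability Omega R)
    (X : 'I_n -> {RV P >-> p.-tuple R}) (e : 'I_n -> {RV P >-> R}),
  (forall i, has_law (X i) F) ->
  (forall i, has_law (e i) (normal_prob 0 1)) ->
  mutual_independence P (fun s : 'I_n + 'I_n =>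
    match s with inl i => sigma_of (X i) | inr i => sigma_of (e i) end) ->
  forall U0 : 'M[R]_p,
  U_diamond F = U0 ->
  `| fine (P [set w | boot_quantile P (fun i => e i) (fun i => X i w) (1 - alpha)
                      <= max_off (U_stat (fun i => X i w) - U0)])
     - alpha | <= C * n%:R `^ (- (K / 6)).
Proof.
have factor (a b c eps : R) :
  a * (eps / C1) + 3 * (b * (eps / C1)) + c * eps = (a / C1 + 3 * (b / C1) + c) * eps by ring.
have [M [M0 hM]] : exists M, 0 <= M /\ forall eps,
    17500 * (eps / C1) + 3 * (4680 * (eps / C1)) + 16 * eps = M * eps.
  exists (17500 / C1 + 3 * (4680 / C1) + 16); split.
    exact: addr_ge0 (addr_ge0 (divr_ge0 (ler0n _ _) (ltW hC1)) (mulr_ge0 (ler0n _ _)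
      (divr_ge0 (ler0n _ _) (ltW hC1)))) (ler0n _ _).
  exact: factor.
(* [M] serves when [16 * eps <= 1] and [eps <= C1]. If one of these fails, [(16 + C1^-1) * eps] is
   at least 1 and the trivial bound on a difference of two numbers in [0, 1] suffices. The factor in
   [C2] converts [eps] into the power of [n]. *)
exists ((M + (16 + C1^-1)) * C2 `^ (6^-1)).
move=> n p n4 p3 hL F hG d Omega P X e hX he indep U0 hU.
have n0 : (0 < n)%N by exact: leq_trans n4.
have n2 : (2 <= n)%N by exact: leq_trans n4.
(* [3 <= p ^ 2] excludes [p <= 1], so that an off-diagonal index exists. *)
have p2 : (2 <= p)%N by case: p p3 {hL F hG X e hX he indep U0 hU} => [|[|p]].
have nR : 0 < n%:R :> R by rewrite ltr0n.
have pR : 0 < p%:R :> R by rewrite ltr0n ltnW.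
pose L : R := ln (n * p)%:R.
have eL : expR L = n%:R * p%:R.
  by rewrite /L lnK natrM ?posrE ?mulr_gt0.
have L1 : 1 <= L.
  rewrite -ler_expR eL -natrM; apply: le_trans (expR1_le4 R) _.
  by rewrite ler_nat (leq_trans n4)// leq_pmulr// ltnW.
have L0 : 0 < L by exact: lt_le_trans L1.
pose s := Num.sqrt L; pose eps := (L ^+ 7 / n%:R) `^ (6^-1).
have s2 : s ^+ 2 = L by rewrite sqr_sqrtr// ltW.
have s1 : 1 <= s by rewrite -[leLHS]sqrtr1 ler_wsqrtr.
have s0 : 0 < s by exact: lt_le_trans s1.
have Ln0 : 0 < L ^+ 7 / n%:R by rewrite divr_gt0// exprn_gt0.
have eps0 : 0 < eps by exact: powR_gt0 Ln0.
have eps6 : eps ^+ 6 = L ^+ 7 / n%:R := rate_pow6 (ltW Ln0).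
have rnE : rn R n = eps ^+ 3 / s ^+ 7.
  apply/eqP; rewrite -(@eqrXn2 _ 2)//; last 2 first.
  - by rewrite ltW// rn_gt0.
  - by rewrite divr_ge0 ?exprn_ge0// ltW.
  have -> : (eps ^+ 3 / s ^+ 7) ^+ 2 = eps ^+ 6 / (s ^+ 2) ^+ 7 by field; rewrite gt_eqF.
  rewrite eps6 s2 mulrAC divff ?mul1r; last by rewrite expf_neq0// gt_eqF.
  by rewrite /rn exprVn sqr_sqrtr// ltW.
pose m0 : 'I_p := widen_ord p2 0; pose m1 : 'I_p := widen_ord p2 1.
pose k0 : {mk : 'I_p * 'I_p | mk.1 != mk.2} := exist _ (m0, m1) isT.
pose e' i := borelRV (e i).
have hiid : iid_law (sample_law X e') (F \x normal_prob 0 1)%E.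
  by apply: sample_law_iid hX _ _; [exact: he|exact: indep].
have -> := boot_rejectsE X e' n0 k0 alpha hU.
apply: le_trans (_ : (M + (16 + C1^-1)) * eps <= _); last first.
  rewrite -mulrA ler_wpM2l ?addr_ge0 ?invr_ge0 ?(ltW hC1)//.
  exact: rate_bound.
have mrej := measurable_boot_rejects F (sample_law X e') alpha.
have [|hbig] := boolP ((16 * eps <= 1) && (eps <= C1)).
  move=> /andP[e16 eC1].
  have Gd k : C1 <= Gam F (proj F (@kern R p)) k k.
    by rewrite -GammaE; case: k => [[j k] /= jk]; exact: hG.
  have p1 : 1 <= p%:R :> R by rewrite ler1n ltnW.
  have cq : #|{: {mk : 'I_p * 'I_p | mk.1 != mk.2}}|%:R <= p%:R ^+ 2 :> R.
    by rewrite -natrX ler_nat card_offdiag.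
  have es : expR (s ^+ 2) = n%:R * p%:R by rewrite s2.
  have := bootstrap_size k0 hiid n2 (@measurable_kern R p) (@kern_01 R p) (@kern_sym R p)
    (lt_test_stat F (n := n)) halpha mrej s1 eps0 e16 eC1 rnE Gd p1 cq n4 es.
  move/le_trans; apply.
  by rewrite hM mulrDl lerDl mulr_ge0 ?addr_ge0 ?invr_ge0 ?(ltW hC1)// ltW.
apply: le_trans (_ : 1 <= _).
  have pr0 : 0 <= fine (sample_law X e' [set x | boot_rejects (sample_law X e') (@kern R p) (test_stat F (n := n)) alpha x]).
    exact: fine_ge0.
  have pr1 : fine (sample_law X e' [set x | boot_rejects (sample_law X e') (@kern R p) (test_stat F (n := n)) alpha x]) <= 1.
    by rewrite -lee_fin fineK ?probability_le1// fin_num_measure.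
  move: (fine _) pr0 pr1 => q q0 q1; have /andP[a0 a1] := halpha.
  rewrite ler_norml; apply/andP; clear -q0 q1 a0 a1; split; lra.
have h1' : 1 <= (16 + C1^-1) * eps.
  rewrite mulrDl; move: hbig; rewrite negb_and -!ltNge => /orP[h|h].
    by apply: le_trans (ltW h) _; rewrite lerDl mulr_ge0 ?invr_ge0// ltW.
  apply: le_trans (_ : C1^-1 * eps <= _); last by rewrite lerDr mulr_ge0// ltW.
  by rewrite mulrC ler_pdivlMr// mul1r ltW.
by apply: le_trans h1' _; rewrite [leRHS]mulrDl lerDr mulr_ge0// ltW.
Qed.
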